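(* Let $\mathfrak{g}$ be a Leibniz algebra and let $V_{\mathfrak g}=U(L(\mathfrak{g}_{Lie}))\otimes_{U(L(\mathfrak{g}_{Lie})^+)}\mathfrak{g}$ be the induced $L(\mathfrak g)$-module. For $a\in\mathfrak g$ set $a(x)=\sum_{n\in\mathbb{Z}}(a\otimes t^n)x^{-n-1}$. Then there exists a vertex Leibniz algebra structure on $V_{\mathfrak g}$, which is uniquely determined by the condition that $Y(a,x)=a(x)$ for $a\in\mathfrak{g}$. Furthermore, for any restricted $L(\mathfrak g)$-module $W$, there is a $V_{\mathfrak g}$-module structure $Y_W(\cdot,x)$ on $W$, which is uniquely determined by the condition that $Y_W(a,x)=a(x)$ for $a\in\mathfrak{g}$.
   Context: All vector spaces are over $\mathbb{C}$. $V((x))$ denotes the space of lower truncated formal Laurent series, $\delta(x)=\sum_{n\in\mathbb{Z}}x^n$, and powers $(x\pm y)^n$ are expanded in nonnegative integer powers of the second variable $y$. A vertex Leibniz algebra is a vector space $V$ with a linear map $Y(\cdot,x):V\to\mathrm{Hom}(V,V((x)))$, $v\mapsto Y(v,x)=\sum_{n\in\mathbb{Z}}v_nx^{-n-1}$, such that for all $u,v\in V$ the Jacobi identity holds: $$x_0^{-1}\delta\left(\tfrac{x_1-x_2}{x_0}\right)Y(u,x_1)Y(v,x_2)-x_0^{-1}\delta\left(\tfrac{x_2-x_1}{-x_0}\right)Y(v,x_2)Y(u,x_1)=x_2^{-1}\delta\left(\tfrac{x_1-x_0}{x_2}\right)Y(Y(u,x_0)v,x_2).$$ A $V$-module is a vector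 space $W$ with a linear map $Y_W(\cdot,x):V\to\mathrm{Hom}(W,W((x)))$ such that for all $u,v\in V$ $$x_0^{-1}\delta\left(\tfrac{x_1-x_2}{x_0}\right)Y_W(u,x_1)Y_W(v,x_2)-x_0^{-1}\delta\left(\tfrac{x_2-x_1}{-x_0}\right)Y_W(v,x_2)Y_W(u,x_1)=x_2^{-1}\delta\left(\tfrac{x_1-x_0}{x_2}\right)Y_W(Y(u,x_0)v,x_2).$$ A (left) Leibniz algebra is a vector space $\mathfrak g$ with a bilinear product $[\cdot,\cdot]$ satisfying $[a,[b,c]]=[[a,b],c]+[b,[a,c]]$. The span of all $[a,a]$ is a two-sided ideal, and $\mathfrak g_{Lie}$ is the quotient Lie algebra. $L(\mathfrak g)=\mathfrak g\otimes\mathbb{C}[t,t^{-1}]$ is the Leibniz algebra with $[a\otimes t^m,b\otimes t^n]=[a,b]\otimes t^{m+n}$; $L(\mathfrak g)_{Lie}\cong L(\mathfrak g_{Lie})$. A (left) module for a Leibniz algebra $\mathfrak g$ is a vector space $W$ with a left action such that $a(bw)-b(aw)=[a,b]w$; this is the same as a module for the Lie algebra $\mathfrak g_{Lie}$. An $L(\mathfrak g)$-module $W$ is restricted if for all $a\in\mathfrak g$, $w\in W$ one has $(a\otimes t^n)w=0$ for $n$ sufficiently large; on such $W$, $a(x)$ is viewed as an element of $\mathrm{Hom}(W,W((x)))$. Construction of $V_{\mathfrak g}$: $\mathfrak g$ is a left $\mathfrak g$-module by left multiplication, hence a $\mathfrak g_{Lie}$-module. Let $\mathfrak g_{Lie}\otimes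 t\mathbb{C}[t]$ act trivially on $\mathfrak g$, making it a module for $L(\mathfrak g_{Lie})^+=\mathfrak g_{Lie}\otimes\mathbb{C}[t]$. Then $V_{\mathfrak g}$ is the induced $L(\mathfrak g_{Lie})$-module displayed in the claim ($U(\cdot)$ denotes the universal enveloping algebra); it is a restricted $L(\mathfrak g)$-module, and $\mathfrak g$ is identified with the subspace $1\otimes\mathfrak g$. *)

(* Defs.v *)
From HB Require Import structures.
From mathcomp Require Import all_boot all_order all_algebra.
From mathcomp Require Import finmap.
From mathcomp Require Import boolp classical_sets cardinality fsbigop reals complex.
From mathcomp Require Import monalg.

Set Implicit Arguments.
Unset Strict Implicit.
Unset Printing Implicit Defensive.

Import GRing.Theory.

Local Open Scope classical_set_scope.
Local Open Scope quotient_scope.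
Local Open Scope ring_scope.

Section LinearFacts.
Variables (K : fieldType) (V W : lmodType K) (f : V -> W).
Hypothesis flin : linear f.
Lemma lin0 : f 0 = 0.
Proof. by move: (flin (-1) 0 0); rewrite scaler0 addr0 scaleN1r addNr. Qed.
Lemma linD u v : f (u + v) = f u + f v.
Proof. by rewrite -[u]scale1r flin !scale1r. Qed.
Lemma linZ c u : f (c *: u) = c *: f u.
Proof. by rewrite -[c *: u]addr0 flin lin0 addr0. Qed.
Lemma linB u v : f (u - v) = f u - f v.
Proof. by rewrite -scaleN1r linD linZ scaleN1r. Qed.
End LinearFacts.

Section Span.
Variables (K : fieldType) (V : lmodType K) (G : set V).

Inductive in_span : V -> Prop :=
| in_span_gen v of G v : in_span v
| in_span0 : in_span 0
| in_spanD c u v of in_span u & in_span v : in_span (c *: u + v).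

Definition lspan : {pred V} := fun v => `[< in_span v >].

Lemma lspan_submod : submod_closed lspan.
Proof.
split; first by apply/asboolP; exact: in_span0.
by move=> c u v /asboolP hu /asboolP hv; apply/asboolP; exact: in_spanD.
Qed.
HB.instance Definition _ := GRing.isSubmodClosed.Build K V lspan lspan_submod.

End Span.

(* V / span G *)
Definition lquot (K : fieldType) (V : lmodType K) (G : set V) : Type :=
  Quotient.quot (lspan G).

(* Constants are locked where their unfolding would make unification diverge. *)
HB.lock Definition lpi (K : fieldType) (V : lmodType K) (G : set V) : V -> lquot G :=
  \pi_(Quotient.quot (lspan G)).
HB.lock Definition lrepr (K : fieldType) (V : lmodType K) (G : set V) : lquot G -> V :=
  repr.

HB.lock Definition lquot_scale (K : fieldType) (V : lmodType K) (G : set V)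
    (c : K) (x : lquot G) : lquot G := lpi G (c *: lrepr x).

Section QuotLmod.
Variables (K : fieldType) (V : lmodType K) (G : set V).
Local Notation lquot := (lquot G).
Local Notation lpi := (@lpi K V G).
Local Notation lrepr := (@lrepr K V G).
Local Notation lquot_scale := (@lquot_scale K V G).

HB.instance Definition _ := Choice.on lquot.
HB.instance Definition _ := GRing.Zmodule.on lquot.

Lemma lreprK x : lpi (lrepr x) = x.
Proof. by rewrite lpi.unlock lrepr.unlock reprK. Qed.

Lemma lpi_eqP u v : reflect (lpi u = lpi v) (u - v \in lspan G).
Proof. by rewrite Quotient.idealrBE lpi.unlock; exact: eqP. Qed.

Lemma lpiD u v : lpi (u + v) = lpi u + lpi v.
Proof. by rewrite lpi.unlock; exact: (raddfD (\pi_(Quotient.quot (lspan G)))). Qed.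

Lemma lquot_scale_pi c u : lquot_scale c (lpi u) = lpi (c *: u).
Proof.
rewrite lquot_scale.unlock; apply/lpi_eqP.
by rewrite -scalerBr rpredZ //; apply/lpi_eqP/lreprK.
Qed.

Lemma lquot_scaleA a b x : lquot_scale a (lquot_scale b x) = lquot_scale (a * b) x.
Proof. by rewrite -[x]lreprK !lquot_scale_pi scalerA. Qed.
Lemma lquot_scale1 : left_id 1 lquot_scale.
Proof. by move=> x; rewrite -[x]lreprK !lquot_scale_pi scale1r. Qed.
Lemma lquot_scaleDr : right_distributive lquot_scale +%R.
Proof.
by move=> a x y; rewrite -[x]lreprK -[y]lreprK -lpiD !lquot_scale_pi -lpiD scalerDr.
Qed.
Lemma lquot_scaleDl x : {morph lquot_scale^~ x : a b / a + b}.
Proof. by move=> a b; rewrite -[x]lreprK !lquot_scale_pi -lpiD scalerDl. Qed.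
HB.instance Definition _ := GRing.Zmodule_isLmodule.Build K lquot
  lquot_scaleA lquot_scale1 lquot_scaleDr lquot_scaleDl.

Lemma lpi_is_linear : linear lpi.
Proof. by move=> c u v; rewrite lpiD -lquot_scale_pi. Qed.
HB.instance Definition _ := GRing.isLinear.Build K V lquot *:%R lpi lpi_is_linear.

Lemma lpi_gen u : G u -> lpi u = 0.
Proof.
move=> Gu; rewrite -[RHS](raddf0 lpi); apply/lpi_eqP; rewrite subr0.
by apply/asboolP; exact: in_span_gen.
Qed.

Lemma lquot_lift (W : lmodType K) (f : V -> W) : linear f -> (forall v, G v -> f v = 0) ->
  forall u v, lpi u = lpi v -> f u = f v.
Proof.
move=> flin fG u v /lpi_eqP/asboolP uv.
have fs w : in_span G w -> f w = 0.
  elim=> [x /fG //||c x y _ fx _ fy]; first exact: lin0.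
  by rewrite flin fx fy scaler0 addr0.
by rewrite -[u](subrK v) -[u - v]scale1r flin (fs _ uv) scaler0 add0r.
Qed.
End QuotLmod.

HB.lock Definition gsum (X : choiceType) (G W : zmodType) (f : X -> G -> W)
    (m : {malg G[X]}) : W :=
  \sum_(x <- msupp m) f x m@_x.

Section GSum.
Variables (X : choiceType) (G W : zmodType).

Lemma malg_elim (P : {malg G[X]} -> Prop) :
  P 0 -> (forall x a, P << a *g x >>) ->
  (forall u v, P u -> P v -> P (u + v)) -> forall m, P m.
Proof.
by move=> P0 P1 PD m; rewrite [m]monalgE; elim/big_rec: _ => // x u _ Pu; exact: PD.
Qed.

Variable f : X -> G -> W.
Hypothesis fD : forall x, {morph f x : a b / a + b}.

Let f0 x : f x 0 = 0.
Proof. by apply: (addrI (f x 0)); rewrite -fD !addr0. Qed.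

Lemma gsumEw (d : {fset X}) m :
  (msupp m `<=` d)%fset -> gsum f m = \sum_(x <- d) f x m@_x.
Proof.
move=> le; rewrite gsum.unlock; apply: big_fset_incl => //= x _.
by move=> /mcoeff_outdom ->; rewrite f0.
Qed.

Lemma gsumU x a : gsum f << a *g x >> = f x a.
Proof. by rewrite (gsumEw msuppU_le) big_seq_fset1 mcoeffUU. Qed.

Lemma gsumD : {morph gsum f : u v / u + v}.
Proof.
move=> u v; rewrite (gsumEw (msuppD_le u v)).
rewrite (gsumEw (fsubsetUl (msupp u) (msupp v))).
rewrite (gsumEw (fsubsetUr (msupp u) (msupp v))) -big_split /=.
by apply: eq_bigr => x _; rewrite mcoeffD fD.
Qed.

Lemma gsum0 : gsum f 0 = 0.
Proof. by rewrite gsum.unlock msupp0 big_seq_fset0. Qed.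
End GSum.

Section LinExt.
Variables (K : fieldType) (X : choiceType) (W : lmodType K).

Definition linext (f : X -> W) : {malg K[X]} -> W := gsum (fun x c => c *: f x).

Lemma linextUc f c x : linext f << c *g x >> = c *: f x.
Proof. by rewrite /linext gsumU // => y a b; rewrite scalerDl. Qed.
Lemma linextU f x : linext f << x >> = f x.
Proof. by rewrite linextUc scale1r. Qed.

Lemma linext_is_linear f : linear (linext f).
Proof.
have D x : {morph (fun c => c *: f x) : a b / a + b} by move=> a b; rewrite scalerDl.
move=> c u v; rewrite /linext gsumD //; congr (_ + _).
elim/malg_elim: u => [|x a|u u' IHu IHu'].
- by rewrite scaler0 gsum0 scaler0.
- have -> : c *: << a *g x >> = << c * a *g x >> :> {malg K[X]}.
    by apply/malgP => k; rewrite mcoeffZ !mcoeffU mulrnAr.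
  by rewrite !gsumU // scalerA.
by rewrite scalerDr !gsumD // IHu IHu' scalerDr.
Qed.

HB.instance Definition _ f :=
  GRing.isLinear.Build K {malg K[X]} W *:%R (linext f) (linext_is_linear f).
End LinExt.

HB.mixin Record Lmodule_isLeibniz (K : fieldType) V of GRing.Lmodule K V := {
  lbr : V -> V -> V;
  lbr_linearl : forall b, linear (fun a => lbr a b);
  lbr_linearr : forall a, linear (lbr a);
  lbr_leibniz : forall a b c, lbr a (lbr b c) = lbr (lbr a b) c + lbr b (lbr a c)
}.
#[short(type="leibnizType")]
HB.structure Definition Leibniz (K : fieldType) :=
  { V of GRing.Lmodule K V & Lmodule_isLeibniz K V }.

HB.mixin Record Leibniz_isLie (K : fieldType) V of Leibniz K V := {
  lbrxx : forall a : V, lbr a a = 0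
}.
#[short(type="lieType")]
HB.structure Definition Lie (K : fieldType) :=
  { V of Leibniz K V & Leibniz_isLie K V }.

Section LeibnizTheory.
Variables (K : fieldType) (g : leibnizType K).
Implicit Types a b c : g.

Lemma lbrDl b : {morph (fun a => lbr a b) : x y / x + y}.
Proof. by move=> x y; move: (lbr_linearl b 1 x y); rewrite !scale1r. Qed.
Lemma lbrDr a : {morph lbr a : x y / x + y}.
Proof. by move=> x y; move: (lbr_linearr a 1 x y); rewrite !scale1r. Qed.
Lemma lbr0l b : lbr 0 b = 0.
Proof. by apply: (addrI (lbr 0 b)); rewrite -lbrDl !addr0. Qed.
Lemma lbr0r a : lbr a 0 = 0.
Proof. by apply: (addrI (lbr a 0)); rewrite -lbrDr !addr0. Qed.
Lemma lbrZl k a b : lbr (k *: a) b = k *: lbr a b.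
Proof. by move: (lbr_linearl b k a 0); rewrite !addr0 lbr0l addr0. Qed.
Lemma lbrZr k a b : lbr a (k *: b) = k *: lbr a b.
Proof. by move: (lbr_linearr a k b 0); rewrite !addr0 lbr0r addr0. Qed.
Lemma lbr_sq a b : lbr (lbr a a) b = 0.
Proof. by apply: (addIr (lbr a (lbr a b))); rewrite -lbr_leibniz add0r. Qed.
End LeibnizTheory.

Lemma lbrC (K : fieldType) (g : lieType K) (a b : g) : lbr a b + lbr b a = 0.
Proof.
by move: (lbrxx (a + b)); rewrite lbrDl !lbrDr !lbrxx add0r addr0.
Qed.

Section LieQuotient.
Variables (K : fieldType) (g : leibnizType K).

(* The span of the squares is already a two-sided ideal. *)
Definition squares : set g := [set x | exists a, x = lbr a a].
Definition gLie : Type := lquot squares.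
HB.instance Definition _ := GRing.Lmodule.on gLie.

Definition toLie : g -> gLie := @lpi K g squares.
HB.instance Definition _ := GRing.Linear.on toLie.

Definition gLie_act (x : gLie) (a : g) : g := lbr (lrepr x) a.
Definition gLie_br (x y : gLie) : gLie := toLie (gLie_act x (lrepr y)).

Lemma gLie_act_toLie a b : gLie_act (toLie a) b = lbr a b.
Proof.
apply: (@lquot_lift _ _ squares _ (fun a => lbr a b)); last exact: lreprK.
  exact: lbr_linearl.
by move=> _ [c ->]; exact: lbr_sq.
Qed.

Lemma gLie_br_toLie a b : gLie_br (toLie a) (toLie b) = toLie (lbr a b).
Proof.
rewrite /gLie_br gLie_act_toLie.
apply: (@lquot_lift _ _ squares _ (fun b => toLie (lbr a b))); last exact: lreprK.
  by move=> c x y; rewrite lbr_linearr linearP.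
move=> _ [c ->]; rewrite lbr_leibniz; set d := lbr a c.
have sq x : toLie (lbr x x) = 0 by apply: lpi_gen; exists x.
by move: (sq (d + c)); rewrite lbrDl !lbrDr !raddfD /= !sq add0r addr0.
Qed.

Lemma toLieK (x : gLie) : exists a, x = toLie a.
Proof. by exists (lrepr x); rewrite /toLie lreprK. Qed.

Lemma gLie_br_linearl y : linear (fun x => gLie_br x y).
Proof.
have [b ->] := toLieK y => c x x'; have [a ->] := toLieK x; have [a' ->] := toLieK x'.
by rewrite -linearP !gLie_br_toLie lbr_linearl linearP.
Qed.
Lemma gLie_br_linearr x : linear (gLie_br x).
Proof.
have [b ->] := toLieK x => c y y'; have [a ->] := toLieK y; have [a' ->] := toLieK y'.
by rewrite -linearP !gLie_br_toLie lbr_linearr linearP.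
Qed.
Lemma gLie_br_leibniz x y z :
  gLie_br x (gLie_br y z) = gLie_br (gLie_br x y) z + gLie_br y (gLie_br x z).
Proof.
have [a ->] := toLieK x; have [b ->] := toLieK y; have [c ->] := toLieK z.
by rewrite !gLie_br_toLie lbr_leibniz raddfD.
Qed.
HB.instance Definition _ := Lmodule_isLeibniz.Build K gLie
  gLie_br_linearl gLie_br_linearr gLie_br_leibniz.

Lemma gLie_brxx (x : gLie) : lbr x x = 0.
Proof.
by have [a ->] := toLieK x; rewrite [LHS]gLie_br_toLie; apply: lpi_gen; exists a.
Qed.
HB.instance Definition _ := Leibniz_isLie.Build K gLie gLie_brxx.
End LieQuotient.

Section Loop.
Variables (K : fieldType) (D : nmodType).

(* g (x) K[t^D], a finitely supported family of elements of g;           *)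
(* << a *g n >> is a (x) t^n.  L(g) is loop int g, L(g)^+ is loop nat g. *)
Definition loop (g : lmodType K) : Type := {malg g[D]}.

Section Lmodule.
Variable g : lmodType K.
Implicit Types x y z : loop g.
HB.instance Definition _ := GRing.Zmodule.on (loop g).

Definition loop_scale (c : K) x : loop g := gsum (fun n a => << c *: a *g n >>) x.

Lemma loop_scaleE c x n : (loop_scale c x)@_n = c *: x@_n.
Proof.
have cD (m : D) : {morph (fun a : g => << c *: a *g m >>) : a b / a + b}.
  by move=> a b; rewrite scalerDr monalgUD.
elim/malg_elim: x => [|m a|u v IHu IHv].
- by rewrite /loop_scale gsum0 !mcoeff0 scaler0.
- by rewrite /loop_scale gsumU // !mcoeffU scalerMnr.
by rewrite /loop_scale gsumD // !mcoeffD -!/(loop_scale _ _) IHu IHv scalerDr.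
Qed.

Lemma loopP x y : (forall n, x@_n = y@_n) -> x = y.
Proof. by move/malgP. Qed.

Lemma loop_scaleA a b x : loop_scale a (loop_scale b x) = loop_scale (a * b) x.
Proof. by apply: loopP => n; rewrite !loop_scaleE scalerA. Qed.
Lemma loop_scale1 : left_id 1 loop_scale.
Proof. by move=> x; apply: loopP => n; rewrite !loop_scaleE scale1r. Qed.
Lemma loop_scaleDr : right_distributive loop_scale +%R.
Proof.
by move=> a x y; apply: loopP => n; rewrite loop_scaleE !mcoeffD !loop_scaleE scalerDr.
Qed.
Lemma loop_scaleDl x : {morph loop_scale^~ x : a b / a + b}.
Proof.
by move=> a b; apply: loopP => n; rewrite loop_scaleE !mcoeffD !loop_scaleE scalerDl.
Qed.
HB.instance Definition _ := GRing.Zmodule_isLmodule.Build K (loop g)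
  loop_scaleA loop_scale1 loop_scaleDr loop_scaleDl.

Lemma loopZU c a n : c *: (<< a *g n >> : loop g) = << c *: a *g n >>.
Proof. by apply: loopP => k; rewrite loop_scaleE !mcoeffU scalerMnr. Qed.

End Lmodule.

Section Bracket.
Variable g : leibnizType K.
Implicit Types x y z : loop g.

Definition loop_br x y : loop g :=
  gsum (fun m a => gsum (fun n b => << lbr a b *g m + n >>) y) x.

Let inD (m : D) a : forall n, {morph (fun b : g => << lbr a b *g m + n >>) : b b' / b + b'}.
Proof. by move=> n b b'; rewrite lbrDr monalgUD. Qed.

Let outD y : forall m,
  {morph (fun a => gsum (fun n b => << lbr a b *g m + n >>) y) : a a' / a + a'}.
Proof.
move=> m a a'; elim/malg_elim: y => [|n b|u v IHu IHv].
- by rewrite !gsum0 addr0.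
- by rewrite !gsumU // lbrDl monalgUD.
by rewrite !gsumD // IHu IHv addrACA.
Qed.

Lemma loop_brU a b m n :
  loop_br << a *g m >> << b *g n >> = << lbr a b *g m + n >>.
Proof. by rewrite /loop_br !gsumU. Qed.

Lemma loop_brDl y : {morph loop_br^~ y : x x' / x + x'}.
Proof. exact: gsumD. Qed.

Lemma loop_brDr x : {morph loop_br x : y y' / y + y'}.
Proof.
move=> y y'; elim/malg_elim: x => [|m a|u v IHu IHv].
- by rewrite /loop_br !gsum0 addr0.
- by rewrite /loop_br !gsumU // gsumD.
by rewrite !loop_brDl IHu IHv addrACA.
Qed.

Lemma loop_br0l y : loop_br 0 y = 0. Proof. exact: gsum0. Qed.
Lemma loop_br0r x : loop_br x 0 = 0.
Proof. by apply: (addrI (loop_br x 0)); rewrite -loop_brDr !addr0. Qed.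

Lemma loop_brZl c x y : loop_br (c *: x) y = c *: loop_br x y.
Proof.
elim/malg_elim: x => [|m a|u v IHu IHv].
- by rewrite scaler0 loop_br0l scaler0.
- elim/malg_elim: y => [|n b|u v IHu IHv].
  + by rewrite !loop_br0r scaler0.
  + by rewrite loopZU !loop_brU loopZU lbrZl.
  by rewrite !loop_brDr scalerDr IHu IHv.
by rewrite scalerDr !loop_brDl scalerDr IHu IHv.
Qed.

Lemma loop_brZr c x y : loop_br x (c *: y) = c *: loop_br x y.
Proof.
elim/malg_elim: x => [|m a|u v IHu IHv].
- by rewrite !loop_br0l scaler0.
- elim/malg_elim: y => [|n b|u v IHu IHv].
  + by rewrite scaler0 !loop_br0r scaler0.
  + by rewrite loopZU !loop_brU loopZU lbrZr.
  by rewrite scalerDr !loop_brDr scalerDr IHu IHv.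
by rewrite !loop_brDl scalerDr IHu IHv.
Qed.

Lemma loop_br_linearl y : linear (fun x => loop_br x y).
Proof. by move=> c x x'; rewrite loop_brDl loop_brZl. Qed.
Lemma loop_br_linearr x : linear (loop_br x).
Proof. by move=> c y y'; rewrite loop_brDr loop_brZr. Qed.

Lemma loop_br_leibniz x y z :
  loop_br x (loop_br y z) = loop_br (loop_br x y) z + loop_br y (loop_br x z).
Proof.
elim/malg_elim: x => [|m a|u v IHu IHv].
- by rewrite !loop_br0l loop_br0r addr0.
- elim/malg_elim: y => [|n b|u v IHu IHv].
  + by rewrite !(loop_br0l, loop_br0r) addr0.
  + elim/malg_elim: z => [|p c|u v IHu IHv].
    * by rewrite !loop_br0r addr0.
    * by rewrite !loop_brU lbr_leibniz monalgUD addrA [n + (m + p)]addrCA addrA.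
    by rewrite !loop_brDr IHu IHv addrACA.
  by rewrite !(loop_brDl, loop_brDr) IHu IHv addrACA.
by rewrite !(loop_brDl, loop_brDr) IHu IHv addrACA.
Qed.
HB.instance Definition _ := Lmodule_isLeibniz.Build K (loop g)
  loop_br_linearl loop_br_linearr loop_br_leibniz.
End Bracket.

Section LieBracket.
Variable g : lieType K.
Implicit Types x y : loop g.

Lemma loop_br_anti x y : loop_br x y + loop_br y x = 0.
Proof.
elim/malg_elim: x => [|m a|u v IHu IHv].
- by rewrite loop_br0l loop_br0r addr0.
- elim/malg_elim: y => [|n b|u v IHu IHv].
  + by rewrite loop_br0l loop_br0r addr0.
  + by rewrite !loop_brU [n + m]addrC -monalgUD lbrC monalgU0.
  by rewrite loop_brDl loop_brDr addrACA IHu IHv addr0.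
by rewrite loop_brDl loop_brDr addrACA IHu IHv addr0.
Qed.

Lemma loop_brxx x : lbr x x = 0.
Proof.
change (loop_br x x = 0); elim/malg_elim: x => [|m a|u v IHu IHv].
- exact: loop_br0l.
- by rewrite loop_brU lbrxx monalgU0.
by rewrite loop_brDl !loop_brDr IHu IHv add0r addr0 loop_br_anti.
Qed.
HB.instance Definition _ := Leibniz_isLie.Build K (loop g) loop_brxx.
End LieBracket.
End Loop.

Section LoopMap.
Variables (K : fieldType) (D D' : nmodType) (g g' : lmodType K).

(* a (x) t^n |-> phi a (x) t^(i n) *)
Definition loop_map (i : D -> D') (phi : g -> g') (x : loop D g) : loop D' g' :=
  gsum (fun n a => << phi a *g i n >>) x.
End LoopMap.

Definition lie_morph (K : fieldType) (g g' : leibnizType K) (f : g -> g') : Prop :=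
  linear f /\ forall a b, f (lbr a b) = lbr (f a) (f b).

Lemma loop_map_morph (K : fieldType) (D D' : nmodType) (g g' : leibnizType K)
    (i : D -> D') (phi : g -> g') :
  {morph i : m n / m + n} -> lie_morph phi -> lie_morph (loop_map i phi).
Proof.
move=> iD [lphi bphi].
have phiD : {morph phi : a b / a + b}.
  by move=> a b; move: (lphi 1 a b); rewrite !scale1r.
have phi0 : phi 0 = 0 by apply: (addrI (phi 0)); rewrite -phiD !addr0.
have phiZ c a : phi (c *: a) = c *: phi a by rewrite -[c *: a]addr0 lphi phi0 addr0.
have fD n : {morph (fun a : g => << phi a *g i n >>) : a b / a + b}.
  by move=> a b; rewrite phiD monalgUD.
have mU a n : loop_map i phi << a *g n >> = << phi a *g i n >> by rewrite /loop_map gsumU.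
have mD : {morph loop_map i phi : x y / x + y} by exact: gsumD.
have m0 : loop_map i phi 0 = 0 by exact: gsum0.
split=> [c x y|x y].
  rewrite mD; congr (_ + _); elim/malg_elim: x => [|n a|u v IHu IHv].
  - by rewrite scaler0 m0 scaler0.
  - by rewrite loopZU !mU loopZU phiZ.
  by rewrite scalerDr !mD IHu IHv scalerDr.
change (loop_map i phi (loop_br x y) = loop_br (loop_map i phi x) (loop_map i phi y)).
elim/malg_elim: x => [|m a|u v IHu IHv].
- by rewrite loop_br0l m0 loop_br0l.
- elim/malg_elim: y => [|n b|u v IHu IHv].
  + by rewrite loop_br0r m0 loop_br0r.
  + by rewrite loop_brU !mU loop_brU bphi iD.
  by rewrite loop_brDr !mD loop_brDr IHu IHv.
by rewrite loop_brDl !mD loop_brDl IHu IHv.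
Qed.

Section LeibnizModule.
Variables (K : fieldType) (g : leibnizType K) (W : lmodType K).

Record leibniz_module (act : g -> W -> W) : Prop := LeibnizModule {
  lmod_linearl : forall w, linear (fun a => act a w);
  lmod_linearr : forall a, linear (act a);
  lmod_br : forall a b w, act a (act b w) - act b (act a w) = act (lbr a b) w
}.
End LeibnizModule.

(* The free associative unital algebra on the set X, with basis the words in X.  *)
(* Words are plain sequences rather than {fmonom X}: the canonical ring structure *)
(* of {malg K[{fmonom X}]} makes unification very slow.                           *)
Definition freealg (K : fieldType) (X : choiceType) : Type := {malg K[seq X]}.
HB.instance Definition _ (K : fieldType) (X : choiceType) :=
  GRing.Lmodule.on (freealg K X).

Section FreeAlg.
Variables (K : fieldType) (X : choiceType).
Implicit Types (p q r : freealg K X) (w : seq X).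

Definition fword w : freealg K X := << w >>.

Definition free_mul p q : freealg K X :=
  linext (fun w => linext (fun w' => fword (w ++ w')) q) p.
Local Notation mul := free_mul.

Lemma freealg_elim (P : freealg K X -> Prop) :
  P 0 -> (forall c w, P (c *: fword w)) -> (forall p q, P p -> P q -> P (p + q)) ->
  forall p, P p.
Proof.
move=> P0 PU PD; apply: malg_elim => // w c.
suff -> : << c *g w >> = c *: fword w by [].
by apply/malgP => k; rewrite mcoeffZ !mcoeffU mulrnAr mulr1.
Qed.

Section Fext.
Variables (W : lmodType K) (f : seq X -> W).
Definition fext : freealg K X -> W := linext f.
Lemma fext_linear : linear fext.
Proof. exact: linext_is_linear. Qed.
Lemma fextU w : fext (fword w) = f w.
Proof. exact: linextU. Qed.
End Fext.

Lemma free_mul_linearl q : linear (mul^~ q).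
Proof. exact: fext_linear. Qed.
Lemma free_mul_words w w' : mul (fword w) (fword w') = fword (w ++ w').
Proof. by rewrite [LHS]linextU linextU. Qed.
Lemma free_mul_linearr p : linear (mul p).
Proof.
move=> c q r; elim/freealg_elim: p => [|d w|u v IHu IHv].
- by rewrite !(lin0 (free_mul_linearl _)) scaler0 addr0.
- rewrite !(linZ (free_mul_linearl _)) /free_mul !linextU linext_is_linear.
  by rewrite scalerDr !scalerA mulrC.
- by rewrite !(linD (free_mul_linearl _)) IHu IHv scalerDr addrACA.
Qed.

Lemma free_mulA : associative mul.
Proof.
move=> p q r; elim/freealg_elim: p => [|c w|u v IHu IHv].
- by rewrite !(lin0 (free_mul_linearl _)).
- rewrite !(linZ (free_mul_linearl _)); congr (_ *: _).
  elim/freealg_elim: q => [|d w'|u v IHu IHv].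
  + by rewrite (lin0 (free_mul_linearr _)) !(lin0 (free_mul_linearl _)) (lin0 (free_mul_linearr _)).
  + rewrite (linZ (free_mul_linearl _)) !(linZ (free_mul_linearr _)) (linZ (free_mul_linearl _)).
    congr (_ *: _); elim/freealg_elim: r => [|e w''|u v IHu IHv].
    * by rewrite !(lin0 (free_mul_linearr _)).
    * by rewrite !(linZ (free_mul_linearr _)) !free_mul_words catA.
    * by rewrite !(linD (free_mul_linearr _)) IHu IHv.
  + rewrite (linD (free_mul_linearl _)) !(linD (free_mul_linearr _)) (linD (free_mul_linearl _)).
    by rewrite IHu IHv.
- by rewrite !(linD (free_mul_linearl _)) IHu IHv.
Qed.
Lemma free_mul1 : left_id (fword [::]) mul.
Proof.
move=> p; elim/freealg_elim: p => [|c w|u v IHu IHv].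
- exact: lin0 (free_mul_linearr _).
- by rewrite (linZ (free_mul_linearr _)) free_mul_words.
- by rewrite (linD (free_mul_linearr _)) IHu IHv.
Qed.
Lemma free_mulr1 : right_id (fword [::]) mul.
Proof.
move=> p; elim/freealg_elim: p => [|c w|u v IHu IHv].
- exact: lin0 (free_mul_linearl _).
- by rewrite (linZ (free_mul_linearl _)) free_mul_words cats0.
- by rewrite (linD (free_mul_linearl _)) IHu IHv.
Qed.
Lemma free_mulDl : left_distributive mul +%R.
Proof. by move=> p q r; rewrite (linD (free_mul_linearl _)). Qed.
Lemma free_mulDr : right_distributive mul +%R.
Proof. by move=> p q r; rewrite (linD (free_mul_linearr _)). Qed.
Lemma free_1neq0 : fword [::] != 0.
Proof. by rewrite /fword monalgU_eq0 oner_eq0. Qed.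
HB.instance Definition _ := GRing.Zmodule_isNzRing.Build (freealg K X)
  free_mulA free_mul1 free_mulr1 free_mulDl free_mulDr free_1neq0.

Lemma fword_nil : 1 = fword [::]. Proof. by []. Qed.
Lemma fword_cat w w' : fword (w ++ w') = fword w * fword w'.
Proof. exact/esym/free_mul_words. Qed.

Lemma freealg_scaleAl (c : K) p q : c *: (p * q) = (c *: p) * q.
Proof. exact/esym/(linZ (free_mul_linearl q)). Qed.
HB.instance Definition _ :=
  GRing.Lmodule_isLalgebra.Build K (freealg K X) freealg_scaleAl.
Lemma freealg_scaleAr (c : K) p q : c *: (p * q) = p * (c *: q).
Proof. exact/esym/(linZ (free_mul_linearr p)). Qed.
HB.instance Definition _ :=
  GRing.Lalgebra_isAlgebra.Build K (freealg K X) freealg_scaleAr.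

Lemma fextM (A : algType K) (f : seq X -> A) :
  (forall w w', f (w ++ w') = f w * f w') ->
  forall p q, fext f (p * q) = fext f p * fext f q.
Proof.
move=> fM p q; have fl := fext_linear f.
elim/freealg_elim: p => [|d w|u v IHu IHv].
- by rewrite mul0r (lin0 fl) mul0r.
- elim/freealg_elim: q => [|e w'|u v IHu IHv].
  + by rewrite mulr0 (lin0 fl) mulr0.
  + by rewrite -scalerAl -scalerAr -fword_cat !(linZ fl) !fextU fM -scalerAl -scalerAr.
  + by rewrite mulrDr !(linD fl) IHu IHv mulrDr.
- by rewrite mulrDl !(linD fl) IHu IHv mulrDl.
Qed.
End FreeAlg.

Definition free_gen (K : fieldType) (h : leibnizType K) (x : h) : freealg K h :=
  fword K [:: x].

Definition Uenv_rel (K : fieldType) (h : leibnizType K) : set (freealg K h) := [set r |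
  (exists c (x y : h), r = free_gen (c *: x + y) - (c *: free_gen x + free_gen y)) \/
  (exists x y : h,
     r = free_gen x * free_gen y - free_gen y * free_gen x - free_gen (lbr x y))].

Definition Uenv_ideal (K : fieldType) (h : leibnizType K) : set (freealg K h) :=
  [set p | exists a r b, Uenv_rel r /\ p = a * r * b].

(* U(h) for a Lie algebra h: the free associative algebra on the set h modulo *)
(* the two-sided ideal making h -> U(h) linear and bracket-preserving.         *)
Definition Uenv (K : fieldType) (h : leibnizType K) : Type := lquot (@Uenv_ideal K h).

HB.lock Definition Upi (K : fieldType) (h : leibnizType K) (p : freealg K h) : Uenv h :=
  lpi (@Uenv_ideal K h) p.
HB.lock Definition Umul (K : fieldType) (h : leibnizType K) (p q : Uenv h) : Uenv h :=
  Upi (lrepr p * lrepr q).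
HB.lock Definition Ugen (K : fieldType) (h : leibnizType K) (x : h) : Uenv h :=
  Upi (free_gen x).

Section Uenv.
Variables (K : fieldType) (h : leibnizType K).
Local Notation F := (freealg K h).
Local Notation Uenv := (Uenv h).
Local Notation Uenv_ideal := (@Uenv_ideal K h).
Local Notation Upi := (@Upi K h).
Local Notation Umul := (@Umul K h).
Local Notation Ugen := (@Ugen K h).

HB.instance Definition _ := GRing.Lmodule.on Uenv.

Definition Uone : Uenv := Upi 1.

Lemma Upi_linear : linear Upi.
Proof. by rewrite Upi.unlock; exact: lpi_is_linear. Qed.
HB.instance Definition _ := GRing.isLinear.Build K F Uenv *:%R Upi Upi_linear.

Lemma Upi_lift (W : lmodType K) (f : F -> W) :
  linear f -> (forall p, Uenv_ideal p -> f p = 0) -> forall p, f (lrepr (Upi p)) = f p.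
Proof.
by move=> fl f0 p; apply: (lquot_lift fl f0); rewrite Upi.unlock lreprK.
Qed.

Lemma Upi_ideal p : Uenv_ideal p -> Upi p = 0.
Proof. by rewrite Upi.unlock; exact: lpi_gen. Qed.

Lemma UpiM a b : Umul (Upi a) (Upi b) = Upi (a * b).
Proof.
rewrite Umul.unlock.
have -> : Upi (lrepr (Upi a) * lrepr (Upi b)) = Upi (a * lrepr (Upi b)).
  apply: (Upi_lift (f := fun a => Upi (a * lrepr (Upi b)))).
  - by move=> c x y; rewrite mulrDl -scalerAl linearP.
  - move=> _ [p [r [q [Gr ->]]]]; apply: Upi_ideal.
    by exists p, r, (q * lrepr (Upi b)); rewrite mulrA.
apply: (Upi_lift (f := fun b => Upi (a * b))).
- by move=> c x y; rewrite mulrDr -scalerAr linearP.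
- move=> _ [p [r [q [Gr ->]]]]; apply: Upi_ideal.
  by exists (a * p), r, q; rewrite !mulrA.
Qed.

Lemma Upi_surj (p : Uenv) : exists a, p = Upi a.
Proof. by exists (lrepr p); rewrite Upi.unlock lreprK. Qed.

Lemma UmulA : associative Umul.
Proof.
move=> p q r; have [a ->] := Upi_surj p; have [b ->] := Upi_surj q.
by have [c ->] := Upi_surj r; rewrite !UpiM mulrA.
Qed.
Lemma Umul1 : left_id Uone Umul.
Proof. by move=> p; have [a ->] := Upi_surj p; rewrite UpiM mul1r. Qed.
Lemma Umulr1 : right_id Uone Umul.
Proof. by move=> p; have [a ->] := Upi_surj p; rewrite UpiM mulr1. Qed.
Lemma UmulDl : left_distributive Umul +%R.
Proof.
move=> p q r; have [a ->] := Upi_surj p; have [b ->] := Upi_surj q.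
by have [c ->] := Upi_surj r; rewrite -raddfD !UpiM mulrDl raddfD.
Qed.
Lemma UmulDr : right_distributive Umul +%R.
Proof.
move=> p q r; have [a ->] := Upi_surj p; have [b ->] := Upi_surj q.
by have [c ->] := Upi_surj r; rewrite -raddfD !UpiM mulrDr raddfD.
Qed.

(* The augmentation shows that U(h) is not the zero ring. *)
Lemma Uone_neq0 : Uone != 0.
Proof.
pose eps : F -> K^o := fext (fun w : seq h => (nilp w)%:R : K^o).
have epsl : linear eps by exact: fext_linear.
have epsM a b : eps (a * b) = eps a * eps b.
  apply: fextM => w w'; rewrite /nilp size_cat addn_eq0.
  by case: (_ == _); case: (_ == _); rewrite ?mulr1 ?mulr0.
have eps_gen x : eps (free_gen x) = 0 by rewrite /eps fextU.
have epsB a b : eps (a - b) = eps a - eps b by exact: linB.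
have lift p : eps (lrepr (Upi p)) = eps p.
  apply: (Upi_lift epsl) => _ [a [r [b [Gr ->]]]]; rewrite !epsM.
  suff -> : eps r = 0 by rewrite mulr0 mul0r.
  case: Gr => [[c [x [y ->]]]|[x [y ->]]]; rewrite !epsB.
    by rewrite epsl !eps_gen scaler0 addr0 subrr.
  by rewrite !epsM !eps_gen mulr0 !subr0.
apply/eqP => U10; have /eqP : eps 1 = 0.
  by rewrite -(lift 1) -/Uone U10 -(lin0 Upi_linear) lift (lin0 epsl).
by rewrite fword_nil /eps fextU oner_eq0.
Qed.

HB.instance Definition _ := GRing.Zmodule_isNzRing.Build Uenv
  UmulA Umul1 Umulr1 UmulDl UmulDr Uone_neq0.

Lemma Upi_mul a b : Upi (a * b) = Upi a * Upi b. Proof. by rewrite -UpiM. Qed.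
Lemma Upi_scale (c : K) (a : freealg K h) : Upi (c *: a) = c *: Upi a. Proof. exact: linearZ. Qed.
Lemma UscaleAl c (p q : Uenv) : c *: (p * q) = (c *: p) * q.
Proof.
have [a ->] := Upi_surj p; have [b ->] := Upi_surj q.
by rewrite -Upi_mul -!Upi_scale -Upi_mul scalerAl.
Qed.
HB.instance Definition _ := GRing.Lmodule_isLalgebra.Build K Uenv UscaleAl.
Lemma UscaleAr c (p q : Uenv) : c *: (p * q) = p * (c *: q).
Proof.
have [a ->] := Upi_surj p; have [b ->] := Upi_surj q.
by rewrite -Upi_mul -!Upi_scale -Upi_mul scalerAr.
Qed.
HB.instance Definition _ := GRing.Lalgebra_isAlgebra.Build K Uenv UscaleAr.

Lemma Ugen_linear : linear Ugen.
Proof.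
move=> c x y; rewrite !Ugen.unlock -Upi_linear; apply/eqP; rewrite -subr_eq0 -raddfB.
apply/eqP/Upi_ideal; exists 1, (free_gen (c *: x + y) - (c *: free_gen x + free_gen y)), 1.
by rewrite mul1r mulr1; split=> //; left; exists c, x, y.
Qed.

Lemma Ugen_br x y : Ugen (lbr x y) = Ugen x * Ugen y - Ugen y * Ugen x.
Proof.
rewrite !Ugen.unlock -!Upi_mul -raddfB; apply/esym/eqP; rewrite -subr_eq0 -raddfB.
apply/eqP/Upi_ideal; eexists 1, _, 1; rewrite mul1r mulr1.
by split; [right; exists x, y|].
Qed.
End Uenv.

Section UenvAct.
Variables (K : fieldType) (h : leibnizType K) (M : lmodType K) (act : h -> M -> M).

(* The action of U(h) on the h-module M: a word x_1...x_k acts by x_1(...(x_k m)). *)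
Definition free_act (p : freealg K h) (m : M) : M := fext (foldr act m) p.
Definition Uact (p : Uenv h) : M -> M := free_act (lrepr p).

Hypothesis act_mod : leibniz_module act.

Lemma free_act_linearl m : linear (free_act^~ m).
Proof. exact: fext_linear. Qed.

Lemma foldr_act_linear (w : seq h) : linear (fun m => foldr act m w).
Proof. by move=> c m n; elim: w => //= x w ->; exact: lmod_linearr. Qed.

Lemma free_act_linear p : linear (free_act p).
Proof.
move=> c m n; elim/freealg_elim: p => [|k w|u v IHu IHv].
- by rewrite !(lin0 (free_act_linearl _)) scaler0 addr0.
- rewrite !(linZ (free_act_linearl _)) /free_act !fextU foldr_act_linear.
  by rewrite scalerDr !scalerA mulrC.
- by rewrite !(linD (free_act_linearl _)) IHu IHv scalerDr addrACA.
Qed.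

Lemma free_actM p q m : free_act (p * q) m = free_act p (free_act q m).
Proof.
elim/freealg_elim: p => [|k w|u v IHu IHv].
- by rewrite mul0r !(lin0 (free_act_linearl _)).
- rewrite -scalerAl !(linZ (free_act_linearl _)); congr (_ *: _).
  elim/freealg_elim: q => [|l w'|u v IHu IHv].
  + by rewrite mulr0 (lin0 (free_act_linearl _)) (lin0 (free_act_linear _)).
  + rewrite -scalerAr !(linZ (free_act_linearl _)) (linZ (free_act_linear _)).
    by rewrite -fword_cat /free_act !fextU foldr_cat.
  + by rewrite mulrDr !(linD (free_act_linearl _)) IHu IHv (linD (free_act_linear _)).
- by rewrite mulrDl !(linD (free_act_linearl _)) IHu IHv.
Qed.

Lemma free_act_gen x m : free_act (free_gen x) m = act x m.
Proof. by rewrite /free_act fextU. Qed.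

Lemma Uact_pi p m : Uact (Upi p) m = free_act p m.
Proof.
apply: (Upi_lift (f := (free_act^~ m))).
  exact: free_act_linearl.
move=> _ [a [r [b [Gr ->]]]]; rewrite !free_actM.
suff -> n : free_act r n = 0 by exact: lin0 (free_act_linear a).
have sub u v : free_act (u - v) n = free_act u n - free_act v n.
  exact: linB (free_act_linearl n) u v.
case: Gr => [[c [x [y ->]]]|[x [y ->]]]; rewrite !sub.
  by rewrite (free_act_linearl n c) !free_act_gen (lmod_linearl act_mod) subrr.
by rewrite !free_actM !free_act_gen (lmod_br act_mod) subrr.
Qed.

Lemma UactM p q m : Uact (p * q) m = Uact p (Uact q m).
Proof.
have [a ->] := Upi_surj p; have [b ->] := Upi_surj q.
by rewrite -Upi_mul !Uact_pi free_actM.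
Qed.

Lemma Uact_gen x m : Uact (Ugen x) m = act x m.
Proof. by rewrite Ugen.unlock Uact_pi free_act_gen. Qed.
End UenvAct.

Section UenvMap.
Variables (K : fieldType) (h h' : leibnizType K) (f : h -> h').

(* U(f), mapping a word x_1...x_k to f(x_1)...f(x_k) *)
Definition free_map (p : freealg K h) : Uenv h' :=
  fext (fun w => \prod_(x <- w) Ugen (f x)) p.
Definition Umap (p : Uenv h) : Uenv h' := free_map (lrepr p).

Hypothesis f_morph : lie_morph f.

Lemma free_map_linear : linear free_map.
Proof. exact: fext_linear. Qed.

Lemma free_mapM p q : free_map (p * q) = free_map p * free_map q.
Proof. by apply: fextM => w w'; rewrite big_cat. Qed.

Lemma free_map_gen x : free_map (free_gen x) = Ugen (f x).
Proof. by rewrite /free_map fextU big_seq1. Qed.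

Lemma Umap_pi p : Umap (Upi p) = free_map p.
Proof.
apply: (Upi_lift (f := free_map)).
  exact: free_map_linear.
move=> _ [a [r [b [Gr ->]]]]; rewrite !free_mapM.
suff -> : free_map r = 0 by rewrite mulr0 mul0r.
have sub u v : free_map (u - v) = free_map u - free_map v.
  exact: linB free_map_linear u v.
have [lf bf] := f_morph.
case: Gr => [[c [x [y ->]]]|[x [y ->]]]; rewrite !sub.
  by rewrite (free_map_linear c) !free_map_gen lf Ugen_linear subrr.
by rewrite !free_mapM !free_map_gen bf Ugen_br subrr.
Qed.

Lemma UmapM p q : Umap (p * q) = Umap p * Umap q.
Proof.
have [a ->] := Upi_surj p; have [b ->] := Upi_surj q.
by rewrite -Upi_mul !Umap_pi free_mapM.
Qed.

Lemma Umap_gen x : Umap (Ugen x) = Ugen (f x).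
Proof. by rewrite [in LHS]Ugen.unlock Umap_pi free_map_gen. Qed.
End UenvMap.

Definition tensor_rel (K : fieldType) (A : Type) (M N : lmodType K)
    (ract : M -> A -> M) (lact : A -> N -> N) : set {malg K[(M * N)%type]} := [set r | [\/
  exists c x x' y, r = << (c *: x + x', y) >> - (c *: << (x, y) >> + << (x', y) >>),
  exists c x y y', r = << (x, c *: y + y') >> - (c *: << (x, y) >> + << (x, y') >>) |
  exists x a y, r = << (ract x a, y) >> - << (x, lact a y) >> ]].

(* M (x)_A N *)
Definition tensor (K : fieldType) (A : Type) (M N : lmodType K)
    (ract : M -> A -> M) (lact : A -> N -> N) : Type := lquot (tensor_rel ract lact).

HB.lock Definition tens (K : fieldType) (A : Type) (M N : lmodType K)
    (ract : M -> A -> M) (lact : A -> N -> N) (x : M) (y : N) : tensor ract lact :=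
  lpi (tensor_rel ract lact) << (x, y) >>.

(* the linear extension of x (x) y |-> f x y, for f bilinear and balanced *)
HB.lock Definition tensor_ext (K : fieldType) (A : Type) (M N : lmodType K)
    (ract : M -> A -> M) (lact : A -> N -> N) (W : lmodType K) (f : M -> N -> W)
    (v : tensor ract lact) : W :=
  linext (fun xy => f xy.1 xy.2) (lrepr v).

Section Tensor.
Variables (K : fieldType) (A : Type) (M N : lmodType K).
Variables (ract : M -> A -> M) (lact : A -> N -> N).
Local Notation F := {malg K[(M * N)%type]}.
Local Notation tensor_rel := (tensor_rel ract lact).
Local Notation tensor := (tensor ract lact).
Local Notation tens := (@tens K A M N ract lact).

HB.instance Definition _ := GRing.Lmodule.on tensor.

Lemma tens_linearl y : linear (fun x => tens x y).
Proof.
move=> c x x'; apply/eqP; rewrite !tens.unlock -linearP -subr_eq0 -raddfB; apply/eqP/lpi_gen.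
by constructor 1; exists c, x, x', y.
Qed.
Lemma tens_linearr x : linear (tens x).
Proof.
move=> c y y'; apply/eqP; rewrite !tens.unlock -linearP -subr_eq0 -raddfB; apply/eqP/lpi_gen.
by constructor 2; exists c, x, y, y'.
Qed.
Lemma tens_balanced x a y : tens (ract x a) y = tens x (lact a y).
Proof.
apply/eqP; rewrite !tens.unlock -subr_eq0 -raddfB; apply/eqP/lpi_gen.
by constructor 3; exists x, a, y.
Qed.

Lemma tensor_elim (P : tensor -> Prop) :
  P 0 -> (forall c x y, P (c *: tens x y)) -> (forall u v, P u -> P v -> P (u + v)) ->
  forall v, P v.
Proof.
move=> P0 PU PD v; rewrite -[v]lreprK; elim/malg_elim: (lrepr v) => [|[x y] c|a b Pa Pb].
- by rewrite raddf0.
- have -> : << c *g (x, y) >> = c *: << (x, y) >> :> F.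
    by apply/malgP => k; rewrite mcoeffZ !mcoeffU mulrnAr mulr1.
  by rewrite linearZ /=; move: (PU c x y); rewrite tens.unlock.
- by rewrite raddfD; exact: PD.
Qed.

Section TensorExt.
Variables (W : lmodType K) (f : M -> N -> W).
Hypothesis fl : forall y, linear (fun x => f x y).
Hypothesis fr : forall x, linear (f x).
Hypothesis fb : forall x a y, f (ract x a) y = f x (lact a y).

Let lift u : linext (fun xy => f xy.1 xy.2) (lrepr (lpi tensor_rel u)) =
  linext (fun xy => f xy.1 xy.2) u.
Proof.
apply: (@lquot_lift _ _ tensor_rel _ (linext (fun xy => f xy.1 xy.2))); last exact: lreprK.
  exact: linext_is_linear.
have lB := linB (linext_is_linear (fun xy : M * N => f xy.1 xy.2)).
have lP := linext_is_linear (fun xy : M * N => f xy.1 xy.2).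
move=> _ [[c [x [x' [y ->]]]]|[c [x [y [y' ->]]]]|[x [a [y ->]]]]; rewrite lB ?lP !linextU /=.
- by rewrite fl subrr.
- by rewrite fr subrr.
- by rewrite fb subrr.
Qed.

Lemma tensor_extE x y : tensor_ext f (tens x y) = f x y.
Proof. by rewrite tensor_ext.unlock tens.unlock lift linextU. Qed.

Lemma tensor_ext_linear : linear (tensor_ext f).
Proof.
move=> c u v; rewrite -[u]lreprK -[v]lreprK -linearP tensor_ext.unlock !lift.
exact: linext_is_linear.
Qed.
End TensorExt.
End Tensor.

(* U(h) (x)_{U(h')} N, with U(h) a right U(h')-module through U(j) *)
Definition induced (K : fieldType) (h' h : leibnizType K) (j : h' -> h)
    (N : lmodType K) (act : h' -> N -> N) : Type :=
  tensor (fun (u : Uenv h) (p : Uenv h') => u * Umap j p) (Uact act).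

HB.lock Definition ind_tens (K : fieldType) (h' h : leibnizType K) (j : h' -> h)
    (N : lmodType K) (act : h' -> N -> N) (u : Uenv h) (y : N) : induced j act :=
  tens _ _ u y.

HB.lock Definition ind_act (K : fieldType) (h' h : leibnizType K) (j : h' -> h)
    (N : lmodType K) (act : h' -> N -> N) (x : h) (v : induced j act) : induced j act :=
  tensor_ext (fun u y => ind_tens j act (Ugen x * u) y) v.

Section Induced.
Variables (K : fieldType) (h' h : leibnizType K) (j : h' -> h).
Variables (N : lmodType K) (act : h' -> N -> N).
Local Notation induced := (induced j act).
Local Notation ind_tens := (@ind_tens K h' h j N act).
Local Notation ind_act := (@ind_act K h' h j N act).

HB.instance Definition _ := GRing.Lmodule.on induced.

Lemma ind_tens_linearl y : linear (fun u => ind_tens u y).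
Proof. by rewrite ind_tens.unlock; exact: tens_linearl. Qed.
Lemma ind_tens_linearr u : linear (ind_tens u).
Proof. by rewrite ind_tens.unlock; exact: tens_linearr. Qed.
Lemma ind_tens_balanced u p y : ind_tens (u * Umap j p) y = ind_tens u (Uact act p y).
Proof. by rewrite ind_tens.unlock; exact: tens_balanced. Qed.

Lemma ind_elim (P : induced -> Prop) :
  P 0 -> (forall c u y, P (c *: ind_tens u y)) -> (forall v w, P v -> P w -> P (v + w)) ->
  forall v, P v.
Proof. by rewrite ind_tens.unlock; exact: tensor_elim. Qed.

Let linl x y : linear (fun u => ind_tens (Ugen x * u) y).
Proof. by move=> c u v; rewrite mulrDr -scalerAr ind_tens_linearl. Qed.
Let linr x u : linear (ind_tens (Ugen x * u)).
Proof. exact: ind_tens_linearr. Qed.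
Let bal x u p y : ind_tens (Ugen x * (u * Umap j p)) y = ind_tens (Ugen x * u) (Uact act p y).
Proof. by rewrite mulrA ind_tens_balanced. Qed.

Lemma ind_actE x u y : ind_act x (ind_tens u y) = ind_tens (Ugen x * u) y.
Proof.
have := tensor_extE (linl x) (linr x) (@bal x) u y.
by rewrite -[tens _ _ u y](congr1 (fun f => f _ _ _ _ _ _ u y) ind_tens.unlock) ind_act.unlock.
Qed.

Lemma ind_act_linear x : linear (ind_act x).
Proof. by rewrite ind_act.unlock; exact: (tensor_ext_linear (linl x) (linr x) (@bal x)). Qed.

Lemma ind_act_module : leibniz_module ind_act.
Proof.
split=> [v c x x'|x|x x' v]; last 1 first.
- elim/ind_elim: v => [|c u y|v w IHv IHw].
  + rewrite (lin0 (ind_act_linear x)) (lin0 (ind_act_linear x')) (lin0 (ind_act_linear x)).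
    by rewrite (lin0 (ind_act_linear (lbr x x'))) subrr.
  + rewrite (linZ (ind_act_linear x')) (linZ (ind_act_linear x) c (ind_tens u y)).
    rewrite (linZ (ind_act_linear x)) (linZ (ind_act_linear x')) (linZ (ind_act_linear (lbr x x'))).
    rewrite -scalerBr (ind_actE x' u) (ind_actE x u) (ind_actE x) (ind_actE x').
    rewrite (ind_actE (lbr x x') u) -(linB (ind_tens_linearl y)).
    by rewrite Ugen_br (mulrBl u) (mulrA _ _ u) (mulrA _ _ u).
  + rewrite (linD (ind_act_linear x')) (linD (ind_act_linear x) v w).
    rewrite (linD (ind_act_linear x)) (linD (ind_act_linear x')) (linD (ind_act_linear (lbr x x'))).
    by rewrite -IHv -IHw opprD addrACA.
- elim/ind_elim: v => [|d u y|v w IHv IHw].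
  + rewrite (lin0 (ind_act_linear x)) (lin0 (ind_act_linear x')).
    by rewrite (lin0 (ind_act_linear (c *: x + x'))) scaler0 addr0.
  + rewrite (linZ (ind_act_linear x)) (linZ (ind_act_linear x')).
    rewrite (linZ (ind_act_linear (c *: x + x'))).
    rewrite (ind_actE x) (ind_actE x') (ind_actE (c *: x + x')).
    rewrite Ugen_linear (mulrDl _ _ u) -scalerAl ind_tens_linearl.
    by rewrite scalerDr !scalerA mulrC.
  + rewrite (linD (ind_act_linear x)) (linD (ind_act_linear x')).
    rewrite (linD (ind_act_linear (c *: x + x'))).
    by rewrite IHv IHw scalerDr addrACA.
- exact: ind_act_linear.
Qed.
End Induced.

Section Vg.
Variables (K : fieldType) (g : leibnizType K).

(* gLie (x) t^n acts on g by left multiplication if n = 0 and by 0 if n > 0. *)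
Definition pos_act (x : loop nat (gLie g)) (a : g) : g := gLie_act x@_0%N a.

Definition pos_incl : loop nat (gLie g) -> loop int (gLie g) := loop_map Posz id.

Lemma pos_incl_morph : lie_morph pos_incl.
Proof. by apply: loop_map_morph => //; exact: PoszD. Qed.

Lemma gLie_act_linearl a : linear (fun x : gLie g => gLie_act x a).
Proof.
move=> c x y; have [b ->] := toLieK x; have [b' ->] := toLieK y.
by rewrite -linearP !gLie_act_toLie lbr_linearl.
Qed.

Lemma pos_act_module : leibniz_module pos_act.
Proof.
have lin a : linear (fun x => pos_act x a).
  by move=> c x y; rewrite /pos_act mcoeffD loop_scaleE gLie_act_linearl.
split=> // [x|x y a]; first exact: lbr_linearr.
change (pos_act x (pos_act y a) - pos_act y (pos_act x a) = pos_act (loop_br x y) a).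
have lr z : linear (pos_act z) by exact: lbr_linearr.
elim/malg_elim: x => [|m u|x x' IHx IHx'].
- by rewrite loop_br0l !(lin0 (lin _)) (lin0 (lr _)) subrr.
- elim/malg_elim: y => [|n v|y y' IHy IHy'].
  + by rewrite loop_br0r !(lin0 (lin _)) (lin0 (lr _)) subrr.
  + rewrite loop_brU /pos_act !mcoeffU.
    have [b ->] := toLieK u; have [b' ->] := toLieK v.
    rewrite [lbr _ _]gLie_br_toLie.
    case: m => [|m]; case: n => [|n]; rewrite /= ?mulr0n ?mulr1n.
    * by rewrite !gLie_act_toLie lbr_leibniz addrK.
    * by rewrite !(lin0 (gLie_act_linearl _)) [gLie_act _ 0](lin0 (lbr_linearr _)) subrr.
    * by rewrite !(lin0 (gLie_act_linearl _)) [gLie_act _ 0](lin0 (lbr_linearr _)) subrr.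
    * by rewrite !(lin0 (gLie_act_linearl _)) subrr.
  + rewrite loop_brDr !(linD (lin _)) (linD (lr _)) -IHy -IHy' opprD.
    by rewrite addrACA.
- rewrite loop_brDl !(linD (lin _)) (linD (lr _)) -IHx -IHx' opprD.
  by rewrite addrACA.
Qed.

Definition Vg : Type := induced pos_incl pos_act.
HB.instance Definition _ := GRing.Lmodule.on Vg.

(* the identification of g with 1 (x) g *)
Definition Vg_in (a : g) : Vg := ind_tens pos_incl pos_act 1 a.

(* Vg as an L(g)-module, through L(g) -> L(gLie) *)
Definition Vg_act (x : loop int g) (v : Vg) : Vg :=
  ind_act (loop_map id (@toLie K g) x) v.

Lemma Vg_act_module : leibniz_module Vg_act.
Proof.
have [fl fb] : lie_morph (loop_map id (@toLie K g) : loop int g -> loop int (gLie g)).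
  apply: loop_map_morph => //; split=> [|a b]; first exact: linearP.
  by rewrite [RHS]gLie_br_toLie.
have [ml mr mb] := ind_act_module pos_incl pos_act.
split=> [v c x y|x|x y v]; rewrite /Vg_act; last by rewrite fb -mb.
  by rewrite fl ml.
exact: mr.
Qed.

Lemma Vg_act_pos (a b : g) (n : nat) :
  Vg_act << a *g n%:Z >> (Vg_in b) = if n is 0%N then Vg_in (lbr a b) else 0.
Proof.
have tD : {morph @toLie K g : x y / x + y} by exact: raddfD.
have E : loop_map id (@toLie K g) << a *g n%:Z >> = pos_incl << toLie a *g n >>.
  rewrite /pos_incl /loop_map gsumU => [|m x y]; last by rewrite tD monalgUD.
  by rewrite gsumU // => m x y; rewrite monalgUD.
rewrite /Vg_act /Vg_in (ind_actE pos_incl pos_act) E mulr1.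
rewrite -(Umap_gen pos_incl_morph) -[Umap _ _]mul1r (ind_tens_balanced pos_incl pos_act).
rewrite (Uact_gen pos_act_module) /pos_act mcoeffU.
case: n {E} => [|n] /=; rewrite ?mulr1n ?mulr0n ?gLie_act_toLie //.
by rewrite (lin0 (gLie_act_linearl b)) (lin0 (ind_tens_linearr pos_incl pos_act 1)).
Qed.
End Vg.

Section FormalCalculus.
Variable K : numFieldType.

(* F i j k is the coefficient of x0^i x1^j x2^k. *)
Definition fseries3 (M : Type) : Type := int -> int -> int -> M.

(* the product of a scalar and a vector formal series; each coefficient is a sum *)
(* over Z^3 that has finite support in all uses below                            *)
Definition fmul3 (M : lmodType K) (F : fseries3 K) (G : fseries3 M) : fseries3 M :=
  fun i j k => \sum_(p \in [set: int * int * int])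
    F p.1.1 p.1.2 p.2 *: G (i - p.1.1) (j - p.1.2) (k - p.2).

Definition binomz (n : int) (i : nat) : K := \prod_(k < i) (n - k%:Z)%:~R / i`!%:R.

(* the coefficient of x^a y^b in (x - y)^n = \sum_(i >= 0) (-1)^i 'C(n, i) x^(n-i) y^i *)
Definition subpow (n a b : int) : K :=
  if b is Posz i then (if a + b == n then (-1) ^+ i * binomz n i else 0) else 0.

(* x0^-1 delta((x1 - x2) / x0)   = \sum_n x0^(-n-1) (x1 - x2)^n        *)
Definition delta_12 : fseries3 K := fun i j k => subpow (- i - 1) j k.
(* x0^-1 delta((x2 - x1) / (-x0)) = \sum_n (-1)^n x0^(-n-1) (x2 - x1)^n *)
Definition delta_21 : fseries3 K := fun i j k => (-1) ^ (- i - 1) * subpow (- i - 1) k j.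
(* x2^-1 delta((x1 - x0) / x2)   = \sum_n x2^(-n-1) (x1 - x0)^n        *)
Definition delta_10 : fseries3 K := fun i j k => subpow (- k - 1) j i.

Section Vertex.
Variables V W : lmodType K.

Definition lower_truncated (s : int -> W) : Prop :=
  exists N : int, forall k : int, (k < N)%R -> s k = 0.

(* linear maps Y_W(., x) : V -> Hom(W, W((x))); YW v w k is the coefficient of x^k *)
(* in Y_W(v, x) w, so that the mode v_n w is YW v w (- n - 1).                     *)
Definition vertex_map (YW : V -> W -> int -> W) : Prop :=
  [/\ forall w k, linear (fun v => YW v w k),
      forall v k, linear (fun w => YW v w k) &
      forall v w, lower_truncated (YW v w)].

Variables (Y : V -> V -> int -> V) (YW : V -> W -> int -> W).

Definition prod_uv (u v : V) (w : W) : fseries3 W :=   (* YW(u, x1) YW(v, x2) w *)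
  fun i j k => if i == 0 then YW u (YW v w k) j else 0.
Definition prod_vu (u v : V) (w : W) : fseries3 W :=   (* YW(v, x2) YW(u, x1) w *)
  fun i j k => if i == 0 then YW v (YW u w j) k else 0.
Definition iterate_uv (u v : V) (w : W) : fseries3 W := (* YW(Y(u, x0) v, x2) w *)
  fun i j k => if j == 0 then YW (Y u v i) w k else 0.

Definition jacobi : Prop := forall (u v : V) (w : W) (i j k : int),
  fmul3 delta_12 (prod_uv u v w) i j k - fmul3 delta_21 (prod_vu u v w) i j k =
  fmul3 delta_10 (iterate_uv u v w) i j k.
End Vertex.

Definition vertex_leibniz_structure (V : lmodType K) (Y : V -> V -> int -> V) : Prop :=
  vertex_map Y /\ jacobi Y Y.

Definition vertex_module_structure (V W : lmodType K) (Y : V -> V -> int -> V)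
    (YW : V -> W -> int -> W) : Prop :=
  vertex_map YW /\ jacobi Y YW.

Section Restricted.
Variables (g : leibnizType K) (W : lmodType K) (act : loop int g -> W -> W).

Definition restricted : Prop := forall (a : g) (w : W),
  exists N : int, forall n : int, (N <= n)%R -> act << a *g n >> w = 0.

(* a(x) w = \sum_n (a (x) t^n) w x^(-n-1) *)
Definition current (a : g) (w : W) : int -> W := fun k => act << a *g - k - 1 >> w.
End Restricted.
End FormalCalculus.

(* Main.v *)
Require Import Defs.
From HB Require Import structures.
From mathcomp Require Import all_boot all_order all_algebra.
From mathcomp Require Import boolp classical_sets functions cardinality fsbigop.
From mathcomp Require Import reals complex monalg.
From mathcomp Require Import zify ring.

Set Implicit Arguments.
Unset Strict Implicit.
Unset Printing Implicit Defensive.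

Import Order.TTheory GRing.Theory Num.Theory.

Local Open Scope classical_set_scope.
Local Open Scope ring_scope.

(* In modes, the Jacobi identity for (u, v) is the Borcherds identity, which by
   Pascal's rule follows from two of its edges: the commutator formula (l = 0) and
   the iterate formula (m = 0).  For a restricted module W, the n-th products with
   the currents a(x) make Hom(W, W((x))) a module for the loop algebra; no locality
   is needed here.  Since a(x)_n b(x) is [a, b](x) for n = 0 and 0 for n > 0, the map
   b |-> b(x) is linear for the nonnegative part of the loop algebra, so it extends
   to Y_W : V_g -> Hom(W, W((x))), and the iterate formula holds for a in g by
   construction.  The commutator formula for (a, v) follows by induction on v, and
   if a and u satisfy the Borcherds identity with all vectors, then so does a_p u.
   As V_g is generated from g by the modes of the currents, this gives the Jacobi
   identity; the iterate formula for a in g also gives uniqueness.  The structure on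
   V_g itself is the case W = V_g. *)

(** * Finitely supported sums over the natural numbers *)

(** A square [a, a] may be nonzero in V_g, yet its current is 0 on every restricted module. Hence v
    cannot be recovered from Y(v, x), and identities inside V_g cannot be read off from identities
    between fields, as one does for vertex algebras with a vacuum. Now the identity for (a_p u, v)
    on W uses the one for (a, u) inside V_g. This is not circular: only pairs whose first entry is a
    generator occur there, and these are settled beforehand for every module, V_g included. For this
    reason the inductions are run with abstract products [mu] on V and [nu] on W. The other
    difficulty is convergence. The sums are finite only after evaluation on a vector, and the bound
    for one index often depends on another, so each interchange needs its own proof of finite
    support. The combinatorics is therefore isolated in identities for abstract families of double
    series. *)

Definition nsum (W : zmodType) (f : nat -> W) : W := \sum_(i \in [set: nat]) f i.

(** A finitely supported sum is 0 by convention when the support is infinite, so [nsum] is not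
    additive in general; every rearrangement below carries a support condition of this kind or of
    the kind [fin2]. *)
Definition fin1 (W : zmodType) (f : nat -> W) : Prop :=
  exists N, forall i, (N <= i)%N -> f i = 0.

Definition fin2 (W : zmodType) (f : nat -> nat -> W) : Prop :=
  exists N, forall i j, (N <= i)%N || (N <= j)%N -> f i j = 0.

Section NSum.
Variable W : zmodType.
Implicit Types (f h : nat -> W) (F : nat -> nat -> W).

Lemma nsumE N f : (forall i, (N <= i)%N -> f i = 0) -> nsum f = \sum_(i < N) f i.
Proof.
move=> f0; rewrite -(big_mkord xpredT f) /nsum.
have -> : [set: nat] = [set` xpredT] by apply/seteqP; split.
rewrite -(bigfs _ (r := index_iota 0 N)) ?iota_uniq // => i _.
by rewrite mem_index_iota /= -leqNgt => /f0.
Qed.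

Lemma eq_nsum f h : f =1 h -> nsum f = nsum h.
Proof. by move=> fh; apply: eq_fsbigr => i _. Qed.

Lemma nsum_0 f : (forall i, f i = 0) -> nsum f = 0.
Proof. by move=> f0; rewrite (nsumE (N := 0)) ?big_ord0. Qed.

Lemma nsum_first f : (forall i, f i.+1 = 0) -> nsum f = f 0%N.
Proof.
by move=> f0; rewrite (nsumE (N := 1)) ?big_ord1 // => -[|i] // _.
Qed.

Lemma fin1_ext f h : f =1 h -> fin1 f -> fin1 h.
Proof. by move=> fh [N f0]; exists N => i /f0; rewrite fh. Qed.

Lemma fin1D f h : fin1 f -> fin1 h -> fin1 (fun i => f i + h i).
Proof.
move=> [M f0] [N h0]; exists (maxn M N) => i; rewrite geq_max => /andP[Mi Ni].
by rewrite f0 ?h0 ?addr0.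
Qed.

Lemma fin1N f : fin1 f -> fin1 (fun i => - f i).
Proof. by move=> [M f0]; exists M => i /f0 ->; rewrite oppr0. Qed.

Lemma fin1B f h : fin1 f -> fin1 h -> fin1 (fun i => f i - h i).
Proof. by move=> ff fh; apply: fin1D => //; exact: fin1N. Qed.

Lemma nsumD f h : fin1 f -> fin1 h -> nsum (fun i => f i + h i) = nsum f + nsum h.
Proof.
move=> [M f0] [N h0].
have Mf i : (maxn M N <= i)%N -> f i = 0 by rewrite geq_max => /andP[/f0].
have Nh i : (maxn M N <= i)%N -> h i = 0 by rewrite geq_max => /andP[_ /h0].
rewrite (nsumE Mf) (nsumE Nh) (@nsumE (maxn M N)) ?big_split // => i ?.
by rewrite Mf ?Nh ?addr0.
Qed.

Lemma nsumN f : fin1 f -> nsum (fun i => - f i) = - nsum f.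
Proof.
move=> [M f0]; rewrite (nsumE f0) (nsumE (N := M)) ?sumrN // => i /f0 ->.
by rewrite oppr0.
Qed.

Lemma nsumB f h : fin1 f -> fin1 h -> nsum (fun i => f i - h i) = nsum f - nsum h.
Proof. by move=> ff fh; rewrite nsumD ?nsumN //; exact: fin1N. Qed.

Lemma nsum_recl f : fin1 f -> nsum f = f 0%N + nsum (fun i => f i.+1).
Proof.
move=> [N f0].
rewrite (nsumE (N := N.+1)) => [|i Ni]; last by rewrite f0 // ltnW.
rewrite (nsumE (f := fun i => f i.+1) (N := N)) => [|i Ni]; last by rewrite f0 // ltnW.
by rewrite big_ord_recl.
Qed.

Lemma fin2_col F j : fin2 F -> fin1 (fun i => F i j).
Proof. by move=> [N F0]; exists N => i Ni; rewrite F0 ?Ni. Qed.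

Lemma fin2_row F i : fin2 F -> fin1 (F i).
Proof. by move=> [N F0]; exists N => j Nj; rewrite F0 ?Nj ?orbT. Qed.

Lemma fin2_nsumr F : fin2 F -> fin1 (fun i => nsum (F i)).
Proof. by move=> [N F0]; exists N => i Ni; apply: nsum_0 => j; rewrite F0 ?Ni. Qed.

Lemma fin2_nsuml F : fin2 F -> fin1 (fun j => nsum (F^~ j)).
Proof. by move=> [N F0]; exists N => j Nj; apply: nsum_0 => i; rewrite F0 ?Nj ?orbT. Qed.

Lemma fin2_ext F G : (forall i j, F i j = G i j) -> fin2 F -> fin2 G.
Proof. by move=> FG [N F0]; exists N => i j /F0; rewrite FG. Qed.

Lemma fin2_sym F : fin2 F -> fin2 (fun i j => F j i).
Proof. by move=> [N F0]; exists N => i j ij; rewrite F0 // orbC. Qed.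

(** Finitely many finite rows fit into one box. This is the shape that truncation gives: the mode
    nearest to w has a uniform bound, while the bound for the next mode depends on the vector
    already produced. *)
Lemma fin2_box F : (exists N, forall i j, (N <= i)%N -> F i j = 0) ->
  (forall i, fin1 (F i)) -> fin2 F.
Proof.
move=> [N F0] Fi.
have [M FM] : exists M, forall i j, (i < N)%N -> (M <= j)%N -> F i j = 0.
  elim: N {F0} => [|N [M IH]]; first by exists 0%N.
  have [M' FM'] := Fi N; exists (maxn M M') => i j.
  rewrite ltnS leq_eqVlt geq_max => /orP[/eqP ->|iN] /andP[Mj M'j].
    exact: FM'.
  exact: IH.
exists (maxn M N) => i j; rewrite !geq_max => ij.
by have [Ni|iN] := leqP N i; [exact: F0|apply: FM => //; lia].
Qed.

Lemma fin2_half F : (exists N, forall i j, (N <= j)%N -> F i j = 0) ->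
  (forall j, fin1 (F^~ j)) -> fin2 F.
Proof.
move=> [N F0] Fj; apply: (@fin2_sym (fun j i => F i j)); apply: fin2_box => //.
by exists N => j i; exact: F0.
Qed.

Lemma fin2B F G : fin2 F -> fin2 G -> fin2 (fun i j => F i j - G i j).
Proof.
move=> [M hM] [N hN]; exists (maxn M N) => i j ij.
by rewrite hM ?hN ?subr0 //; lia.
Qed.

Lemma nsum_swap F : fin2 F ->
  nsum (fun i => nsum (fun j => F i j)) = nsum (fun j => nsum (fun i => F i j)).
Proof.
move=> [N F0].
have E1 i : nsum (fun j => F i j) = \sum_(j < N) F i j.
  by apply: nsumE => j Nj; rewrite F0 ?Nj ?orbT.
have E2 j : nsum (fun i => F i j) = \sum_(i < N) F i j.
  by apply: nsumE => i Ni; rewrite F0 ?Ni.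
rewrite (eq_nsum E1) (eq_nsum E2) (nsumE (N := N)) => [|i Ni]; last first.
  by rewrite big1 // => j _; rewrite F0 ?Ni.
rewrite (nsumE (N := N)) => [|j Nj]; last by rewrite big1 // => i _; rewrite F0 ?Nj ?orbT.
exact: exchange_big.
Qed.

(** Regrouping along i + j = t, as in a Cauchy product; this brings double sums into the form of
    Vandermonde's identity. *)
Lemma nsum_diag F : fin2 F ->
  nsum (fun i => nsum (fun j => F i j)) = nsum (fun t => \sum_(i < t.+1) F i (t - i)%N).
Proof.
move=> fF; have [N F0] := fF.
pose G i t := if (i <= t)%N then F i (t - i)%N else 0.
have fG : fin2 G.
  exists (N + N)%N => i t; rewrite /G; case: (leqP i t) => // it NN.
  by apply: F0; lia.
have E i : nsum (fun j => F i j) = nsum (fun t => G i t).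
  rewrite [RHS](nsumE (N := (i + N)%N)) => [|t Nt]; last first.
    by rewrite /G; case: (leqP i t) => // it; apply: F0; lia.
  rewrite big_split_ord /= big1 => [|j _]; last by rewrite /G leqNgt ltn_ord.
  rewrite add0r (nsumE (N := N)) => [|j Nj]; last by rewrite F0 ?Nj ?orbT.
  by apply: eq_bigr => j _; rewrite /G leq_addr addKn.
rewrite (eq_nsum E) nsum_swap //; apply: eq_nsum => t.
rewrite (nsumE (N := t.+1)) => [|i ti]; last by rewrite /G leqNgt ti.
by apply: eq_bigr => i _; rewrite /G -ltnS ltn_ord.
Qed.


Lemma nsum_shift f j : fin1 f ->
  (forall t, (t < j)%N -> f t = 0) -> nsum f = nsum (fun t => f (j + t)%N).
Proof.
move=> [N f0] fj; rewrite (nsumE (N := (j + N)%N)) => [|i ?]; last by apply: f0; lia.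
rewrite big_split_ord /= big1 ?add0r => [|i _]; last exact: fj.
by rewrite (nsumE (N := N)) // => i ?; apply: f0; lia.
Qed.
End NSum.

Section NSumLinear.
Variables (K : fieldType) (V W : lmodType K) (phi : V -> W).
Hypothesis phil : linear phi.

Lemma lin_fin1 f : fin1 f -> fin1 (fun i => phi (f i)).
Proof. by move=> [N f0]; exists N => i /f0 ->; exact: lin0. Qed.

Lemma lin_sum n (f : 'I_n -> V) : phi (\sum_(i < n) f i) = \sum_(i < n) phi (f i).
Proof. by apply: (big_morph phi) => [x y|]; [exact: linD|exact: lin0]. Qed.

Lemma lin_nsum f : fin1 f -> phi (nsum f) = nsum (fun i => phi (f i)).
Proof.
move=> [N f0]; rewrite (nsumE f0) (nsumE (N := N)) => [|i /f0 ->]; last exact: lin0.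
exact: lin_sum.
Qed.
End NSumLinear.

Section NSumScale.
Variables (K : fieldType) (W : lmodType K).
Implicit Types (f : nat -> W) (c : nat -> K).

Lemma scale_linear (k : K) : linear (fun w : W => k *: w).
Proof. by move=> c x y; rewrite scalerDr !scalerA mulrC. Qed.

Lemma scale_nsum (k : K) f : fin1 f -> k *: nsum f = nsum (fun i => k *: f i).
Proof. exact: (lin_nsum (scale_linear k)). Qed.

Lemma fin1Z c f : fin1 f -> fin1 (fun i => c i *: f i).
Proof. by move=> [N f0]; exists N => i /f0 ->; rewrite scaler0. Qed.

Lemma fin2Z (c : nat -> nat -> K) (F : nat -> nat -> W) :
  fin2 F -> fin2 (fun i j => c i j *: F i j).
Proof. by move=> [N f0]; exists N => i j /f0 ->; rewrite scaler0. Qed.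

Lemma nsum_swapZ c (d : nat -> K) (F : nat -> nat -> W) : fin2 F ->
  nsum (fun i => c i *: nsum (fun j => d j *: F i j)) =
  nsum (fun j => d j *: nsum (fun i => c i *: F i j)).
Proof.
move=> fF.
under eq_nsum => i do rewrite (scale_nsum _ (fin1Z d (fin2_row i fF))).
rewrite nsum_swap; last first.
  by apply: (fin2_ext _ (fin2Z (fun i j => c i * d j) fF)) => i j; rewrite scalerA.
apply: eq_nsum => j; rewrite (scale_nsum _ (fin1Z c (fin2_col j fF))).
by apply: eq_nsum => i; rewrite !scalerA mulrC.
Qed.

Lemma nsum_splitZ c f f1 f2 :
  (forall i, f i = f1 i + f2 i) -> fin1 f -> fin1 f1 ->
  nsum (fun i => c i *: f i) = nsum (fun i => c i *: f1 i) + nsum (fun i => c i *: f2 i).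
Proof.
move=> E ff ff1; rewrite -nsumD; last 2 first.
- exact: fin1Z.
- by apply/fin1Z/(fin1_ext _ (fin1B ff ff1)) => i; rewrite E addrC addKr.
by apply: eq_nsum => i; rewrite E scalerDr.
Qed.

Lemma nsum_subZ c (e : K) f f1 f2 :
  (forall i, f i = f1 i - e *: f2 i) -> fin1 f1 -> fin1 f2 ->
  nsum (fun i => c i *: f i) = nsum (fun i => c i *: f1 i) - e *: nsum (fun i => c i *: f2 i).
Proof.
move=> E ff1 ff2; rewrite scale_nsum -?nsumB; try exact: fin1Z.
  by apply: eq_nsum => i; rewrite E scalerBr !scalerA [e * _]mulrC.
exact/(fin1Z (fun _ => e))/fin1Z.
Qed.

Lemma nsum_lin c (k : K) f f1 f2 :
  (forall i, f i = k *: f1 i + f2 i) -> fin1 f1 -> fin1 f2 ->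
  nsum (fun i => c i *: f i) = k *: nsum (fun i => c i *: f1 i) + nsum (fun i => c i *: f2 i).
Proof.
move=> E ff1 ff2; rewrite scale_nsum -?nsumD; try exact: fin1Z.
  by apply: eq_nsum => i; rewrite E scalerDr !scalerA mulrC.
exact/(fin1Z (fun _ => k))/fin1Z.
Qed.
End NSumScale.

(** * Binomial coefficients of integers *)

Section Binom.
Variable K : numFieldType.
Local Notation "''B' ( n , k )" := (binomz K n k) (at level 8, format "''B' ( n ,  k )").
Implicit Types (n p : int) (k t j : nat).

Lemma fact_neq0 k : (k`!%:R : K) != 0.
Proof. by rewrite pnatr_eq0 -lt0n fact_gt0. Qed.

Lemma binomz0r n : 'B(n, 0) = 1.
Proof. by rewrite /binomz big_ord0 fact0 divr1. Qed.

Lemma binomz0l k : 'B(0, k) = (k == 0%N)%:R.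
Proof.
case: k => [|k]; first exact: binomz0r.
by rewrite /binomz big_ord_recl subr0 mul0r mul0r.
Qed.

Lemma binomz_step n k : 'B(n, k.+1) * k.+1%:R = 'B(n, k) * (n - k%:Z)%:~R.
Proof.
rewrite /binomz big_ord_recr /= factS natrM.
have := fact_neq0 k; have : (k.+1)%:R != 0 :> K by rewrite pnatr_eq0.
move: (k.+1%:R : K) (k`!%:R : K) => x y x0 y0.
by field; rewrite x0 y0.
Qed.

Lemma binomz_pascal n k : 'B(n + 1, k.+1) = 'B(n, k.+1) + 'B(n, k).
Proof.
elim: k => [|k IH].
  by rewrite /binomz !big_ord_recl !big_ord0 fact0 /= !subr0 !divr1 !mulr1 intrD.
apply: (mulIf (x := (k.+2)%:R)); first by rewrite pnatr_eq0.
rewrite mulrDl !binomz_step IH.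
have -> : n + 1 - k.+1%:Z = n - k%:Z by lia.
have -> : n - k.+1%:Z = (n - k%:Z) - 1 by lia.
rewrite mulrDl -binomz_step intrB -[k.+2]addn1 natrD.
by ring.
Qed.

Lemma binomz_nat t k : 'B(t%:Z, k) = 'C(t, k)%:R.
Proof.
elim: t k => [|t IH] k; first by rewrite binomz0l bin0n.
case: k => [|k]; first by rewrite binomz0r bin0.
by rewrite -addn1 PoszD binomz_pascal !IH addn1 binS natrD.
Qed.

Lemma binomz_small t j : (t < j)%N -> 'B(t%:Z, j) = 0.
Proof. by move=> tj; rewrite binomz_nat bin_small. Qed.

(** Both sides are 1 at k = 0 and satisfy Pascal's rule in n. The rule can be solved in either
    direction, so agreement at n = 0 spreads to all positive and negative n. *)
Lemma binomz_vandermonde n p k :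
  'B(n + p, k) = \sum_(i < k.+1) 'B(n, i) * 'B(p, (k - i)%N).
Proof.
pose c n k := \sum_(i < k.+1) 'B(n, i) * 'B(p, (k - i)%N).
have c0 n' : c n' 0%N = 1 by rewrite /c big_ord1 !binomz0r mulr1.
have cS n' k' : c (n' + 1) k'.+1 = c n' k'.+1 + c n' k'.
  rewrite /c !(big_ord_recl k'.+1) !subn0 !binomz0r -addrA; congr (_ + _).
  rewrite -big_split /=; apply: eq_bigr => i _.
  by rewrite /bump /= add1n subSS binomz_pascal mulrDl.
rewrite -/(c n k); elim/int_ind: n k => [|n IH|n IH] k.
- rewrite add0r /c big_ord_recl binomz0r mul1r subn0 big1 ?addr0 // => i _.
  by rewrite binomz0l /= mul0r.
- elim: k => [|k IHk]; first by rewrite binomz0r c0.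
  by rewrite -addn1 PoszD cS addrAC binomz_pascal !IH.
- elim: k => [|k IHk]; first by rewrite binomz0r c0.
  have E : - n.+1%:Z + 1 = - n%:Z by lia.
  have := cS (- n.+1%:Z) k; have := binomz_pascal (- n.+1%:Z + p) k.
  by rewrite addrAC E -IHk IH => -> /addIr.
Qed.

Lemma binomz_mul p t j :
  'B(p, t) * 'B(p - t%:Z, j) = \prod_(k < t + j) (p - k%:Z)%:~R / (t`!%:R * j`!%:R).
Proof.
rewrite /binomz mulf_div big_split_ord /=; congr (_ * _ / _); apply: eq_bigr => i _.
by rewrite PoszD opprD addrA.
Qed.

(** Both sides are the falling factorial of p of length t + j divided by t! j!. *)
Lemma binomz_mulC p t j : 'B(p, t) * 'B(p - t%:Z, j) = 'B(p, j) * 'B(p - j%:Z, t).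
Proof. by rewrite !binomz_mul addnC [j`!%:R * _]mulrC. Qed.

Lemma binomz_trinomial p t j : (j <= t)%N ->
  'B(p, t) * 'B(t%:Z, j) = 'B(p, j) * 'B(p - j%:Z, (t - j)%N).
Proof.
move=> jt; rewrite binomz_mul subnKC // binomz_nat /binomz -mulrA; congr (_ * _).
have := bin_fact jt; move/(congr1 (fun m : nat => m%:R : K)); rewrite !natrM => <-.
have := fact_neq0 j; have := fact_neq0 (t - j).
have : 'C(t, j)%:R != 0 :> K by rewrite pnatr_eq0 -lt0n bin_gt0.
move: ('C(t, j)%:R : K) (j`!%:R : K) ((t - j)`!%:R : K) => x y z x0 y0 z0.
by field; rewrite x0 y0 z0.
Qed.

(** Upper negation. It accounts for x2^-1 delta((x1 - x0) / x2) = x1^-1 delta((x2 + x0) / x1), and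
    so for the unsigned coefficients in [rexp]. *)
Lemma binomz_negate n k : (-1) ^+ k * 'B(n + k%:Z, k) = 'B(- n - 1, k).
Proof.
rewrite /binomz mulrA; congr (_ / _).
rewrite -[k in _ ^+ k]card_ord -prodrN (reindex_inj rev_ord_inj) /=.
apply: eq_bigr => i _; rewrite -rmorphN; congr (_ %:~R).
by have := ltn_ord i; lia.
Qed.
End Binom.

(** * Expansions and the Borcherds identity *)

Definition truncated (W : zmodType) (f : int -> W) : Prop :=
  exists N : int, forall n, N <= n -> f n = 0.

Definition truncated1 (W : zmodType) (F : int -> int -> W) : Prop :=
  exists N : int, forall m n, N <= m -> F m n = 0.

Definition truncated2 (W : zmodType) (F : int -> int -> W) : Prop :=
  exists N : int, forall m n, N <= n -> F m n = 0.

Lemma truncated_fin1 (W : zmodType) (f : int -> W) (h : nat -> int) c :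
  truncated f -> (forall i, h i = c + i%:Z) -> fin1 (fun i => f (h i)).
Proof. by move=> [N f0] hE; exists `|N - c|%N => i ?; rewrite f0 // hE; lia. Qed.

(* the coefficient of y^i in (1 - y)^n *)
Definition sbinom (K : numFieldType) (n : int) (i : nat) : K := (-1) ^+ i * binomz K n i.

Section Expand.
Variables (K : numFieldType) (W : lmodType K).
Implicit Types (F G : int -> int -> W) (l m n p : int).
Local Notation B := (binomz K).
Local Notation sb := (sbinom K).

Lemma sbinom0l i : sb 0 i = (i == 0%N)%:R.
Proof. by rewrite /sbinom binomz0l; case: i => [|i]; rewrite ?mulr1 ?mulr0. Qed.

Lemma sbinom0r n : sb n 0 = 1.
Proof. by rewrite /sbinom binomz0r mulr1. Qed.

Lemma sbinom_pascal n i : sb (n + 1) i.+1 = sb n i.+1 - sb n i.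
Proof. by rewrite /sbinom binomz_pascal exprS; ring. Qed.

Lemma sbinom_vandermonde n p k :
  sb (n + p) k = \sum_(i < k.+1) sb n i * sb p (k - i)%N.
Proof.
rewrite /sbinom binomz_vandermonde mulr_sumr; apply: eq_bigr => i _.
by rewrite [RHS]mulrACA -exprD subnKC // -ltnS.
Qed.

Lemma sbinom_sum n k :
  \sum_(t < k.+1) sb n t = sb (n - 1) k.
Proof.
elim: k => [|k IH]; first by rewrite big_ord1 !sbinom0r.
have := sbinom_pascal (n - 1) k; rewrite subrK => E.
by rewrite big_ord_recr /= IH E addrC subrK.
Qed.

(* the mode (m, n) of (x1 - x2)^l F(x1, x2), expanded in nonnegative powers of x2 *)
Definition xexp F l m n : W :=
  nsum (fun i => sb l i *: F (l + m - i%:Z) (n + i%:Z)).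

(* the mode (l, n) of (x2 + x0)^m G(x0, x2), expanded in nonnegative powers of x0 *)
Definition rexp G l m n : W :=
  nsum (fun k => B m k *: G (l + k%:Z) (m + n - k%:Z)).

Lemma xexp_fin F (f : nat -> int) n : truncated2 F -> fin1 (fun i => F (f i) (n + i%:Z)).
Proof. by move=> [N F0]; exists `|N - n|%N => i ?; rewrite F0 //; lia. Qed.

Lemma rexp_fin G (f : nat -> int) l : truncated1 G -> fin1 (fun i => G (l + i%:Z) (f i)).
Proof. by move=> [N F0]; exists `|N - l|%N => i ?; rewrite F0 //; lia. Qed.

Lemma xexp_truncated F l : truncated2 F -> truncated2 (xexp F l).
Proof.
move=> [N F0]; exists N => m n Nn; apply: nsum_0 => i.
by rewrite F0 ?scaler0 //; lia.
Qed.

Lemma xexp0l F m n : xexp F 0 m n = F m n.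
Proof.
rewrite /xexp nsum_first => [|i]; last by rewrite sbinom0l scale0r.
by rewrite sbinom0r scale1r add0r subr0 addr0.
Qed.

Lemma rexp0 G l n : rexp G l 0 n = G l n.
Proof.
rewrite /rexp nsum_first => [|i]; last by rewrite binomz0l scale0r.
by rewrite binomz0r scale1r add0r subr0 addr0.
Qed.

Lemma xexp_pascal F l m n : truncated2 F ->
  xexp F (l + 1) m n = xexp F l (m + 1) n - xexp F l m (n + 1).
Proof.
move=> tF; rewrite /xexp nsum_recl; last exact/fin1Z/xexp_fin.
rewrite [X in _ = X - _]nsum_recl; last exact/fin1Z/xexp_fin.
rewrite -[RHS]addrA -nsumB; last 2 first.
- have := fin1Z (sb l) (@xexp_fin F (fun i => l + (m + 1) - i%:Z) n tF).
  by move=> [N h]; exists N => i ?; apply: h; lia.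
- exact/fin1Z/xexp_fin.
congr (_ *: F _ _ + _); rewrite ?sbinom0r //; first by lia.
apply: eq_nsum => i; rewrite sbinom_pascal scalerBl.
by congr (_ *: F _ _ - _ *: F _ _); lia.
Qed.

(** (x1 - x2)^(l + p) is the product of the two expansions, by Vandermonde; truncation in n makes
    the double sum finite, so the factors may be applied one after the other. *)
Lemma xexp_add F l p m n : truncated2 F ->
  xexp F (l + p) m n = nsum (fun t => sb p t *: xexp F l (m + p - t%:Z) (n + t%:Z)).
Proof.
move=> tF; have [N F0] := tF.
pose H t i := (sb p t * sb l i) *: F (l + (m + p - t%:Z) - i%:Z) (n + t%:Z + i%:Z).
have fH : fin2 H.
  exists `|N - n|%N => t i ti; rewrite /H F0 ?scaler0 //; lia.
rewrite [RHS](eq_nsum (h := fun t => nsum (H t))) => [|t]; last first.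
  rewrite scale_nsum; last exact/fin1Z/xexp_fin.
  by apply: eq_nsum => i; rewrite scalerA.
rewrite nsum_diag //; apply: eq_nsum => k; rewrite addrC sbinom_vandermonde scaler_suml.
apply: eq_bigr => i _; rewrite /H; congr (_ *: F _ _); have := ltn_ord i; lia.
Qed.

Lemma signD (l : int) (k : nat) : (-1) ^ (l + k%:Z) = (-1) ^ l * (-1) ^+ k :> K.
Proof. by rewrite expfzDr ?oppr_eq0 ?oner_eq0. Qed.

Lemma sign_sqr (l : int) : (-1) ^ l * (-1) ^ l = 1 :> K.
Proof. by rewrite -expfzMl mulrNN mulr1 exp1rz. Qed.

Lemma sign_sqrn (k : nat) : (-1) ^+ k * (-1) ^+ k = 1 :> K.
Proof. exact: (sign_sqr k). Qed.

(* The substitution x0 -> - x0 turns (x2 + x0)^m into the expansion of [xexp]. *)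
Lemma rexp_xexp G l m n : truncated1 G ->
  rexp G l m n = (-1) ^ l *: xexp (fun x y => (-1) ^ y *: G y x) m n l.
Proof.
move=> [N G0]; rewrite /xexp scale_nsum; last first.
  by exists `|N - l|%N => i ?; rewrite G0 ?scaler0 //; lia.
apply: eq_nsum => k; rewrite !scalerA; congr (_ *: _).
rewrite /sbinom signD; transitivity ((-1) ^ l * (-1) ^ l * ((-1) ^+ k * (-1) ^+ k) * B m k).
  by rewrite sign_sqr sign_sqrn !mul1r.
by ring.
Qed.

Let sign_swap_truncated G : truncated1 G -> truncated2 (fun x y => (-1 : K) ^ y *: G y x).
Proof. by move=> [N G0]; exists N => m n Nn; rewrite G0 ?scaler0. Qed.

Lemma rexp_add G l p m n : truncated1 G ->
  rexp G l (m + p) n = nsum (fun s => B p s *: rexp G (l + s%:Z) m (n + p - s%:Z)).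
Proof.
move=> tG; rewrite rexp_xexp // xexp_add ?scale_nsum; try exact: sign_swap_truncated.
  apply: eq_nsum => s; rewrite rexp_xexp // !scalerA; congr (_ *: _).
  by rewrite signD /sbinom; ring.
exact/fin1Z/(xexp_fin _ _ (xexp_truncated _ (sign_swap_truncated tG))).
Qed.

Lemma rexp_pascal G l m n : truncated1 G ->
  rexp G l (m + 1) n = rexp G (l + 1) m n + rexp G l m (n + 1).
Proof.
move=> tG; rewrite !rexp_xexp // xexp_pascal; last exact: sign_swap_truncated.
by rewrite (signD l 1) expr1 mulrN1 scaleNr scalerBr addrC.
Qed.

(* F, F' and G stand for Y(u, x1)Y(v, x2)w, Y(v, x2)Y(u, x1)w and Y(Y(u, x0)v, x2)w. *)
Definition borcherds F F' G : Prop := forall l m n,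
  xexp F l m n - (-1) ^ l *: xexp F' l n m = rexp G l m n.

(* Pascal's rule propagates the identity from [l = 0] and [m = 0] to all indices. *)
Lemma borcherds_comm_iter F F' G :
  truncated2 F -> truncated2 F' -> truncated1 G ->
  (forall m n, F m n - F' n m = rexp G 0 m n) ->
  (forall l n, xexp F l 0 n - (-1) ^ l *: xexp F' l n 0 = G l n) ->
  borcherds F F' G.
Proof.
move=> tF tF' tG hc hi l m n.
pose D l m n := xexp F l m n - (-1) ^ l *: xexp F' l n m - rexp G l m n.
suff : D l m n = 0 by move/subr0_eq.
have D0 m' n' : D 0 m' n' = 0 by rewrite /D !xexp0l expr0z scale1r hc subrr.
have Dm0 l' n' : D l' 0 n' = 0 by rewrite /D hi rexp0 subrr.
have DP l' m' n' : D l' (m' + 1) n' = D (l' + 1) m' n' + D l' m' (n' + 1).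
  rewrite /D !xexp_pascal // rexp_pascal // (signD l' 1) expr1 mulrN1 scaleNr.
  rewrite opprK scalerBr [RHS]addrACA opprD; congr (_ + _).
  by rewrite [RHS]addrAC !subrKA.
(* The defect D vanishes for l = 0 and for m = 0. For l > 0, [DP] is solved for D at l + 1. For l <
   0 the term at l + 1 is 0 by induction, so D(l, m + 1, n) = D(l, m, n + 1), and one moves away
   from m = 0 in both directions. *)
elim/int_ind: l m n => [|l IH|l IH] m n; first exact: D0.
  have := DP l%:Z m n; by rewrite !IH addr0 -addn1 PoszD => <-.
have El : - l.+1%:Z + 1 = - l%:Z by lia.
elim/int_ind: m n => [|m IHm|m IHm] n; first exact: Dm0.
  have -> : m.+1%:Z = m%:Z + 1 by lia.
  by rewrite DP El IH IHm addr0.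
have := DP (- l.+1%:Z) (- m.+1%:Z) (n - 1).
have -> : - m.+1%:Z + 1 = - m%:Z by lia.
by rewrite IHm El IH add0r subrK.
Qed.
End Expand.

(** * The Borcherds identity for a_p u *)

Section Families.
Variables (K : numFieldType) (W : lmodType K).
Implicit Types (l m n p : int).
Local Notation B := (binomz K).
Local Notation sb := (sbinom K).

Lemma sbinom_trinomial p j t : sb p (j + t) * B (j + t)%:Z j = sb p j * sb (p - j%:Z) t.
Proof.
by rewrite /sbinom -mulrA binomz_trinomial ?leq_addr // addKn exprD; ring.
Qed.

Lemma sbinom_mulC p t j : sb p t * B (p - t%:Z) j = B p j * sb (p - j%:Z) t.
Proof. by rewrite /sbinom -mulrA binomz_mulC; ring. Qed.

Section Products.
Variable H : nat -> int -> int -> W.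
Hypothesis H0 : exists J, forall j x y, (J <= j)%N -> H j x y = 0.
Hypothesis tH : forall j, truncated2 (H j).

Lemma family_fin (c : nat -> nat -> K) (f h : nat -> nat -> int) :
  (forall j, exists c, forall t, h t j = c + t%:Z) ->
  fin2 (fun t j => c t j *: H j (f t j) (h t j)).
Proof.
move=> hE; apply: fin2_half => [|j].
  by have [J HJ] := H0; exists J => t j Jj; rewrite HJ ?scaler0.
have [N HN] := tH j; have [d hd] := hE j.
by exists `|N - d|%N => t Nt; rewrite HN ?scaler0 // hd; lia.
Qed.

Lemma family_xexp_swap l m n p (c : nat -> K) :
  nsum (fun i => sb l i *: nsum (fun j => c j *: xexp (H j) (p - j%:Z) (l + m - i%:Z) (n + i%:Z))) =
  nsum (fun j => c j *: xexp (H j) (l + p - j%:Z) m n).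
Proof.
rewrite nsum_swapZ.
  apply: eq_nsum => j; congr (_ *: _).
  have -> : l + p - j%:Z = p - j%:Z + l by lia.
  by rewrite xexp_add //; apply: eq_nsum => i; congr (_ *: xexp _ _ _ _); lia.
apply: fin2_half => [|j].
  have [J HJ] := H0; exists J => i j Jj; apply: nsum_0 => k.
  by rewrite HJ ?scaler0.
exact/xexp_fin/xexp_truncated.
Qed.

(** Here [H j x y] will be u_x (a_j v)_y w, produced by moving a_t past v. As t >= 0, only t >= j
    contributes; with t = j + s the trinomial identity splits off [sb p j], and the sum over s
    expands (x1 - x2)^(p - j). *)
Lemma family_left l m n p :
  nsum (fun i => sb l i *: nsum (fun t => sb p t *: nsum (fun j =>
    B t%:Z j *: H j (p + (l + m - i%:Z) - t%:Z) (t%:Z + (n + i%:Z) - j%:Z)))) =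
  nsum (fun j => sb p j *: xexp (H j) (l + p - j%:Z) m n).
Proof.
rewrite -family_xexp_swap; apply: eq_nsum => i; congr (_ *: _).
pose F t j := B t%:Z j *: H j (p + (l + m - i%:Z) - t%:Z) (t%:Z + (n + i%:Z) - j%:Z).
have fF : fin2 F by apply: family_fin => j; exists (n + i%:Z - j%:Z) => t; lia.
pose F' t j := sb p t *: F t j.
have fF' : fin2 F' by apply: fin2Z.
rewrite (eq_nsum (h := fun t => nsum (F' t))) => [|t]; last first.
  by rewrite (scale_nsum _ (fin2_row t fF)).
rewrite nsum_swap //; apply: eq_nsum => j.
rewrite (nsum_shift (j := j) (fin2_col j fF')); last first.
  by move=> t tj; rewrite /F' /F binomz_small // scale0r scaler0.
rewrite /xexp scale_nsum; last exact/fin1Z/xexp_fin.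
apply: eq_nsum => t; rewrite /F' /F !scalerA sbinom_trinomial.
by congr (_ *: H _ _ _); lia.
Qed.

(** Here [H j x y] will be (a_j v)_x u_y w, produced by moving a_(p - t) past v. The index p - t may
    be negative, so t is not shifted; the symmetry of [sbinom_mulC] leaves the unsigned weight
    [B p j]. *)
Lemma family_right l m n p :
  nsum (fun i => sb l i *: nsum (fun t => sb p t *: nsum (fun j =>
    B (p - t%:Z) j *: H j (p - t%:Z + (l + n - i%:Z) - j%:Z) (m + i%:Z + t%:Z)))) =
  nsum (fun j => B p j *: xexp (H j) (l + p - j%:Z) n m).
Proof.
rewrite -family_xexp_swap; apply: eq_nsum => i; congr (_ *: _).
pose F t j := B (p - t%:Z) j *: H j (p - t%:Z + (l + n - i%:Z) - j%:Z) (m + i%:Z + t%:Z).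
have fF : fin2 F by apply: family_fin => j; exists (m + i%:Z) => t; lia.
pose F' t j := sb p t *: F t j.
have fF' : fin2 F' by apply: fin2Z.
rewrite (eq_nsum (h := fun t => nsum (F' t))) => [|t]; last first.
  by rewrite (scale_nsum _ (fin2_row t fF)).
rewrite nsum_swap //; apply: eq_nsum => j.
rewrite /xexp scale_nsum; last exact/fin1Z/xexp_fin.
apply: eq_nsum => t; rewrite /F' /F !scalerA sbinom_mulC.
by congr (_ *: H _ _ _); lia.
Qed.
End Products.

Lemma rexp_swap (G : nat -> int -> int -> W) (c : nat -> K) (q : nat -> int) l m n :
  (exists R, forall r x y, (R <= r)%N -> G r x y = 0) -> (forall r, truncated1 (G r)) ->
  nsum (fun k => B m k *: nsum (fun r => c r *: rexp (G r) (l + k%:Z) (q r) (m + n - k%:Z))) =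
  nsum (fun r => c r *: rexp (G r) l (m + q r) n).
Proof.
move=> [R GR] tG; rewrite nsum_swapZ.
  apply: eq_nsum => r; rewrite (addrC m (q r)) rexp_add //; congr (_ *: _).
  by apply: eq_nsum => k; congr (_ *: rexp _ _ _ _); lia.
apply: fin2_half => [|r].
  by exists R => k r Rr; apply: nsum_0 => i; rewrite GR ?scaler0.
have [N GN] := tG r; exists `|N - l|%N => k Nk; apply: nsum_0 => i.
by rewrite GN ?scaler0 //; lia.
Qed.

(** For [G r x y] = (u_x v)_y a_r w. The sign (-1)^(p - s) cancels the alternation in s, so the sum
    over s expands (x2 + x0)^(p - r), which raises the exponent m. *)
Lemma family_iter_right (G : nat -> int -> int -> W) l m n p :
  (exists R, forall r x y, (R <= r)%N -> G r x y = 0) -> (forall r, truncated1 (G r)) ->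
  nsum (fun k => B m k *: nsum (fun s => sb p s *: ((-1) ^ (p - s%:Z) *: nsum (fun r =>
    sb (p - s%:Z) r *: G r (l + k%:Z + s%:Z) (p - s%:Z + (m + n - k%:Z) - r%:Z))))) =
  (-1) ^ p *: nsum (fun r => sb p r *: rexp (G r) l (m + (p - r%:Z)) n).
Proof.
move=> G0 tG; have [R GR] := G0.
rewrite scale_nsum; last first.
  by exists R => r Rr; rewrite /rexp nsum_0 ?scaler0 // => k; rewrite GR ?scaler0.
rewrite [RHS](eq_nsum (h := fun r =>
    ((-1) ^ p * sb p r) *: rexp (G r) l (m + (p - r%:Z)) n)); last first.
  by move=> r; rewrite scalerA.
rewrite -(rexp_swap (fun r => (-1) ^ p * sb p r) (fun r => p - r%:Z) l m n G0 tG).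
apply: eq_nsum => k; congr (_ *: _).
pose F s r := sb (p - s%:Z) r *: G r (l + k%:Z + s%:Z) (p - s%:Z + (m + n - k%:Z) - r%:Z).
have fF : fin2 F.
  apply: fin2_half => [|r].
    by exists R => s r Rr; rewrite /F GR ?scaler0.
  have [N GN] := tG r; exists `|(N - (l + k%:Z))%R|%N => s Ns.
  by rewrite /F GN ?scaler0 //; lia.
pose F' s r := (sb p s * (-1) ^ (p - s%:Z)) *: F s r.
have fF' : fin2 F' by apply: fin2Z.
rewrite (eq_nsum (h := fun s => nsum (F' s))) => [|s]; last first.
  by rewrite scalerA (scale_nsum _ (fin2_row s fF)).
rewrite nsum_swap //; apply: eq_nsum => r.
rewrite /rexp scale_nsum; last exact/fin1Z/rexp_fin.
apply: eq_nsum => s; rewrite /F' /F !scalerA; congr (_ *: G _ _ _); last by lia.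
have E : B p s * B (p - s%:Z) r = B p r * B (p - r%:Z) s by exact: binomz_mulC.
have -> : (-1) ^ p = (-1) ^ (p - s%:Z) * (-1) ^+ s :> K by rewrite -signD subrK.
rewrite /sbinom.
transitivity ((-1) ^ (p - s%:Z) * (-1) ^+ s * (-1) ^+ r * (B p s * B (p - s%:Z) r)).
  by ring.
by rewrite E; ring.
Qed.

Lemma rexp_fin_mid (G : int -> int -> W) l m n : truncated1 G -> (forall x, truncated (G x)) ->
  fin1 (fun t : nat => rexp G l (m + t%:Z) n).
Proof.
move=> [N GN] tG; pose F s t := B (m + Posz t) s *: G (l + s%:Z) (m + t%:Z + n - s%:Z).
apply: (@fin2_nsuml _ F); apply: fin2_box => [|s].
  by exists `|N - l|%N => s t Ns; rewrite /F GN ?scaler0 //; lia.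
by apply: fin1Z; apply: (truncated_fin1 (c := m + n - s%:Z)) => // t; lia.
Qed.

(** For [A z] = a_z and [G x y] = (u_x v)_y w. With t = r + s the trinomial identity isolates
    [sb p t], and the remaining sum over s expands (x2 + x0)^t, which raises the exponent m to m +
    t. *)
Lemma family_iter_left (A : int -> W -> W) (G : int -> int -> W) l m n p :
  (forall z, linear (A z)) -> truncated1 G -> (forall x, truncated (G x)) ->
  nsum (fun k => B m k *: nsum (fun s => sb p s *: nsum (fun r =>
    sb (p - s%:Z) r *: A (p - s%:Z - r%:Z) (G (l + k%:Z + s%:Z) (m + n - k%:Z + r%:Z))))) =
  nsum (fun t => sb p t *: A (p - t%:Z) (rexp G l (m + t%:Z) n)).
Proof.
move=> Al tG tG'; have [N GN] := tG.
rewrite (eq_nsum (h := fun k => B m k *: nsum (fun t =>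
    sb p t *: A (p - t%:Z) (rexp G (l + k%:Z) t%:Z (m + n - k%:Z))))); last first.
  move=> k; congr (_ *: _).
  pose F s t := (sb p t * B (Posz t) s) *:
    A (p - t%:Z) (G (l + k%:Z + s%:Z) (t%:Z + (m + n - k%:Z) - s%:Z)).
  have fF : fin2 F.
    apply: fin2_box => [|s].
      exists `|(N - (l + k%:Z))%R|%N => s t Ns; rewrite /F GN ?(lin0 (Al _)) ?scaler0 //; lia.
    apply: fin1Z; have [c hc] := tG' (l + k%:Z + s%:Z).
    by exists `|(c - (m + n - k%:Z - s%:Z))%R|%N => t ct; rewrite hc ?(lin0 (Al _)) //; lia.
  rewrite (eq_nsum (h := fun s => nsum (F s))); last first.
    move=> s; rewrite (nsum_shift (j := s) (fin2_row s fF)); last first.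
      by move=> t ts; rewrite /F binomz_small // mulr0 scale0r.
    rewrite scale_nsum.
      apply: eq_nsum => r; rewrite /F scalerA sbinom_trinomial.
      by congr (_ *: A _ (G _ _)); lia.
    apply: fin1Z; have [c hc] := tG' (l + k%:Z + s%:Z).
    by exists `|(c - (m + n - k%:Z))%R|%N => t ct; rewrite hc ?(lin0 (Al _)) //; lia.
  rewrite nsum_swap //; apply: eq_nsum => t.
  rewrite /rexp (lin_nsum (Al _)); last exact/fin1Z/rexp_fin.
  rewrite scale_nsum; last by apply: (lin_fin1 (Al _)); exact/fin1Z/rexp_fin.
  by apply: eq_nsum => s; rewrite (linZ (Al _)) scalerA.
rewrite nsum_swapZ.
  apply: eq_nsum => t; congr (_ *: _).
  rewrite (addrC m t%:Z) rexp_add // (lin_nsum (Al _)).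
    by apply: eq_nsum => k; rewrite (linZ (Al _)); congr (_ *: A _ (rexp _ _ _ _)); lia.
  apply: fin1Z; exists `|N - l|%N => k Nk; apply: nsum_0 => i.
  by rewrite GN ?scaler0 //; lia.
apply: fin2_box => [|k].
  exists `|N - l|%N => k t Nk; rewrite /rexp nsum_0 ?(lin0 (Al _)) // => i.
  by rewrite GN ?scaler0 //; lia.
have [c hc] := rexp_fin_mid (l + k%:Z) 0 (m + n - k%:Z) tG tG'.
by exists c => t /hc; rewrite add0r => ->; rewrite (lin0 (Al _)).
Qed.
End Families.

(* [nu v n w] is the mode v_n w. *)
Definition field_map (K : numFieldType) (V W : lmodType K) (nu : V -> int -> W -> W) : Prop :=
  [/\ forall n w, linear (fun v => nu v n w),
      forall v n, linear (nu v n) &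
      forall v w, truncated (fun n => nu v n w)].

Definition borcherds_pair (K : numFieldType) (V W : lmodType K)
    (mu : V -> int -> V -> V) (nu : V -> int -> W -> W) (u v : V) : Prop :=
  forall w, borcherds (fun x y => nu u x (nu v y w)) (fun y x => nu v y (nu u x w))
    (fun x y => nu (mu u x v) y w).

(* The part of the Borcherds identity at [m = 0]. *)
Definition iterate_pair (K : numFieldType) (V W : lmodType K)
    (mu : V -> int -> V -> V) (nu : V -> int -> W -> W) (u v : V) : Prop :=
  forall p n w, nu (mu u p v) n w =
    nsum (fun t => sbinom K p t *: nu u (p - t%:Z) (nu v (n + t%:Z) w)) -
    (-1) ^ p *: nsum (fun t => sbinom K p t *: nu v (p + n - t%:Z) (nu u t%:Z w)).

(* The part of the Borcherds identity at [l = 0]. *)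
Definition commutator_pair (K : numFieldType) (V W : lmodType K)
    (mu : V -> int -> V -> V) (nu : V -> int -> W -> W) (u v : V) : Prop :=
  forall m n w, nu u m (nu v n w) - nu v n (nu u m w) =
    nsum (fun j => binomz K m j *: nu (mu u j%:Z v) (m + n - j%:Z) w).

Section Formulas.
Variables (K : numFieldType) (V W : lmodType K).
Variables (mu : V -> int -> V -> V) (nu : V -> int -> W -> W) (u v : V).
Hypothesis h : borcherds_pair mu nu u v.

Lemma borcherds_commutator : commutator_pair mu nu u v.
Proof.
move=> m n w; have := h w 0 m n; rewrite !xexp0l expr0z scale1r => ->.
by apply: eq_nsum => j; rewrite add0r.
Qed.

Lemma borcherds_iterate : iterate_pair mu nu u v.
Proof.
move=> p n w; have := h w p 0 n; rewrite rexp0 => <-; rewrite /xexp.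
by congr (_ - _ *: _); apply: eq_nsum => t; rewrite ?addr0 ?add0r.
Qed.
End Formulas.

Section Modes.
Variables (K : numFieldType) (V W : lmodType K).
Variables (mu : V -> int -> V -> V) (nu : V -> int -> W -> W).
Hypotheses (fmu : field_map mu) (fnu : field_map nu).
Local Notation B := (binomz K).
Local Notation sb := (sbinom K).
Local Notation bor := (borcherds_pair mu nu).
Implicit Types (u v a : V) (w : W) (l m n p : int).

Let nuL n w : linear (fun v => nu v n w). Proof. by case: fnu. Qed.
Let nuR v n : linear (nu v n). Proof. by case: fnu. Qed.
Let nuT v w : truncated (fun n => nu v n w). Proof. by case: fnu. Qed.
Let muT u v : truncated (fun n => mu u n v). Proof. by case: fmu. Qed.

Lemma prod_truncated u v w : truncated2 (fun x y => nu u x (nu v y w)).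
Proof. by have [N h] := nuT v w; exists N => m n /h ->; exact: lin0. Qed.

Lemma prod_fin u v w n (f : nat -> int) : fin1 (fun i => nu u (f i) (nu v (n + i%:Z) w)).
Proof. exact: (xexp_fin f n (prod_truncated u v w)). Qed.

Lemma iter_truncated u v w : truncated1 (fun x y => nu (mu u x v) y w).
Proof. by have [N h] := muT u v; exists N => m n /h ->; exact: (lin0 (nuL n w)). Qed.

Lemma iter_fin u v p n w :
  fin1 (fun t => sb p t *: nu u (p - t%:Z) (nu v (n + t%:Z) w)) /\
  fin1 (fun t => sb p t *: nu v (p + n - t%:Z) (nu u t%:Z w)).
Proof.
split; apply: fin1Z.
  exact: prod_fin.
have := prod_fin v u w 0 (fun t => p + n - t%:Z).
by apply: fin1_ext => t; rewrite add0r.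
Qed.

Lemma fin2_nested x y w (phi : nat -> nat -> W -> W) (e d : nat -> nat -> int) :
  (forall i t, phi i t 0 = 0) ->
  (forall i, exists c, forall t, e i t = c + t%:Z) -> (exists c, forall i t, d i t = c + i%:Z) ->
  fin2 (fun i t => phi i t (nu x (e i t) (nu y (d i t) w))).
Proof.
move=> p0 ec [d0 dE]; have [N hN] := nuT y w.
apply: fin2_box => [|i].
  by exists `|N - d0|%N => i t Ni; rewrite hN ?(lin0 (nuR _ _)) ?p0 // dE; lia.
have [c hc] := ec i; have [M hM] := nuT x (nu y (d0 + i%:Z) w).
by exists `|M - c|%N => t Mt; rewrite dE hM ?p0 // hc; lia.
Qed.

Section Step.
Variables (a u v : V) (p : int).
Hypothesis ha : forall v, bor a v.
Hypothesis hu : forall v, bor u v.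
Hypothesis hau : borcherds_pair mu mu a u.

Let av j := mu a (Posz j) v.
Let avJ : exists J, forall j, (J <= j)%N -> av j = 0.
Proof. by have [N h] := muT a v; exists `|N|%N => j Nj; apply: h; lia. Qed.

Let nu0 n w : nu 0 n w = 0. Proof. exact: (lin0 (nuL n w)). Qed.
Let nur0 x n : nu x n 0 = 0. Proof. exact: (lin0 (nuR x n)). Qed.

Let H w (j : nat) (x y : int) := nu u x (nu (av j) y w).
Let H' w (j : nat) (x y : int) := nu (av j) x (nu u y w).

Let H_supp w : exists J, forall j x y, (J <= j)%N -> H w j x y = 0.
Proof. by have [J h] := avJ; exists J => j x y Jj; rewrite /H h // nu0. Qed.
Let H'_supp w : exists J, forall j x y, (J <= j)%N -> H' w j x y = 0.
Proof. by have [J h] := avJ; exists J => j x y Jj; rewrite /H' h // nu0. Qed.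

(** The iterate formula splits (a_p u)_x into terms with a_(p - t) left of u and terms with a_t, t
    >= 0, right of u. The lemmas [left1] to [right2] bring all products to one normal form, a_(p -
    t) leftmost and a_t next to w. In [left1] and [right2] this holds already; in [left2] and
    [right1] the mode of a has to cross v, which leaves the corrections H and H' in the vectors a_j
    v. *)
Let left1 l m n w :
  nsum (fun i => sb l i *: nsum (fun t => sb p t *:
    nu a (p - t%:Z) (nu u (l + m - i%:Z + t%:Z) (nu v (n + i%:Z) w)))) =
  nsum (fun t => sb p t *: nu a (p - t%:Z)
    (xexp (fun x y => nu u x (nu v y w)) l (m + t%:Z) n)).
Proof.
rewrite nsum_swapZ.
  apply: eq_nsum => t; congr (_ *: _); rewrite (lin_nsum (nuR _ _)); last first.
    exact/fin1Z/prod_fin.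
  apply: eq_nsum => i; rewrite (linZ (nuR _ _)); congr (_ *: nu _ _ (nu _ _ _)); lia.
apply: (fin2_nested _ _ _ (phi := fun _ t => nu a (p - Posz t))) => //; last by exists n.
by move=> i; exists (l + m - i%:Z).
Qed.

Let right2_fin l m n w : fin2 (fun i t =>
  nu v (l + n - Posz i) (nu u (p + (m + Posz i) - Posz t) (nu a (Posz t) w))).
Proof.
apply: (@fin2_sym _ (fun t i =>
  nu v (l + n - Posz i) (nu u (p + (m + Posz i) - Posz t) (nu a (Posz t) w)))).
apply: (fin2_nested _ _ _ (phi := fun _ t => nu v (l + n - Posz t))) => //.
  by move=> t; exists (p + m - t%:Z) => i; lia.
by exists 0 => i t; rewrite add0r.
Qed.

Let right2 l m n w :
  nsum (fun i => sb l i *: nsum (fun t => sb p t *: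
    nu v (l + n - i%:Z) (nu u (p + (m + i%:Z) - t%:Z) (nu a t%:Z w)))) =
  nsum (fun t => sb p t *:
    xexp (fun y x => nu v y (nu u x (nu a t%:Z w))) l n (m + (p - t%:Z))).
Proof.
rewrite nsum_swapZ.
  apply: eq_nsum => t; congr (_ *: _); apply: eq_nsum => i.
  by congr (_ *: nu _ _ (nu _ _ _)); lia.
exact: right2_fin.
Qed.

Let left2 l m n w :
  nsum (fun i => sb l i *: nsum (fun t => sb p t *:
    nu u (p + (l + m - i%:Z) - t%:Z) (nu a t%:Z (nu v (n + i%:Z) w)))) =
  nsum (fun t => sb p t *:
    xexp (fun x y => nu u x (nu v y (nu a t%:Z w))) l (m + (p - t%:Z)) n) +
  nsum (fun j => sb p j *: xexp (H w j) (l + p - j%:Z) m n).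
Proof.
pose F i t := nu u (p + (l + m - Posz i) - Posz t) (nu v (n + Posz i) (nu a (Posz t) w)).
have fF : fin2 F.
  apply: (@fin2_sym _ (fun t i => F i t)).
  apply: fin2_box => [|t].
    have [N hN] := nuT a w; exists `|N|%N => t i Nt.
    by rewrite /F hN ?nur0 //; lia.
  exact: prod_fin.
pose H2 i t j := B (Posz t) j *:
  H w j (p + (l + m - Posz i) - Posz t) (Posz t + (n + Posz i) - Posz j).
have fH2 i : fin2 (H2 i).
  apply: (family_fin (H_supp w)) => j; first exact: prod_truncated.
  by exists (n + i%:Z - j%:Z) => t; lia.
have E i t : nu u (p + (l + m - i%:Z) - t%:Z) (nu a t%:Z (nu v (n + i%:Z) w)) =
    F i t + nsum (H2 i t).
  have := borcherds_commutator (ha v) t%:Z (n + i%:Z) w => /eqP; rewrite subr_eq => /eqP ->.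
  rewrite (linD (nuR _ _)) addrC; congr (_ + _).
  rewrite (lin_nsum (nuR _ _)).
    by apply: eq_nsum => j; rewrite (linZ (nuR _ _)).
  by have [J h] := avJ; exists J => j /h; rewrite /av => ->; rewrite nu0 scaler0.
(* Over i, only the total and the F part are shown to be finitely supported; the correction inherits
   this as their difference. *)
rewrite (@nsum_splitZ _ _ _ _ (fun i => nsum (fun t => sb p t *: F i t))
  (fun i => nsum (fun t => sb p t *: nsum (H2 i t)))); last 3 first.
- move=> i; rewrite -nsumD; last 2 first.
  + exact/fin1Z/(fin2_row i fF).
  + exact/fin1Z/fin2_nsumr.
  by apply: eq_nsum => t; rewrite E scalerDr.
- have [N hN] := nuT v w; exists `|N - n|%N => i Ni; apply: nsum_0 => t.
  by rewrite hN ?nur0 ?scaler0 //; lia.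
- exact: (fin2_nsumr (fin2Z (fun _ => sb p) fF)).
congr (_ + _); last first.
  by apply: (family_left (H_supp w)) => j; exact: prod_truncated.
rewrite nsum_swapZ //; apply: eq_nsum => t; congr (_ *: _); apply: eq_nsum => i.
by congr (_ *: nu _ _ (nu _ _ _)); lia.
Qed.

Let right1 l m n w :
  nsum (fun i => sb l i *: nsum (fun t => sb p t *:
    nu v (l + n - i%:Z) (nu a (p - t%:Z) (nu u (m + i%:Z + t%:Z) w)))) =
  nsum (fun t => sb p t *: nu a (p - t%:Z)
    (xexp (fun y x => nu v y (nu u x w)) l n (m + t%:Z))) -
  nsum (fun j => B p j *: xexp (H' w j) (l + p - j%:Z) n m).
Proof.
pose F i t := nu a (p - Posz t) (nu v (l + n - Posz i) (nu u (m + Posz i + Posz t) w)).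
have [N hN] := nuT u w.
have fF : fin2 F.
  by exists `|N - m|%N => i t it; rewrite /F hN ?nur0 //; lia.
pose H2 i t j := B (p - Posz t) j *:
  H' w j (p - Posz t + (l + n - Posz i) - Posz j) (m + Posz i + Posz t).
have fH2 i : fin2 (H2 i).
  apply: (family_fin (H'_supp w)) => j; first exact: prod_truncated.
  by exists (m + i%:Z) => t; lia.
have E i t : nu v (l + n - i%:Z) (nu a (p - t%:Z) (nu u (m + i%:Z + t%:Z) w)) =
    F i t + - nsum (H2 i t).
  have := borcherds_commutator (ha v) (p - t%:Z) (l + n - i%:Z) (nu u (m + i%:Z + t%:Z) w).
  by rewrite -/(nsum (H2 i t)) => <-; rewrite /F subKr.
rewrite (@nsum_splitZ _ _ _ _ (fun i => nsum (fun t => sb p t *: F i t))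
  (fun i => - nsum (fun t => sb p t *: nsum (H2 i t)))); last 3 first.
- move=> i; rewrite -nsumB; last 2 first.
  + exact/fin1Z/(fin2_row i fF).
  + exact/fin1Z/fin2_nsumr.
  by apply: eq_nsum => t; rewrite E scalerBr.
- exists `|N - m|%N => i Ni; apply: nsum_0 => t.
  by rewrite hN ?nur0 ?scaler0 //; lia.
- exact: (fin2_nsumr (fin2Z (fun _ => sb p) fF)).
congr (_ + _); last first.
  rewrite -(family_right (H'_supp w)) => [|j]; last exact: prod_truncated.
  under eq_nsum => i do rewrite scalerN.
  apply: nsumN.
  have : fin2 (fun i t => sb p t *: nsum (H2 i t)).
    apply: fin2Z; exists `|N - m|%N => i t it; apply: nsum_0 => j.
    by rewrite /H2 /H' hN ?nur0 ?scaler0 //; lia.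
  by move/fin2_nsumr => [M hM]; exists M => i /hM ->; rewrite scaler0.
rewrite nsum_swapZ //; apply: eq_nsum => t; congr (_ *: _).
rewrite (lin_nsum (nuR _ _)); last exact/fin1Z/prod_fin.
apply: eq_nsum => i; rewrite (linZ (nuR _ _)).
by congr (_ *: nu _ _ (nu _ _ (nu _ _ _))); lia.
Qed.

Let lhs_left l m n w :
  xexp (fun x y => nu (mu a p u) x (nu v y w)) l m n =
  nsum (fun t => sb p t *: nu a (p - t%:Z)
    (xexp (fun x y => nu u x (nu v y w)) l (m + t%:Z) n)) -
  (-1) ^ p *: (nsum (fun t => sb p t *:
    xexp (fun x y => nu u x (nu v y (nu a t%:Z w))) l (m + (p - t%:Z)) n) +
  nsum (fun j => sb p j *: xexp (H w j) (l + p - j%:Z) m n)).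
Proof.
have [N hN] := nuT v w.
rewrite -left1 -left2; apply: nsum_subZ => [i||].
- exact: (borcherds_iterate (ha u)).
- by exists `|N - n|%N => i Ni; apply: nsum_0 => t; rewrite hN ?nur0 ?scaler0 //; lia.
- by exists `|N - n|%N => i Ni; apply: nsum_0 => t; rewrite hN ?nur0 ?scaler0 //; lia.
Qed.

Let lhs_right l m n w :
  xexp (fun y x => nu v y (nu (mu a p u) x w)) l n m =
  nsum (fun t => sb p t *: nu a (p - t%:Z)
    (xexp (fun y x => nu v y (nu u x w)) l n (m + t%:Z))) -
  nsum (fun j => B p j *: xexp (H' w j) (l + p - j%:Z) n m) -
  (-1) ^ p *: nsum (fun t => sb p t *:
    xexp (fun y x => nu v y (nu u x (nu a t%:Z w))) l n (m + (p - t%:Z))).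
Proof.
have [N hN] := nuT u w.
rewrite -right1 -right2; apply: nsum_subZ => [i||].
- have [f1 f2] := iter_fin a u p (m + i%:Z) w.
  rewrite (borcherds_iterate (ha u)) (linB (nuR _ _)) (linZ (nuR _ _)).
  rewrite (lin_nsum (nuR _ _) f1) (lin_nsum (nuR _ _) f2).
  by congr (_ - _ *: _); apply: eq_nsum => t; rewrite (linZ (nuR _ _)).
- by exists `|N - m|%N => i Ni; apply: nsum_0 => t; rewrite hN ?nur0 ?scaler0 //; lia.
- exact: (fin2_nsumr (fin2Z (fun _ => sb p) (right2_fin l m n w))).
Qed.

(** Two iterate formulas are nested: the one inside V for (a, u) rewrites (a_p u)_x v, then the one
    on W for (a, u_x v) produces P and Q. The third term, with a_s v, is the partner of the
    corrections H and H'. *)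
Let rhs l m n w :
  rexp (fun x y => nu (mu (mu a p u) x v) y w) l m n =
  nsum (fun t => sb p t *: nu a (p - t%:Z)
    (rexp (fun x y => nu (mu u x v) y w) l (m + t%:Z) n)) -
  (-1) ^ p *: nsum (fun r => sb p r *:
    rexp (fun x y => nu (mu u x v) y (nu a r%:Z w)) l (m + (p - r%:Z)) n) -
  (-1) ^ p *: nsum (fun s => sb p s *:
    rexp (fun x y => nu (mu u x (av s)) y w) (l + p - s%:Z) m n).
Proof.
have [N hN] := muT u v.
rewrite -(@family_iter_left _ _ (nu a) (fun x y => nu (mu u x v) y w)) //; last 1 first.
  exact: iter_truncated.
rewrite -(@family_iter_right _ _ (fun r x y => nu (mu u x v) y (nu a (Posz r) w))); first last.
- by move=> r; exact: iter_truncated.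
- by have [M hM] := nuT a w; exists `|M|%N => r x y Mr; rewrite hM ?nur0 //; lia.
have fav (q : nat -> nat -> int) :
    fin2 (fun k s => nu (mu u (p + (l + Posz k) - Posz s) (av s)) (q k s) w).
  apply: fin2_half => [|s].
    have [J hJ] := avJ; exists J => k s /hJ ->; rewrite (lin0 _) ?nu0 //.
    by case: fmu.
  have [M hM] := muT u (av s); exists `|(M - (p + l - s%:Z))%R|%N => k Mk.
  by rewrite hM ?nu0 //; lia.
have -> : nsum (fun s => sb p s *: rexp (fun x y => nu (mu u x (av s)) y w) (l + p - s%:Z) m n) =
    nsum (fun k => B m k *: nsum (fun s => sb p s *:
      nu (mu u (p + (l + k%:Z) - s%:Z) (av s)) (m + n - k%:Z) w)).
  rewrite [RHS]nsum_swapZ //; apply: eq_nsum => s; congr (_ *: _); apply: eq_nsum => k.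
  by congr (_ *: nu (mu _ _ _) _ _); lia.
pose P k s := nsum (fun r => sb (p - Posz s) r *: nu a (p - Posz s - Posz r)
  (nu (mu u (l + Posz k + Posz s) v) (m + n - Posz k + Posz r) w)).
pose Q k s := (-1) ^ (p - Posz s) *: nsum (fun r => sb (p - Posz s) r *:
  nu (mu u (l + Posz k + Posz s) v) (p - Posz s + (m + n - Posz k) - Posz r) (nu a (Posz r) w)).
have fP : fin2 P.
  exists `|N - l|%N => k s ks; apply: nsum_0 => r.
  by rewrite hN ?nu0 ?nur0 ?scaler0 //; lia.
have fQ : fin2 Q.
  exists `|N - l|%N => k s ks; rewrite /Q nsum_0 ?scaler0 // => r.
  by rewrite hN ?nu0 ?scaler0 //; lia.
have E k : nu (mu (mu a p u) (l + k%:Z) v) (m + n - k%:Z) w =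
   nsum (fun s => sb p s *: P k s) - nsum (fun s => sb p s *: Q k s) - (-1) ^ p *:
   nsum (fun s => sb p s *: nu (mu u (p + (l + k%:Z) - s%:Z) (av s)) (m + n - k%:Z) w).
  rewrite (borcherds_iterate hau) (linB (nuL _ _)) (linZ (nuL _ _)).
  have [muf1 muf2] : fin1 (fun t => sb p t *: mu a (p - t%:Z) (mu u (l + k%:Z + t%:Z) v)) /\
      fin1 (fun t => sb p t *: mu u (p + (l + k%:Z) - t%:Z) (mu a t%:Z v)).
    split; apply: fin1Z.
      exists `|N - l|%N => s ks; rewrite hN ?(lin0 _) //; first by case: fmu.
      by lia.
    by have [J hJ] := avJ; exists J => s /hJ; rewrite /av => ->; rewrite (lin0 _) //; case: fmu.
  rewrite (lin_nsum (nuL _ _) muf1) (lin_nsum (nuL _ _) muf2); congr (_ - _ *: _); last first.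
    by apply: eq_nsum => t; rewrite (linZ (nuL _ _)).
  rewrite -nsumB; last 2 first.
  - exact/fin1Z/(fin2_row k fP).
  - exact/fin1Z/(fin2_row k fQ).
  apply: eq_nsum => s; rewrite (linZ (nuL _ _)) -scalerBr; congr (_ *: _).
  by rewrite (borcherds_iterate (ha _)).
have fPk : fin1 (fun k => nsum (fun s => sb p s *: P k s)).
  exact: (fin2_nsumr (fin2Z (fun _ => sb p) fP)).
have fQk : fin1 (fun k => nsum (fun s => sb p s *: Q k s)).
  exact: (fin2_nsumr (fin2Z (fun _ => sb p) fQ)).
rewrite /rexp -nsumB; [|exact: fin1Z|exact: fin1Z].
under [X in _ = X - _]eq_nsum => k do rewrite -scalerBr.
apply: nsum_subZ; [exact: E|exact: fin1B|].
exact: (fin2_nsumr (fin2Z (fun _ => sb p) (fav (fun k _ => m + n - Posz k)))).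
Qed.

(* Both sides are expanded into products of modes of a, u, v on w.  The terms match
   by 'C(p, t) 'C(t, j) = 'C(p, j) 'C(p - j, t - j) and Vandermonde's identity, once the
   Borcherds identities for (u, v) and (u, a_j v) have absorbed the infinite ranges. *)
Lemma borcherds_step : bor (mu a p u) v.
Proof.
move=> w l m n; rewrite lhs_left lhs_right rhs.
have hG v' w' : truncated1 (fun x y => nu (mu u x v') y w') by exact: iter_truncated.
pose e : K := (-1) ^ l; pose e' : K := (-1) ^ p.
have f1 : fin1 (fun t : nat => xexp (fun y x => nu v y (nu u x w)) l n (m + t%:Z)).
  by have := xexp_fin (fun _ => n) m (xexp_truncated l (prod_truncated v u w)).
have f2 : fin1 (fun t : nat => rexp (fun x y => nu (mu u x v) y w) l (m + t%:Z) n).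
  by apply: rexp_fin_mid => // x; exact: nuT.
(* The identity for (u, v) is solved for the product u v, as a sum; the scalar [- e] fits that sum
   to a lemma about differences. The same is then done with a_t w in place of w. *)
rewrite (@nsum_subZ _ _ _ (- e)
   (fun t => nu a (p - t%:Z) (xexp (fun x y => nu u x (nu v y w)) l (m + t%:Z) n))
   (fun t => nu a (p - t%:Z) (rexp (fun x y => nu (mu u x v) y w) l (m + t%:Z) n))
   (fun t => nu a (p - t%:Z) (xexp (fun y x => nu v y (nu u x w)) l n (m + t%:Z)))); last 3 first.
- by move=> t; rewrite -(linZ (nuR _ _)) -(linB (nuR _ _)) scaleNr opprK -(hu v w l) subrK.
- by have [M h] := f2; exists M => t /h ->.
- by have [M h] := f1; exists M => t /h ->.
have [A hA] := nuT a w; have [J hJ] := avJ.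
rewrite (@nsum_subZ _ _ _ (- e)
   (fun t => xexp (fun x y => nu u x (nu v y (nu a (Posz t) w))) l (m + (p - t%:Z)) n)
   (fun t => rexp (fun x y => nu (mu u x v) y (nu a (Posz t) w)) l (m + (p - t%:Z)) n)
   (fun t => xexp (fun y x => nu v y (nu u x (nu a (Posz t) w))) l n (m + (p - t%:Z))));
   last 3 first.
- by move=> t; rewrite scaleNr opprK -(hu v _ l) subrK.
- exists `|A|%N => t At; apply: nsum_0 => i; rewrite hA ?nur0 ?scaler0 //; lia.
- exists `|A|%N => t At; apply: nsum_0 => i; rewrite hA ?nur0 ?scaler0 //; lia.
have -> : nsum (fun j => sb p j *: xexp (H w j) (l + p - j%:Z) m n) =
   nsum (fun s => sb p s *: rexp (fun x y => nu (mu u x (av s)) y w) (l + p - s%:Z) m n) +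
   (e * e') *: nsum (fun j => B p j *: xexp (H' w j) (l + p - j%:Z) n m).
  have fH : fin1 (fun j => B p j *: xexp (H' w j) (l + p - j%:Z) n m).
    by apply: fin1Z; exists J => j /hJ h; apply: nsum_0 => i; rewrite /H' h nu0 scaler0.
  rewrite scale_nsum // -nsumD; last 2 first.
  - apply: fin1Z; exists J => j /hJ h; apply: nsum_0 => i.
    by rewrite h (lin0 _) ?nu0 ?scaler0 //; case: fmu.
  - exact: (fin1Z (fun _ => e * e')).
  apply: eq_nsum => j; rewrite -(hu (av j) w (l + p - j%:Z)).
  rewrite -/(H w j) -/(H' w j).
  rewrite scalerBr !scalerA.
  (* The sign in front of the H' term of the identity at l + p - j turns the signed weight of
     [left2] into the unsigned weight of [right1]. *)
  have -> : sb p j * (-1) ^ (l + p - j%:Z) = e * e' * B p j.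
    have -> : e * e' = (-1) ^ (l + p - j%:Z) * (-1) ^+ j.
      by rewrite -signD subrK expfzDr // oppr_eq0 oner_eq0.
    by rewrite /sbinom; ring.
  by rewrite subrK.
move: (nsum _) (nsum _) (nsum _) (nsum _) (nsum _) (nsum _) => x1 x2 x3 x4 x5 x6.
rewrite !scaleNr -/e -/e' !scalerDr !scalerN !scalerA !opprK [e' * (e * e')]mulrCA sign_sqr mulr1.
rewrite [e' * e]mulrC.
move: (e *: x5) (e' *: x4) ((e * e') *: x3) (e' *: x2) (e *: x1) => {e e'} y5 y4 y3 y2 y1.
by apply: (addIr (y5 - y1 - y3)); rewrite subrK !opprD [LHS](AC (2*(2*2)) ((1*3*5)*(2*6*4))).
Qed.

End Step.
End Modes.

(** * The Borcherds identity from generators *)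

Section LinearCombination.
Variables (K : numFieldType) (W : lmodType K).
Implicit Types F G : int -> int -> W.

Lemma borcherds_lin k F1 F1' G1 F2 F2' G2 F F' G :
  truncated2 F1 -> truncated2 F1' -> truncated1 G1 ->
  truncated2 F2 -> truncated2 F2' -> truncated1 G2 ->
  (forall x y, F x y = k *: F1 x y + F2 x y) ->
  (forall x y, F' x y = k *: F1' x y + F2' x y) ->
  (forall x y, G x y = k *: G1 x y + G2 x y) ->
  borcherds F1 F1' G1 -> borcherds F2 F2' G2 -> borcherds F F' G.
Proof.
move=> t1 t1' s1 t2 t2' s2 FE F'E GE b1 b2 l m n.
have -> : rexp G l m n = k *: rexp G1 l m n + rexp G2 l m n.
  by apply: nsum_lin => [i||]; [exact: GE|exact: rexp_fin|exact: rexp_fin].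
have -> : xexp F l m n = k *: xexp F1 l m n + xexp F2 l m n.
  by apply: nsum_lin => [i||]; [exact: FE|exact: xexp_fin|exact: xexp_fin].
have -> : xexp F' l n m = k *: xexp F1' l n m + xexp F2' l n m.
  by apply: nsum_lin => [i||]; [exact: F'E|exact: xexp_fin|exact: xexp_fin].
by rewrite -b1 -b2 scalerBr scalerDr !scalerA mulrC opprD addrACA.
Qed.
End LinearCombination.

Section PairLinear.
Variables (K : numFieldType) (V W : lmodType K).
Variables (mu : V -> int -> V -> V) (nu : V -> int -> W -> W).
Hypotheses (fmu : field_map mu) (fnu : field_map nu).
Local Notation bor := (borcherds_pair mu nu).

Let tp u v w := prod_truncated fnu u v w.
Let ti u v w := iter_truncated fmu fnu u v w.

Lemma bor_linl u1 u2 v k : bor u1 v -> bor u2 v -> bor (k *: u1 + u2) v.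
Proof.
have [nl nr _] := fnu; have [ml mr _] := fmu.
move=> b1 b2 w; apply: (borcherds_lin (tp _ _ _) (tp _ _ _) (ti _ _ _)
  (tp _ _ _) (tp _ _ _) (ti _ _ _) _ _ _ (b1 w) (b2 w)) => x y.
- exact: nl.
- by rewrite nl nr.
- by rewrite ml nl.
Qed.

Lemma bor_linr u v1 v2 k : bor u v1 -> bor u v2 -> bor u (k *: v1 + v2).
Proof.
have [nl nr _] := fnu; have [ml mr _] := fmu.
move=> b1 b2 w; apply: (borcherds_lin (tp _ _ _) (tp _ _ _) (ti _ _ _)
  (tp _ _ _) (tp _ _ _) (ti _ _ _) _ _ _ (b1 w) (b2 w)) => x y.
- by rewrite nl nr.
- by rewrite nl.
- by rewrite mr nl.
Qed.
End PairLinear.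

Section Generators.
Variables (K : numFieldType) (V W : lmodType K).
Variables (mu : V -> int -> V -> V) (nu : V -> int -> W -> W).
Hypotheses (fmu : field_map mu) (fnu : field_map nu).
Local Notation B := (binomz K).
Local Notation sb := (sbinom K).

Let nuL n w : linear (fun v => nu v n w). Proof. by case: fnu. Qed.
Let nuR v n : linear (nu v n). Proof. by case: fnu. Qed.
Let nuT v w : truncated (fun n => nu v n w). Proof. by case: fnu. Qed.
Let muT u v : truncated (fun n => mu u n v). Proof. by case: fmu. Qed.
Let nu0 n w : nu 0 n w = 0. Proof. exact: (lin0 (nuL n w)). Qed.
Let nur0 x n : nu x n 0 = 0. Proof. exact: (lin0 (nuR x n)). Qed.

Lemma borcherds_pair_intro u v :
  commutator_pair mu nu u v -> iterate_pair mu nu u v -> borcherds_pair mu nu u v.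
Proof.
move=> hc hi w; apply: borcherds_comm_iter.
- exact: (prod_truncated fnu).
- exact: (prod_truncated fnu).
- exact: (iter_truncated fmu fnu).
- by move=> m n; rewrite hc; apply: eq_nsum => j; rewrite add0r.
- by move=> l n; rewrite hi; congr (_ - _ *: _); apply: eq_nsum => t; rewrite ?addr0 ?add0r.
Qed.

(** The commutator with a_m acts as a derivation on the iterate formula for b_q v. The terms from
    [a, b] are modes of c and form the full identity for (c, v) at l = q, not just its commutator
    formula; the terms from [a, v] are iterate formulas for (b, a_j v). On the other side, a_j (b_q
    v) = b_q (a_j v) + c_(j + q) v gives the same two groups. *)
Lemma commutator_step (a b c v : V) q :
  (forall m n w, nu a m (nu b n w) - nu b n (nu a m w) = nu c (m + n) w) ->
  (forall m n x, mu a m (mu b n x) - mu b n (mu a m x) = mu c (m + n) x) ->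
  (forall x, iterate_pair mu nu b x) ->
  commutator_pair mu nu a v -> borcherds_pair mu nu c v ->
  commutator_pair mu nu a (mu b q v).
Proof.
move=> abW abV ib cav bcv m n w.
pose av j := mu a (Posz j) v.
have avJ : exists J, forall j, (J <= j)%N -> av j = 0.
  by have [N h] := muT a v; exists `|N|%N => j Nj; apply: h; lia.
pose f1 t := nu c (q + m - Posz t) (nu v (n + Posz t) w).
pose f2 t := nu v (q + n - Posz t) (nu c (m + Posz t) w).
pose F1 j t := nu b (q - Posz t) (nu (av j) (m + n - Posz j + Posz t) w).
pose F2 j t := nu (av j) (q + (m + n - Posz j) - Posz t) (nu b (Posz t) w).
have fF1 : fin2 F1.
  apply: fin2_box => [|j].
    by have [J h] := avJ; exists J => j t /h E; rewrite /F1 E nu0 nur0.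
  exact: (prod_fin fnu).
have fF2 : fin2 F2.
  apply: fin2_box => [|j].
    by have [J h] := avJ; exists J => j t /h E; rewrite /F2 E nu0.
  have [N h] := nuT b w; exists `|N|%N => t Nt; rewrite /F2 h ?nur0 //; lia.
have ff1 : fin1 f1 by exact: (prod_fin fnu).
have ff2 : fin1 f2 by exact: (prod_fin fnu).
have fBF1 := fin2Z (fun j t => B m j) fF1.
have fBF2 := fin2Z (fun j t => B m j) fF2.
have -> : nsum (fun j => B m j *: nu (mu a j%:Z (mu b q v)) (m + n - j%:Z) w) =
    (nsum (fun t => sb q t *: f1 t) - (-1) ^ q *: nsum (fun t => sb q t *: f2 t)) +
    (nsum (fun t => sb q t *: nsum (fun j => B m j *: F1 j t)) - (-1) ^ q *:
     nsum (fun t => sb q t *: nsum (fun j => B m j *: F2 j t))).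
  rewrite (bcv w q m n) -(nsum_swapZ _ _ fF1) -(nsum_swapZ _ _ fF2).
  rewrite -(@nsum_subZ _ _ _ _ (fun j => nsum (fun t => sb q t *: F1 j t) -
    (-1) ^ q *: nsum (fun t => sb q t *: F2 j t))); first last.
  - exact: (fin2_nsumr (fin2Z (fun _ => sb q) fF2)).
  - exact: (fin2_nsumr (fin2Z (fun _ => sb q) fF1)).
  - by move=> i; reflexivity.
  rewrite /rexp -nsumD; last 2 first.
  - exact/fin1Z/(rexp_fin (fun k => m + n - Posz k) q (iter_truncated fmu fnu c v w)).
  - have [J h] := avJ; exists J => j /h E; rewrite !nsum_0 ?scaler0 ?subrr ?scaler0 // => t.
      by rewrite /F2 E nu0 scaler0.
    by rewrite /F1 E nu0 nur0 scaler0.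
  apply: eq_nsum => j; rewrite -scalerDr; congr (_ *: _).
  have /eqP := abV j%:Z q v; rewrite subr_eq => /eqP ->.
  by rewrite (linD (nuL _ _)) [j%:Z + q]addrC (ib (av j) q).
have [g1 g2] := iter_fin fnu b v q n w.
have [h1 h2] := iter_fin fnu b v q n (nu a m w).
rewrite !ib (linB (nuR _ _)) (linZ (nuR _ _)).
rewrite (lin_nsum (nuR _ _) g1) (lin_nsum (nuR _ _) g2).
have k1 := lin_fin1 (nuR a m) g1; have k2 := lin_fin1 (nuR a m) g2.
have -> (x y z t : W) : x - (-1) ^ q *: y - (z - (-1) ^ q *: t) = (x - z) - (-1) ^ q *: (y - t).
  by rewrite scalerBr !opprB addrACA [RHS]addrACA; congr (_ + _); exact: addrC.
rewrite -!nsumB //.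
have -> (x y z t : W) : x - (-1) ^ q *: y + (z - (-1) ^ q *: t) = (x + z) - (-1) ^ q *: (y + t).
  by rewrite scalerDr opprD addrACA.
rewrite -!nsumD; last 4 first.
- exact: fin1Z.
- exact/fin1Z/fin2_nsuml.
- exact: fin1Z.
- exact/fin1Z/fin2_nsuml.
congr (_ - _ *: _); apply: eq_nsum => t; rewrite (linZ (nuR _ _)) -scalerBr -scalerDr;
  congr (_ *: _).
- have /eqP := abW m (q - t%:Z) (nu v (n + t%:Z) w); rewrite subr_eq => /eqP ->.
  rewrite -addrA -(linB (nuR _ _)) cav; congr (_ + _); first by congr (nu _ _ _); lia.
  rewrite (lin_nsum (nuR _ _)).
    by apply: eq_nsum => j; rewrite (linZ (nuR _ _)); congr (_ *: nu _ _ (nu _ _ _)); lia.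
  by have [J h] := avJ; exists J => j /h E; rewrite -/(av j) E nu0 scaler0.
- have /eqP := cav m (q + n - t%:Z) (nu b t%:Z w); rewrite subr_eq => /eqP ->.
  rewrite -addrA -(linB (nuR _ _)) abW addrC; congr (_ + _).
  by apply: eq_nsum => j; congr (_ *: nu _ _ _); lia.
Qed.
End Generators.

Section Generated.
Variables (K : numFieldType) (V : lmodType K) (A : Type) (gen : A -> V) (br : A -> A -> A).

Definition loop_relations (W : lmodType K) (nu : V -> int -> W -> W) : Prop :=
  forall a b m n w, nu (gen a) m (nu (gen b) n w) - nu (gen b) n (nu (gen a) m w) =
    nu (gen (br a b)) (m + n) w.

(** Generation is encoded as an induction principle, so that it can be passed directly to [elim]. *)
Definition generated (mu : V -> int -> V -> V) : Prop :=
  forall P : V -> Prop, (forall k u v, P u -> P v -> P (k *: u + v)) ->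
    (forall a, P (gen a)) -> (forall a n v, P v -> P (mu (gen a) n v)) -> forall v, P v.

Section Borcherds.
Variable mu : V -> int -> V -> V.
Hypotheses (fmu : field_map mu) (rmu : loop_relations mu) (gmu : generated mu).
Hypothesis mu_gen : forall a b (j : nat),
  mu (gen a) j%:Z (gen b) = if j is 0%N then gen (br a b) else 0.

Section GenBorcherds.
Variables (W : lmodType K) (nu : V -> int -> W -> W).
Hypotheses (fnu : field_map nu) (rnu : loop_relations nu).
Hypothesis inu : forall a v, iterate_pair mu nu (gen a) v.

(** The induction on v runs for all a at once, since the step to b_q v calls on both (a, v) and
    ([a, b], v). *)
Lemma gen_borcherds a v : borcherds_pair mu nu (gen a) v.
Proof.
elim/gmu: v a => [k u v bu bv a|b a|b q v bv a].
- exact: (bor_linr fmu fnu).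
- apply: borcherds_pair_intro => // m n w.
  rewrite rnu nsum_first => [|j]; last first.
    by have [nl _ _] := fnu; rewrite mu_gen /= (lin0 (nl _ _)) scaler0.
  by rewrite mu_gen binomz0r scale1r subr0.
- apply: borcherds_pair_intro => //.
  apply: (commutator_step fmu fnu q (rnu a b) (rmu a b)) => //.
  exact: (borcherds_commutator (bv a)).
Qed.
End GenBorcherds.

Hypothesis imu : forall a v, iterate_pair mu mu (gen a) v.

(** Induction on u, with [borcherds_step] for a_p u. There [gen_borcherds] serves twice: on W for a
    with any vector, and with [nu] replaced by [mu] for the pair (a, u) inside V. *)
Lemma generated_borcherds (W : lmodType K) (nu : V -> int -> W -> W) :
  field_map nu -> loop_relations nu -> (forall a v, iterate_pair mu nu (gen a) v) ->
  forall u v, borcherds_pair mu nu u v.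
Proof.
move=> fnu rnu inu u; elim/gmu: u => [k u1 u2 b1 b2 v|a v|a p u bu v].
- exact: (bor_linl fmu fnu).
- exact: gen_borcherds.
- by apply: borcherds_step => // [v'|]; exact: gen_borcherds.
Qed.
End Borcherds.

(** The iterate formula determines the modes of a_p v from those of a and v, and the product of V
    enters it only through the modes of generators. So two products on V may differ a priori, and
    the lemma applies to algebra and module structures alike. *)
Lemma iterate_unique (mu mu' : V -> int -> V -> V) (W : lmodType K)
    (nu nu' : V -> int -> W -> W) :
  generated mu -> field_map nu -> field_map nu' ->
  (forall a n v, mu' (gen a) n v = mu (gen a) n v) ->
  (forall a n w, nu' (gen a) n w = nu (gen a) n w) ->
  (forall a v, iterate_pair mu nu (gen a) v) ->
  (forall a v, iterate_pair mu' nu' (gen a) v) ->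
  forall v n w, nu' v n w = nu v n w.
Proof.
move=> gmu [nl _ _] [nl' _ _] mE nE i i' v; elim/gmu: v => [k u v IHu IHv|a|a p v IH] n w //.
  by rewrite nl' nl IHu IHv.
rewrite i -mE i'; congr (_ - _ *: _); apply: eq_nsum => t; rewrite IH nE //.
Qed.
End Generated.

(** * The loop algebra acting on fields *)

Section FieldSpace.
Variables (K : numFieldType) (W : lmodType K).

Definition is_field (f : int -> W -> W) : Prop :=
  (forall n, linear (f n)) /\ (forall w, truncated (fun n => f n w)).

Definition field_pred : {pred int -> W -> W} := fun f => `[< is_field f >].

Lemma field_submod : submod_closed field_pred.
Proof.
split.
  apply/asboolP; split=> [n c x y|w]; first by rewrite [RHS]addr0 [RHS]scaler0.
  by exists 0 => n _.
move=> c f h /asboolP [fl ft] /asboolP [hl ht]; apply/asboolP; split=> [n k x y|w].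
  change (c *: f n (k *: x + y) + h n (k *: x + y) =
    k *: (c *: f n x + h n x) + (c *: f n y + h n y)).
  by rewrite fl hl !scalerDr !scalerA mulrC addrACA.
have [M fM] := ft w; have [N hN] := ht w; exists (Num.max M N) => n.
rewrite ge_max => /andP[Mn Nn]; move: (fM n Mn) (hN n Nn) => {}fM {}hN.
by change (c *: f n w + h n w = 0); rewrite fM hN scaler0 addr0.
Qed.
HB.instance Definition _ := GRing.isSubmodClosed.Build K (int -> W -> W) field_pred field_submod.

(* the space of fields Hom(W, W((x))), by modes *)
Record field := Field { field_val :> int -> W -> W; _ : field_val \in field_pred }.
HB.instance Definition _ := [isSub for field_val].
HB.instance Definition _ := [Choice of field by <:].
HB.instance Definition _ := [SubChoice_isSubLmodule of field by <:].

Lemma field_linear (f : field) n : linear (f n).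
Proof. by case: f => f /= /asboolP []. Qed.

Lemma field_truncated (f : field) w : truncated (fun n => f n w).
Proof. by case: f => f /= /asboolP []. Qed.

Lemma field_eq (f h : field) : (forall n w, f n w = h n w) -> f = h.
Proof. by move=> fh; apply: val_inj; apply/funext => n; apply/funext => w; exact: fh. Qed.

Lemma in_field_pred f : is_field f -> f \in field_pred.
Proof. by move=> hf; apply/asboolP. Qed.

Definition mk_field f (hf : is_field f) : field := Field (in_field_pred hf).

Lemma field_linE c (f h : field) n w : (c *: f + h : field) n w = c *: f n w + h n w.
Proof. by []. Qed.
End FieldSpace.

Section FieldProduct.
Variables (K : numFieldType) (W : lmodType K).
Local Notation sb := (sbinom K).
Implicit Types (C D E f : field W) (p q n : int) (w : W).

(** The p-th product of fields, Res_(x1) of (x1 - x)^p C(x1) f(x) - (-x + x1)^p f(x) C(x1). It is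
    the right-hand side of the iterate formula, which thus says that Y_W turns a_p into the p-th
    product with a(x). *)
Definition field_prod_mode C p f : int -> W -> W := fun n w =>
  nsum (fun t => sb p t *: C (p - t%:Z) (f (n + t%:Z) w)) -
  (-1) ^ p *: nsum (fun t => sb p t *: f (p + n - t%:Z) (C t%:Z w)).

Let f0 f n : f n 0 = 0. Proof. exact: (lin0 (field_linear f n)). Qed.

Lemma field_prod_fin1 C f n w (x : nat -> int) : fin1 (fun t => C (x t) (f (n + t%:Z) w)).
Proof. by have [N h] := field_truncated f w; exists `|N - n|%N => t Nt; rewrite h ?f0 //; lia. Qed.

Lemma field_prod_fin2 C f w (x : nat -> int) : fin1 (fun t => f (x t) (C t%:Z w)).
Proof. by have [N h] := field_truncated C w; exists `|N|%N => t Nt; rewrite h ?f0 //; lia. Qed.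

Lemma field_prod_is_field C p f : is_field (field_prod_mode C p f).
Proof.
split=> [n k x y|w].
  have L1 t z : linear (fun w => C z (f (n + Posz t) w)).
    by move=> c u v; rewrite field_linear field_linear.
  have L2 t z : linear (fun w => f z (C (Posz t) w)).
    by move=> c u v; rewrite field_linear field_linear.
  rewrite /field_prod_mode (@nsum_lin _ _ _ k _ (fun t => C (p - t%:Z) (f (n + t%:Z) x))
    (fun t => C (p - t%:Z) (f (n + t%:Z) y))); try exact: field_prod_fin1; last first.
    by move=> t; apply: L1.
  rewrite (@nsum_lin _ _ _ k (fun t => f (p + n - t%:Z) (C t%:Z (k *: x + y)))
    (fun t => f (p + n - t%:Z) (C t%:Z x))
    (fun t => f (p + n - t%:Z) (C t%:Z y))); try exact: field_prod_fin2; last first.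
    by move=> t; apply: L2.
  by rewrite scalerBr scalerDr !scalerA mulrC opprD addrACA.
have [N hN] := field_truncated f w; have [T hT] := field_truncated C w.
(* C_t w is 0 for t >= T, so finitely many vectors remain and one bound M for f serves them all;
   then n >= M + T - p gives p + n - t >= M for t < T. *)
have [M hM] : exists M, forall (t : nat) n, t%:Z < T -> M <= n -> f n (C t%:Z w) = 0.
  have [k hk] : exists k : nat, T <= k%:Z by exists `|T|%N; lia.
  suff [M hM] : exists M, forall (t : nat) n, (t < k)%N -> M <= n -> f n (C t%:Z w) = 0.
    by exists M => t n tT; apply: hM; lia.
  elim: k {hk} => [|k [M IH]]; first by exists 0.
  have [M' hM'] := field_truncated f (C k%:Z w).
  exists (Num.max M M') => t n; rewrite ltnS leq_eqVlt ge_max => /orP[/eqP ->|tk] /andP[Mn M'n].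
    exact: hM'.
  exact: IH.
exists (Num.max N (M + T - p)) => n; rewrite ge_max => /andP[Nn Mn].
rewrite /field_prod_mode !nsum_0 ?scaler0 ?subrr // => t.
  have [tT|Tt] := ltP t%:Z T; last by rewrite hT ?f0 ?scaler0.
  by rewrite hM ?scaler0 //; lia.
by rewrite hN ?f0 ?scaler0 //; lia.
Qed.

Definition field_prod C p f : field W := mk_field (field_prod_is_field C p f).

Lemma field_prodE C p f n w : field_prod C p f n w = 
  nsum (fun t => sb p t *: C (p - t%:Z) (f (n + t%:Z) w)) -
  (-1) ^ p *: nsum (fun t => sb p t *: f (p + n - t%:Z) (C t%:Z w)).
Proof. by []. Qed.

Lemma field_prod_linearr C p : linear (field_prod C p).
Proof.
move=> k f h; apply: field_eq => n w; rewrite field_linE !field_prodE.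
rewrite (@nsum_lin _ _ _ k _ (fun t => C (p - t%:Z) (f (n + t%:Z) w))
    (fun t => C (p - t%:Z) (h (n + t%:Z) w))); try exact: field_prod_fin1; last first.
  by move=> t; rewrite field_linE field_linear.
rewrite (@nsum_lin _ _ _ k (fun t => (k *: f + h : field W) (p + n - t%:Z) (C t%:Z w))
    (fun t => f (p + n - t%:Z) (C t%:Z w)) (fun t => h (p + n - t%:Z) (C t%:Z w)));
    try exact: field_prod_fin2; last by [].
by rewrite scalerBr scalerDr !scalerA mulrC opprD addrACA.
Qed.

Lemma field_prod_linearl p f : linear (fun C => field_prod C p f).
Proof.
move=> k C D; apply: field_eq => n w; rewrite field_linE !field_prodE.
rewrite (@nsum_lin _ _ _ k _ (fun t => C (p - t%:Z) (f (n + t%:Z) w))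
    (fun t => D (p - t%:Z) (f (n + t%:Z) w))); try exact: field_prod_fin1; last by [].
rewrite (@nsum_lin _ _ _ k (fun t => f (p + n - t%:Z) ((k *: C + D : field W) t%:Z w))
    (fun t => f (p + n - t%:Z) (C t%:Z w)) (fun t => f (p + n - t%:Z) (D t%:Z w)));
    try exact: field_prod_fin2; last first.
  by move=> t; rewrite field_linE field_linear.
by rewrite scalerBr scalerDr !scalerA mulrC opprD addrACA.
Qed.

Section Quad.
Variables (C D : field W) (p q : int) (f : field W) (n : int) (w : W).

Let X1 t s := C (p - Posz t) (D (q - Posz s) (f (n + Posz t + Posz s) w)).
Let X2 t s := C (p - Posz t) (f (q + (n + Posz t) - Posz s) (D (Posz s) w)).
Let X3 t s := D (q - Posz s) (f (p + n - Posz t + Posz s) (C (Posz t) w)).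
Let X4 t s := f (q + (p + n - Posz t) - Posz s) (D (Posz s) (C (Posz t) w)).

Lemma quad1_fin : fin2 X1.
Proof.
have [N h] := field_truncated f w; exists `|N - n|%N => t s ts.
by rewrite /X1 h ?f0 //; lia.
Qed.

Lemma quad2_fin : fin2 X2.
Proof.
apply: fin2_half => [|s].
  by have [N h] := field_truncated D w; exists `|N|%N => t s Ns; rewrite /X2 h ?f0 //; lia.
have [N h] := field_truncated f (D (Posz s) w); exists `|(N - (q + n - s%:Z))%R|%N => t Nt.
by rewrite /X2 h ?f0 //; lia.
Qed.

Lemma quad3_fin : fin2 X3.
Proof.
apply: fin2_box => [|t].
  by have [N h] := field_truncated C w; exists `|N|%N => t s Ns; rewrite /X3 h ?f0 //; lia.
have [N h] := field_truncated f (C (Posz t) w); exists `|(N - (p + n - t%:Z))%R|%N => s Ns.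
by rewrite /X3 h ?f0 //; lia.
Qed.

Lemma quad4_fin : fin2 X4.
Proof.
apply: fin2_box => [|t].
  by have [N h] := field_truncated C w; exists `|N|%N => t s Ns; rewrite /X4 h ?f0 //; lia.
have [N h] := field_truncated D (C (Posz t) w); exists `|N|%N => s Ns.
by rewrite /X4 h ?f0 //; lia.
Qed.

Definition quad t s := (sb p t * sb q s) *:
  (X1 t s - (-1) ^ q *: X2 t s - (-1) ^ p *: (X3 t s - (-1) ^ q *: X4 t s)).

Lemma quad_fin : fin2 quad.
Proof.
apply/fin2Z/fin2B; first by apply: fin2B quad1_fin _; exact: (fin2Z (fun _ _ => _) quad2_fin).
apply: (fin2Z (fun _ _ => _)); apply: fin2B quad3_fin _.
exact: (fin2Z (fun _ _ => _) quad4_fin).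
Qed.

Lemma field_prod_fprod : field_prod C p (field_prod D q f) n w = nsum (fun t => nsum (quad t)).
Proof.
have fq1 := fin2Z (fun _ s => sb q s) quad1_fin.
have fq2 := fin2Z (fun _ s => sb q s) quad2_fin.
have fq3 := fin2Z (fun _ s => sb q s) quad3_fin.
have fq4 := fin2Z (fun _ s => sb q s) quad4_fin.
have fq12 := fin2B fq1 (fin2Z (fun _ _ => (-1) ^ q) fq2).
have fq34 := fin2B fq3 (fin2Z (fun _ _ => (-1) ^ q) fq4).
pose Y12 t := nsum (fun s => sb q s *: X1 t s - (-1) ^ q *: (sb q s *: X2 t s)).
pose Y34 t := nsum (fun s => sb q s *: X3 t s - (-1) ^ q *: (sb q s *: X4 t s)).
have E12 t : C (p - t%:Z) (field_prod D q f (n + t%:Z) w) = Y12 t.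
  rewrite field_prodE (linB (field_linear _ _)) (linZ (field_linear _ _)).
  have g1 : fin1 (fun s => sb q s *: D (q - s%:Z) (f (n + t%:Z + s%:Z) w)).
    exact/fin1Z/field_prod_fin1.
  have g2 : fin1 (fun s => sb q s *: f (q + (n + t%:Z) - s%:Z) (D s%:Z w)).
    exact/fin1Z/field_prod_fin2.
  rewrite !(lin_nsum (field_linear _ _)) // scale_nsum; last first.
    exact: (lin_fin1 (field_linear C _) g2).
  rewrite -nsumB; first by apply: eq_nsum => s; rewrite !(linZ (field_linear _ _)).
    exact: (lin_fin1 (field_linear C _) g1).
  exact: (fin1Z (fun _ => _) (lin_fin1 (field_linear C _) g2)).
have E34 t : field_prod D q f (p + n - t%:Z) (C t%:Z w) = Y34 t.
  rewrite field_prodE scale_nsum -?nsumB //.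
  - exact: (fin2_row t fq3).
  - exact: (fin2_row t (fin2Z (fun _ _ => (-1) ^ q) fq4)).
  - exact/fin1Z/field_prod_fin2.
rewrite field_prodE.
rewrite (eq_nsum (f := fun t => sb p t *: C _ _) (h := fun t => sb p t *: Y12 t)); last first.
  by move=> t; rewrite E12.
rewrite (eq_nsum (f := fun t => sb p t *: field_prod _ _ _ _ _)
  (h := fun t => sb p t *: Y34 t)); last first.
  by move=> t; rewrite E34.
have gY12 : fin1 Y12 by exact: fin2_nsumr fq12.
have gY34 : fin1 Y34 by exact: fin2_nsumr fq34.
rewrite -(@nsum_subZ _ _ _ _ (fun t => Y12 t - (-1) ^ p *: Y34 t)) //.
apply: eq_nsum => t.
have h12 := fin2_row t fq12; have h34 := fin2_row t fq34.
have h34' := fin1Z (fun _ => (-1) ^ p) h34.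
rewrite /Y12 /Y34 (scale_nsum _ h34) -(nsumB h12 h34') (scale_nsum _ (fin1B h12 h34')).
apply: eq_nsum => s; rewrite /quad -scalerA; congr (_ *: _); rewrite !(scalerBr, scalerA).
by congr (_ - _ *: _ - (_ *: _ - _ *: _)); ring.
Qed.
End Quad.

(** Each double product expands into the orderings C D f, C f D, D f C and f D C. In the difference
    the two orderings with f in the middle cancel, the outer ones become commutators of C and D,
    hence modes of E depending on t + s only, and Vandermonde sums over t + s = k. *)
Lemma field_prod_comm C D E p q f :
  (forall m n w, C m (D n w) - D n (C m w) = E (m + n) w) ->
  field_prod C p (field_prod D q f) - field_prod D q (field_prod C p f) = field_prod E (p + q) f.
Proof.
move=> CD; apply: field_eq => n w.
change (field_prod C p (field_prod D q f) n w - field_prod D q (field_prod C p f) n w =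
  field_prod E (p + q) f n w).
have fQ := quad_fin C D p q f n w; have fQ' := quad_fin D C q p f n w.
rewrite (field_prod_fprod C D p q f n w) (field_prod_fprod D C q p f n w) (nsum_swap fQ').
rewrite -(nsumB (fin2_nsumr fQ) (fin2_nsuml fQ')).
pose Z1 t s := E (p + q - Posz t - Posz s) (f (n + Posz t + Posz s) w).
pose Z2 t s := f (p + q + n - Posz t - Posz s) (E (Posz t + Posz s) w).
have E12 t s : quad C D p q f n w t s - quad D C q p f n w s t =
    (sb p t * sb q s) *: (Z1 t s - (-1) ^ (p + q) *: Z2 t s).
  rewrite /quad [sb q s * _]mulrC -scalerBr; congr (_ *: _).
  have -> : Z1 t s = C (p - t%:Z) (D (q - s%:Z) (f (n + t%:Z + s%:Z) w)) -
      D (q - s%:Z) (C (p - t%:Z) (f (n + s%:Z + t%:Z) w)).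
    by rewrite [n + s%:Z + _]addrAC CD /Z1; congr (E _ _); lia.
  have -> : Z2 t s = f (q + (p + n - t%:Z) - s%:Z) (C t%:Z (D s%:Z w)) -
      f (q + (p + n - t%:Z) - s%:Z) (D s%:Z (C t%:Z w)).
    by rewrite -(linB (field_linear _ _)) CD /Z2; congr (f _ _); lia.
  have -> : p + n - t%:Z + s%:Z = p + (n + s%:Z) - t%:Z by lia.
  have -> : q + n - s%:Z + t%:Z = q + (n + t%:Z) - s%:Z by lia.
  have -> : p + (q + n - s%:Z) - t%:Z = q + (p + n - t%:Z) - s%:Z by lia.
  have -> : (-1) ^ (p + q) = (-1) ^ p * (-1) ^ q :> K.
    by rewrite expfzDr // oppr_eq0 oner_eq0.
  move: ((-1) ^ p : K) ((-1) ^ q : K) => e e'.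
  move: (C _ _) (D _ (C _ _)) (C _ (f _ _)) (D _ (f _ _)) (f _ (D _ _)) (f _ (C _ _)).
  move=> y1 y2 y3 y4 y5 y6.
  rewrite !scalerBr !scalerA [e' * e]mulrC.
  rewrite !opprB [LHS](AC ((2*2)*(2*2)) ((1*8)*(3*6)*((7*4)*(5*2)))).
  by rewrite /= !subrr !addr0.
pose Q t s := (sb p t * sb q s) *: (Z1 t s - (-1) ^ (p + q) *: Z2 t s).
have fQ2 : fin2 Q by apply: (fin2_ext E12); apply: fin2B fQ _; exact: fin2_sym.
rewrite (eq_nsum (h := fun t => nsum (Q t))) => [|t]; last first.
  rewrite -(nsumB (fin2_row t fQ) (fin2_col t fQ')); apply: eq_nsum => s; exact: E12.
rewrite nsum_diag // field_prodE.
rewrite -(@nsum_subZ _ _ _ _ (fun t => E (p + q - t%:Z) (f (n + t%:Z) w) -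
  (-1) ^ (p + q) *: f (p + q + n - t%:Z) (E t%:Z w))) //; last 2 first.
- exact: field_prod_fin1.
- exact: field_prod_fin2.
apply: eq_nsum => k; rewrite sbinom_vandermonde scaler_suml; apply: eq_bigr => i _.
rewrite /Q /Z1 /Z2; have ik : (i <= k)%N by rewrite -ltnS.
have -> : p + q - i%:Z - (k - i)%N%:Z = p + q - k%:Z by lia.
have -> : n + i%:Z + (k - i)%N%:Z = n + k%:Z by lia.
have -> : p + q + n - i%:Z - (k - i)%N%:Z = p + q + n - k%:Z by lia.
by have -> : i%:Z + (k - i)%N%:Z = k%:Z by lia.
Qed.

End FieldProduct.

Section LoopAction.
Variables (K : fieldType) (h : leibnizType K) (M : lmodType K).
Variable phi : int -> h -> M -> M.
Hypothesis phi_linl : forall n m, linear (fun a => phi n a m).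
Hypothesis phi_linr : forall n a, linear (phi n a).
Hypothesis phi_br : forall p q a b m,
  phi p a (phi q b m) - phi q b (phi p a m) = phi (p + q) (lbr a b) m.

Definition loop_act (x : loop int h) (m : M) : M := gsum (fun n a => phi n a m) x.

Let phiD m n : {morph (fun a => phi n a m) : a b / a + b}.
Proof. by move=> a b; exact: (linD (phi_linl n m)). Qed.

Lemma loop_actU n a m : loop_act << a *g n >> m = phi n a m.
Proof. by rewrite /loop_act gsumU //; exact: phiD. Qed.

Lemma loop_actD x y m : loop_act (x + y) m = loop_act x m + loop_act y m.
Proof. by rewrite /loop_act gsumD //; exact: phiD. Qed.

Lemma loop_act0 m : loop_act 0 m = 0. Proof. exact: gsum0. Qed.

Lemma loop_act_linearl m : linear (fun x => loop_act x m).
Proof.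
move=> c x y; rewrite loop_actD; congr (_ + _).
elim/malg_elim: x => [|n a|u v IHu IHv].
- by rewrite scaler0 loop_act0 scaler0.
- by rewrite loopZU !loop_actU (linZ (phi_linl n m)).
- by rewrite scalerDr !loop_actD IHu IHv scalerDr.
Qed.

Lemma loop_act_linearr x : linear (loop_act x).
Proof.
move=> c m m'; elim/malg_elim: x => [|n a|u v IHu IHv].
- by rewrite !loop_act0 scaler0 addr0.
- by rewrite !loop_actU phi_linr.
- by rewrite !loop_actD IHu IHv scalerDr addrACA.
Qed.

Lemma loop_act_module : leibniz_module loop_act.
Proof.
split; [exact: loop_act_linearl|exact: loop_act_linearr|move=> x y m].
change (loop_act x (loop_act y m) - loop_act y (loop_act x m) = loop_act (loop_br x y) m).
have lr z := linD (loop_act_linearr z); have lr0 z := lin0 (loop_act_linearr z).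
elim/malg_elim: x => [|p a|u v IHu IHv].
- by rewrite loop_br0l !loop_act0 lr0 subrr.
- elim/malg_elim: y => [|q b|u v IHu IHv].
  + by rewrite loop_br0r !loop_act0 lr0 subrr.
  + by rewrite loop_brU !loop_actU phi_br.
  + by rewrite loop_brDr !loop_actD lr -IHu -IHv opprD addrACA.
- by rewrite loop_brDl !loop_actD lr -IHu -IHv opprD addrACA.
Qed.
End LoopAction.

(** * Frobenius reciprocity for induced modules *)

Section UactFacts.
Variables (K : fieldType) (h : leibnizType K) (M : lmodType K) (act : h -> M -> M).
Hypothesis act_mod : leibniz_module act.

Lemma Uact_linearl m : linear (fun p => Uact act p m).
Proof.
move=> c p q; have [a ->] := Upi_surj p; have [b ->] := Upi_surj q.
by rewrite -(Upi_linear c) !(Uact_pi act_mod) (free_act_linearl act).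
Qed.

Lemma Uact_linearr p : linear (Uact act p).
Proof. exact: (free_act_linear act_mod). Qed.

Lemma Uact1 m : Uact act 1 m = m.
Proof.
have -> : (1 : Uenv h) = Upi (1 : freealg K h) by [].
by rewrite (Uact_pi act_mod) fword_nil /free_act fextU.
Qed.

Lemma Uenv_elim (P : Uenv h -> Prop) : P 0 -> P 1 ->
  (forall c p q, P p -> P q -> P (c *: p + q)) ->
  (forall x p, P p -> P (Ugen x * p)) -> forall p, P p.
Proof.
move=> P0 P1 PL PM p; have [a ->] := Upi_surj p.
elim/freealg_elim: a => [|c w|u v Pu Pv].
- by rewrite (lin0 (@Upi_linear _ _)).
- rewrite (linZ (@Upi_linear _ _)) -[_ *: _]addr0; apply: PL => //.
  elim: w => [|x w IH]; first exact: P1.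
  rewrite -cat1s fword_cat Upi_mul.
  by have := PM x _ IH; rewrite Ugen.unlock.
- by rewrite (linD (@Upi_linear _ _)) -[Upi u]scale1r; exact: PL.
Qed.
End UactFacts.

Section InducedLift.
Variables (K : fieldType) (h' h : leibnizType K) (j : h' -> h).
Variables (N : lmodType K) (act : h' -> N -> N) (M : lmodType K) (actM : h -> M -> M).
Variable phi : N -> M.
Hypotheses (j_morph : lie_morph j) (act_mod : leibniz_module act).
Hypotheses (actM_mod : leibniz_module actM) (phil : linear phi).
Hypothesis phi_act : forall x y, phi (act x y) = actM (j x) (phi y).

Let f (u : Uenv h) (y : N) : M := Uact actM u (phi y).

(** The h-linear map with u (x) y |-> u . phi y. It is balanced over U(h') because [phi_act],
    assumed for elements of h', extends to products by [Uenv_elim]. *)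
Definition ind_lift (v : induced j act) : M := tensor_ext f v.

Let fl y : linear (fun u => f u y). Proof. exact: Uact_linearl. Qed.

Let fr u : linear (f u).
Proof. by move=> c x y; rewrite /f phil (Uact_linearr actM_mod). Qed.

Lemma Umap_linear : linear (Umap j).
Proof.
move=> c p q; have [a ->] := Upi_surj p; have [b ->] := Upi_surj q.
by rewrite -(Upi_linear c) !(Umap_pi j_morph) (free_map_linear j).
Qed.

Lemma Umap1 : Umap j 1 = 1.
Proof.
have -> : (1 : Uenv h') = Upi (1 : freealg K h') by [].
by rewrite (Umap_pi j_morph) fword_nil /free_map fextU big_nil.
Qed.

Let phi_Uact p y : Uact actM (Umap j p) (phi y) = phi (Uact act p y).
Proof.
elim/Uenv_elim: p => [||c p q IHp IHq|x p IH].
- rewrite (lin0 Umap_linear) (lin0 (Uact_linearl actM_mod _)).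
  by rewrite (lin0 (Uact_linearl act_mod _)) (lin0 phil).
- by rewrite Umap1 (Uact1 actM_mod) (Uact1 act_mod).
- by rewrite Umap_linear (Uact_linearl actM_mod) (Uact_linearl act_mod) phil IHp IHq.
- rewrite (UmapM j_morph) (Umap_gen j_morph) (UactM actM_mod) IH (Uact_gen actM_mod).
  by rewrite (UactM act_mod) (Uact_gen act_mod) phi_act.
Qed.

Let fb u p y : f (u * Umap j p) y = f u (Uact act p y).
Proof. by rewrite /f (UactM actM_mod) phi_Uact. Qed.

Lemma ind_lift_tens u y : ind_lift (ind_tens j act u y) = Uact actM u (phi y).
Proof. by rewrite ind_tens.unlock; exact: (tensor_extE fl fr fb). Qed.

Lemma ind_lift_linear : linear ind_lift.
Proof. exact: (tensor_ext_linear fl fr fb). Qed.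

Lemma ind_lift1 y : ind_lift (ind_tens j act 1 y) = phi y.
Proof. by rewrite ind_lift_tens (Uact1 actM_mod). Qed.

Lemma ind_lift_act x v : ind_lift (ind_act x v) = actM x (ind_lift v).
Proof.
have Ll := ind_lift_linear; have Al := lmod_linearr actM_mod x.
have Il := ind_act_linear (j := j) (act := act) x.
elim/ind_elim: v => [|c u y|v w IHv IHw].
- by rewrite (lin0 Il) (lin0 Ll) (lin0 Al).
- rewrite (linZ Il) !(linZ Ll) (linZ Al) (ind_actE j act) !ind_lift_tens.
  by rewrite (UactM actM_mod) (Uact_gen actM_mod).
- by rewrite (linD Il) !(linD Ll) (linD Al) IHv IHw.
Qed.
End InducedLift.

(** * The module Vg *)

Section VgInduction.
Variables (K : fieldType) (g : leibnizType K).

Lemma loop_toLieU (a : g) (n : int) :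
  loop_map id (@toLie K g) << a *g n >> = << toLie a *g n >> :> loop int (gLie g).
Proof.
have tD : {morph @toLie K g : x y / x + y} by exact: raddfD.
by rewrite /loop_map gsumU // => m x y; rewrite tD monalgUD.
Qed.

Lemma Vg_actU (a : g) (n : int) (v : Vg g) :
  Vg_act << a *g n >> v = ind_act (<< toLie a *g n >> : loop int (gLie g)) v.
Proof. by rewrite /Vg_act loop_toLieU. Qed.

(** Every element of [gLie g] is the class of some a, so the operators a (x) t^n already generate
    the action of U(L(gLie)) on 1 (x) g. *)
Lemma Vg_ind (P : Vg g -> Prop) :
  (forall k u v, P u -> P v -> P (k *: u + v)) -> (forall a, P (Vg_in a)) ->
  (forall a n v, P v -> P (Vg_act << a *g n >> v)) -> forall v, P v.
Proof.
move=> PL Pin Pact.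
have P0 : P 0 by rewrite -(addNr (Vg_in 0)) -scaleN1r; exact: PL.
have PD u v : P u -> P v -> P (u + v) by rewrite -[u in P (u + v)]scale1r; exact: PL.
have PZ k u : P u -> P (k *: u) by rewrite -[k *: u]addr0 => Pu; exact: PL.
have Pz z v : P v -> P (ind_act z v).
  have Il := ind_act_module (@pos_incl K g) (@pos_act K g).
  move=> Pv; elim/malg_elim: z => [|n x|x y Px Py].
  - by rewrite (lin0 (lmod_linearl Il v)).
  - by have [a ->] := toLieK x; rewrite -Vg_actU; exact: Pact.
  - by rewrite (linD (lmod_linearl Il v)); exact: PD.
elim/ind_elim => [//|c u y|v w]; last exact: PD.
apply: PZ; elim/Uenv_elim: u => [||d p q Pp Pq|x p Pp].
- by rewrite (lin0 (ind_tens_linearl _ _ y)).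
- exact: Pin.
- by rewrite ind_tens_linearl; exact: PL.
- by rewrite -ind_actE; exact: Pz.
Qed.
End VgInduction.

(** For n >= 0 both sums stop at t = n. Reversing the second pairs the terms into commutators, all
    equal to E_(n + k), with total weight [sbinom K (n - 1) n]: this is 1 for n = 0 and 0 for n >
    0. *)
Lemma field_prod_nonneg (K : numFieldType) (W : lmodType K) (C D E : field W) (n : nat) :
  (forall p q w, C p (D q w) - D q (C p w) = E (p + q) w) ->
  field_prod C n%:Z D = if n is 0%N then E else 0.
Proof.
move=> CD; apply: field_eq => k w; rewrite field_prodE.
have sb0 t : (n < t)%N -> sbinom K n%:Z t = 0.
  by move=> nt; rewrite /sbinom binomz_small // mulr0.
have S (f : nat -> W) : nsum (fun t => sbinom K n t *: f t) =
    \sum_(t < n.+1) sbinom K n t *: f t.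
  by apply: nsumE => t /sb0 ->; rewrite scale0r.
rewrite !S.
rewrite [X in _ - _ *: X](reindex_inj rev_ord_inj) /= scaler_sumr -sumrB.
rewrite (eq_bigr (fun t : 'I_n.+1 => sbinom K n%:Z t *: E (n%:Z + k) w)) => [|t _].
  rewrite -scaler_suml sbinom_sum; case: n {sb0 S} => [|n].
    by rewrite sbinom0r scale1r add0r.
  rewrite -addn1 PoszD addrK /sbinom binomz_small ?addn1 // mulr0 scale0r.
  by [].
have tn : (t <= n)%N by rewrite -ltnS.
have -> : n%:Z + k = n%:Z - t%:Z + (k + t%:Z) by lia.
rewrite -CD scalerBr scalerA; congr (_ *: C _ (D _ _) - _ *: D _ (C _ _)).
- rewrite /sbinom subSS !binomz_nat bin_sub // mulrA -exprnP -exprD; congr (_ * _).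
  have -> : (n + (n - t) = 2 * (n - t) + t)%N by lia.
  by rewrite exprD exprM sqrrN !expr1n mul1r.
- by lia.
- by rewrite subSS; lia.
Qed.

Section Currents.
Variables (K : numFieldType) (g : leibnizType K) (W : lmodType K) (act : loop int g -> W -> W).
Hypotheses (act_mod : leibniz_module act) (act_res : restricted act).

Lemma current_is_field (a : g) : is_field (fun n w => act << a *g n >> w).
Proof. by split=> [n|w]; [exact: (lmod_linearr act_mod)|exact: act_res]. Qed.

Definition current_field (a : g) : field W := mk_field (current_is_field a).

Lemma current_field_linear : linear current_field.
Proof.
move=> c a b; apply: field_eq => n w; rewrite field_linE.
change (act << c *: a + b *g n >> w = c *: act << a *g n >> w + act << b *g n >> w).
by rewrite monalgUD -loopZU (lmod_linearl act_mod).
Qed.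

Lemma current_field_br (a b : g) m n w :
  current_field a m (current_field b n w) - current_field b n (current_field a m w) =
  current_field (lbr a b) (m + n) w.
Proof.
rewrite [LHS](lmod_br act_mod << a *g m >> << b *g n >> w).
by congr (act _ w); exact: loop_brU.
Qed.

(** [a_n, a_0] and [a_0, a_n] are opposite, yet both equal the mode [a, a]_n; twice this mode is
    therefore 0, and the characteristic is 0. Hence the currents factor through [gLie g]. *)
Lemma current_field_sq a : current_field (lbr a a) = 0.
Proof.
apply: field_eq => n w.
have E1 := current_field_br a a n 0 w; have E2 := current_field_br a a 0 n w.
move: E1 E2; rewrite addr0 add0r => E1 E2.
have : current_field (lbr a a) n w + current_field (lbr a a) n w = 0.
  by rewrite -{1}E1 -E2 subrKA subrr.
rewrite -mulr2n -scaler_nat => /eqP.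
by rewrite scaler_eq0 pnatr_eq0 => /eqP.
Qed.

Definition current_Lie (x : gLie g) : field W := current_field (lrepr x).

Lemma current_toLie a : current_Lie (toLie a) = current_field a.
Proof.
have sq0 v : squares v -> current_field v = 0 by move=> [b ->]; exact: current_field_sq.
exact: (lquot_lift current_field_linear sq0 (lreprK (toLie a))).
Qed.

Lemma current_Lie_linear : linear current_Lie.
Proof.
move=> c x y; have [a ->] := toLieK x; have [b ->] := toLieK y.
by rewrite -linearP !current_toLie current_field_linear.
Qed.

Lemma current_Lie_br x y m n w :
  current_Lie x m (current_Lie y n w) - current_Lie y n (current_Lie x m w) =
  current_Lie (lbr x y) (m + n) w.
Proof.
have [a ->] := toLieK x; have [b ->] := toLieK y.
by rewrite [lbr _ _]gLie_br_toLie !current_toLie current_field_br.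
Qed.

Definition field_act : loop int (gLie g) -> field W -> field W :=
  loop_act (fun n x f => field_prod (current_Lie x) n f).

Lemma field_act_module : leibniz_module field_act.
Proof.
apply: loop_act_module => [n f c x y|n x|p q x y f].
- by rewrite current_Lie_linear field_prod_linearl.
- exact: field_prod_linearr.
- by apply: field_prod_comm => m n w; exact: current_Lie_br.
Qed.

Lemma field_actU (a : g) n f :
  field_act (<< toLie a *g n >> : loop int (gLie g)) f = field_prod (current_field a) n f.
Proof.
rewrite /field_act loop_actU ?current_toLie // => m f'.
by move=> c x y; rewrite current_Lie_linear field_prod_linearl.
Qed.

(** This is the equivariance required by [ind_lift]: products with nonnegative index of currents
    reproduce the action of L(gLie)^+ from which V_g is induced. *)
Lemma current_pos_act x a :
  current_field (pos_act x a) = field_act (pos_incl x) (current_field a).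
Proof.
have Fl := lmod_linearl field_act_module (current_field a).
have [il _] := pos_incl_morph g.
have pl : linear (fun x => pos_act x a) := lmod_linearl (pos_act_module g) a.
elim/malg_elim: x => [|n x|x y IHx IHy].
- by rewrite (lin0 pl) (lin0 il) (lin0 Fl) (lin0 current_field_linear).
- have -> : pos_incl << x *g n >> = << x *g n%:Z >> :> loop int (gLie g).
    by rewrite /pos_incl /loop_map gsumU // => m u v; rewrite monalgUD.
  have [b ->] := toLieK x; rewrite field_actU /pos_act mcoeffU.
  rewrite (field_prod_nonneg _ (current_field_br b a)).
  case: n => [|n]; rewrite /= ?mulr1n ?mulr0n ?gLie_act_toLie //.
  by rewrite (lin0 (gLie_act_linearl a)) (lin0 current_field_linear).
- by rewrite (linD pl) (linD il) (linD Fl) (linD current_field_linear) IHx IHy.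
Qed.
End Currents.

(** * The Jacobi identity in modes *)

(** In each Jacobi term the support of the summand over Z^3 is a curve, parametrized by the exponent
    s of the variable in whose nonnegative powers the delta function is expanded. *)
Lemma fsum_inj (W : zmodType) (T : choiceType) (F : T -> W) (h : nat -> T) :
  injective h -> (forall p, (forall s, p <> h s) -> F p = 0) ->
  \sum_(p \in [set: T]) F p = nsum (fun s => F (h s)).
Proof.
move=> hI F0; rewrite -(@fsbig_widen _ _ _ _ (range h)) //.
  by rewrite fsbig_image // => x y _ _; exact: hI.
move=> p [_ hp] /=; apply: F0 => s ps; apply: hp; exists s => //.
Qed.

Local Arguments subpow : simpl never.

Section Jacobi.
Variables (K : numFieldType) (V W : lmodType K).

(* the mode v_n w is the coefficient of x^(-n-1) *)
Definition modes (YW : V -> W -> int -> W) : V -> int -> W -> W :=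
  fun v n w => YW v w (- n - 1).

Lemma field_map_modes (YW : V -> W -> int -> W) : vertex_map YW -> field_map (modes YW).
Proof.
move=> [Yl Yr Yt]; split=> [n w|v n|v w]; [exact: Yl|exact: Yr|].
have [N h] := Yt v w; exists (- N) => n Nn; apply: h; lia.
Qed.

Lemma vertex_map_modes (nu : V -> int -> W -> W) :
  field_map nu -> vertex_map (fun v w k => nu v (- k - 1) w).
Proof.
move=> [nl nr nt]; split=> [w k|v k|v w]; [exact: nl|exact: nr|].
have [N h] := nt v w; exists (- N) => k Nk; apply: h; lia.
Qed.

Lemma subpow_nat n a (s : nat) : subpow K n a s%:Z = if a + s%:Z == n then sbinom K n s else 0.
Proof. by []. Qed.

Variables (Y : V -> V -> int -> V) (YW : V -> W -> int -> W).
Local Notation mu := (fun u n v => Y u v (- n - 1)).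
Local Notation nu := (modes YW).
Hypothesis vYW : vertex_map YW.

Lemma jacobi_uv u v w i j k :
  fmul3 (delta_12 K) (prod_uv YW u v w) i j k =
  xexp (fun x y => nu u x (nu v y w)) (- i - 1) (- j - 1) (- k - 1).
Proof.
(* The product is free of x0, so the delta function supplies the whole exponent i; x2 takes the
   expansion exponent s, and x1 the rest of the degree - i - 1. *)
pose h (s : nat) : int * int * int := (i, - i - 1 - s%:Z, s%:Z).
rewrite /fmul3 (fsum_inj (h := h)) => [|s t [_ []] //|[[p1 p2] p3] /= hp].
  apply: eq_nsum => s; rewrite /h /= /prod_uv subrr eqxx /delta_12 subpow_nat subrK eqxx.
  by congr (_ *: YW _ (YW _ _ _) _); lia.
rewrite /prod_uv /delta_12 subr_eq0; case: eqP => [ip|_]; last by rewrite scaler0.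
case: p3 hp => [s|s] hp; last by rewrite scale0r.
rewrite subpow_nat; case: eqP => [ps|_]; last by rewrite scale0r.
by case: (hp s); rewrite /h; congr (_, _, _); lia.
Qed.

Let vu_fin u v w n (f : nat -> int) : fin1 (fun i => nu v (f i) (nu u (n + i%:Z) w)).
Proof. exact: (prod_fin (field_map_modes vYW)). Qed.

Lemma jacobi_vu u v w i j k :
  fmul3 (delta_21 K) (prod_vu YW u v w) i j k =
  (-1) ^ (- i - 1) *: xexp (fun y x => nu v y (nu u x w)) (- i - 1) (- k - 1) (- j - 1).
Proof.
pose h (s : nat) : int * int * int := (i, s%:Z, - i - 1 - s%:Z).
rewrite /fmul3 (fsum_inj (h := h)) => [|s t [_ [] //]|[[p1 p2] p3] /= hp].
  rewrite /xexp scale_nsum; last exact/fin1Z/vu_fin.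
  apply: eq_nsum => s; rewrite /h /= /prod_vu subrr eqxx /delta_21 subpow_nat subrK eqxx scalerA.
  by congr (_ *: YW _ (YW _ _ _) _); lia.
rewrite /prod_vu /delta_21 subr_eq0; case: eqP => [ip|_]; last by rewrite scaler0.
case: p2 hp => [s|s] hp; last by rewrite mulr0 scale0r.
rewrite subpow_nat; case: eqP => [ps|_]; last by rewrite mulr0 scale0r.
by case: (hp s); rewrite /h; congr (_, _, _); lia.
Qed.

Lemma jacobi_iter u v w i j k :
  fmul3 (delta_10 K) (iterate_uv Y YW u v w) i j k =
  rexp (fun x y => nu (mu u x v) y w) (- i - 1) (- j - 1) (- k - 1).
Proof.
pose h (s : nat) : int * int * int := (s%:Z, j, - j - 1 - s%:Z).
rewrite /fmul3 (fsum_inj (h := h)) => [|s t [] //|[[p1 p2] p3] /= hp].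
  apply: eq_nsum => s; rewrite /h /= /iterate_uv subrr eqxx /delta_10 subpow_nat.
  have -> : - (- j - 1 - s%:Z) - 1 = j + s%:Z by lia.
  (* The exponent j + s of (x1 - x0) grows with s; upper negation replaces it by the fixed exponent
     - j - 1 of (x2 + x0). *)
  rewrite eqxx /sbinom binomz_negate.
  by congr (_ *: YW (Y _ _ _) _ _); lia.
rewrite /iterate_uv /delta_10 subr_eq0; case: eqP => [jp|_]; last by rewrite scaler0.
case: p1 hp => [s|s] hp; last by rewrite scale0r.
rewrite subpow_nat; case: eqP => [ps|_]; last by rewrite scale0r.
by case: (hp s); rewrite /h; congr (_, _, _); lia.
Qed.

Lemma jacobi_borcherds : jacobi Y YW <-> forall u v, borcherds_pair mu nu u v.
Proof.
split=> [J u v w l m n|bor u v w i j k].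
  have := J u v w (- l - 1) (- m - 1) (- n - 1).
  rewrite jacobi_uv jacobi_vu jacobi_iter.
  have E (x : int) : - (- x - 1) - 1 = x by lia.
  by rewrite !E.
by rewrite jacobi_uv jacobi_vu jacobi_iter; exact: bor.
Qed.
End Jacobi.

(** * Restrictedness of V_g and the map Y_W *)

Section Existence.
Variables (K : numFieldType) (g : leibnizType K).

(** Induction over V_g for all a at once: a_n b_q v = b_q a_n v + [a, b]_(n + q) v needs the bounds
    for both a and [a, b], the latter shifted by q. On 1 (x) g all modes with n >= 1 vanish. *)
Lemma Vg_restricted : restricted (@Vg_act K g).
Proof.
have [al ar ab] := Vg_act_module g.
move=> a v; elim/Vg_ind: v a => [k u v IHu IHv a|b a|b q v IH a].
- have [M hM] := IHu a; have [N hN] := IHv a; exists (Num.max M N) => n.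
  by rewrite ge_max => /andP[Mn Nn]; rewrite ar hM ?hN // scaler0 addr0.
- exists 1 => n n1; have -> : n = (`|n|%N.-1.+1)%:Z by lia.
  exact: Vg_act_pos.
- have [M hM] := IH a; have [N hN] := IH (lbr a b); exists (Num.max M (N - q)) => n.
  rewrite ge_max => /andP[Mn Nn].
  have /eqP := ab << a *g n >> << b *g q >> v; rewrite subr_eq => /eqP ->.
  rewrite hM // (lin0 (ar _)) addr0.
  have -> : lbr (<< a *g n >> : loop int g) << b *g q >> = << lbr a b *g n + q >>.
    exact: loop_brU.
  by apply: hN; lia.
Qed.

Section Module.
Variables (W : lmodType K) (act : loop int g -> W -> W).
Hypotheses (act_mod : leibniz_module act) (act_res : restricted act).

Definition Y_field (v : Vg g) : field W :=
  ind_lift (field_act act_mod act_res) (current_field act_mod act_res) v.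

Definition Y_mode (v : Vg g) (n : int) (w : W) : W := Y_field v n w.

Let hyps := (pos_incl_morph g, pos_act_module g, field_act_module act_mod act_res,
  current_field_linear act_mod act_res, current_pos_act act_mod act_res).

Lemma Y_field_linear : linear Y_field.
Proof. by apply: ind_lift_linear; apply hyps. Qed.

Lemma Y_field_in a : Y_field (Vg_in a) = current_field act_mod act_res a.
Proof. by apply: ind_lift1; apply hyps. Qed.

Lemma Y_field_act a n v : Y_field (Vg_act << a *g n >> v) =
  field_prod (current_field act_mod act_res a) n (Y_field v).
Proof.
rewrite Vg_actU -field_actU; apply: ind_lift_act; apply hyps.
Qed.

Lemma Y_mode_field_map : field_map Y_mode.
Proof.
split=> [n w c u v|v n|v w].
- by rewrite /Y_mode Y_field_linear.
- exact: field_linear.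
- exact: field_truncated.
Qed.

Lemma Y_mode_in a n w : Y_mode (Vg_in a) n w = act << a *g n >> w.
Proof. by rewrite /Y_mode Y_field_in. Qed.

Lemma Y_mode_relations : loop_relations (@Vg_in K g) lbr Y_mode.
Proof.
move=> a b m n w; rewrite !Y_mode_in (lmod_br act_mod).
by congr (act _ w); exact: loop_brU.
Qed.

(** This is the equivariance of [Y_field]. The product [mu] is left open because the one on V_g is
    itself obtained as [Y_mode] for W = V_g. *)
Lemma Y_mode_iterate (mu : Vg g -> int -> Vg g -> Vg g) :
  (forall a n v, mu (Vg_in a) n v = Vg_act << a *g n >> v) ->
  forall a v, iterate_pair mu Y_mode (Vg_in a) v.
Proof.
move=> muE a v p n w; rewrite muE {1}/Y_mode Y_field_act field_prodE.
by rewrite /Y_mode Y_field_in.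
Qed.
End Module.
End Existence.

(** * Existence and uniqueness of the structures *)

Section Main.
Variables (K : numFieldType) (g : leibnizType K).

Definition Vg_mode : Vg g -> int -> Vg g -> Vg g := Y_mode (Vg_act_module g) (@Vg_restricted K g).
Definition Vg_Y (u v : Vg g) (k : int) : Vg g := Vg_mode u (- k - 1) v.

Lemma opp_pred (n : int) : - (- n - 1) - 1 = n. Proof. lia. Qed.

Lemma modesK (V W : lmodType K) (nu : V -> int -> W -> W) :
  modes (fun v w k => nu v (- k - 1) w) = nu.
Proof. by apply/funext => v; apply/funext => n; apply/funext => w; rewrite /modes opp_pred. Qed.

Lemma Vg_mode_generated : generated (@Vg_in K g) Vg_mode.
Proof.
move=> P PL Pin Pact; apply: Vg_ind => // a n v Pv.
by rewrite -(Y_mode_in (Vg_act_module g) (@Vg_restricted K g)); exact: Pact.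
Qed.

Lemma Vg_mode_gen (a b : g) (j : nat) :
  Vg_mode (Vg_in a) j%:Z (Vg_in b) = if j is 0%N then Vg_in (lbr a b) else 0.
Proof. by rewrite /Vg_mode Y_mode_in; exact: Vg_act_pos. Qed.

Section Structure.
Variables (W : lmodType K) (act : loop int g -> W -> W).
Hypotheses (act_mod : leibniz_module act) (act_res : restricted act).

Definition Vg_YW (v : Vg g) (w : W) (k : int) : W := Y_mode act_mod act_res v (- k - 1) w.

Lemma Vg_YW_structure : vertex_module_structure Vg_Y Vg_YW.
Proof.
have Vin := Y_mode_in (Vg_act_module g) (@Vg_restricted K g).
have vY := vertex_map_modes (Y_mode_field_map act_mod act_res).
split=> //; apply/(jacobi_borcherds Vg_Y vY).
rewrite [modes _]modesK -/(modes Vg_Y) [modes _]modesK.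
apply: generated_borcherds.
- exact: Y_mode_field_map.
- exact: Y_mode_relations.
- exact: Vg_mode_generated.
- exact: Vg_mode_gen.
- exact: Y_mode_iterate.
- exact: Y_mode_field_map.
- exact: Y_mode_relations.
- exact: Y_mode_iterate.
Qed.

Lemma Vg_YW_in a w : Vg_YW (Vg_in a) w = current act a w.
Proof. by apply/funext => k; exact: Y_mode_in. Qed.

(** With W = V_g and [YW'] = [Y'] this is uniqueness of the algebra structure; with [Y'] = [Vg_Y] it
    is uniqueness of the module structure. *)
Lemma Vg_YW_unique (Y' : Vg g -> Vg g -> int -> Vg g) (YW' : Vg g -> W -> int -> W) :
  (forall a v, Y' (Vg_in a) v = current (@Vg_act _ g) a v) ->
  vertex_module_structure Y' YW' -> (forall a w, YW' (Vg_in a) w = current act a w) ->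
  Vg_YW = YW'.
Proof.
move=> Y'in [vY' jY'] YW'in.
have bor := proj1 (jacobi_borcherds Y' vY') jY'.
have E v n w : modes YW' v n w = Y_mode act_mod act_res v n w.
  apply: (iterate_unique (gen := @Vg_in K g) (mu := Vg_mode) (mu' := modes Y')) v n w.
  - exact: Vg_mode_generated.
  - exact: Y_mode_field_map.
  - exact: field_map_modes.
  - by move=> a n u; rewrite /modes Y'in /current opp_pred /Vg_mode Y_mode_in.
  - by move=> a n u; rewrite /modes YW'in /current opp_pred Y_mode_in.
  - by move=> a u; apply: Y_mode_iterate => b n x; exact: Y_mode_in.
  - by move=> a u p n w; exact: (borcherds_iterate (bor (Vg_in a) u)).
apply/funext => v; apply/funext => w; apply/funext => k.
by rewrite /Vg_YW -E /modes opp_pred.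
Qed.
End Structure.
End Main.

Theorem theorem3p5 (R : realType) (g : leibnizType R[i]) :
  exists Y : Vg g -> Vg g -> int -> Vg g,
    unique (fun Y => vertex_leibniz_structure Y /\
                     (forall (a : g) (v : Vg g), Y (Vg_in a) v = current (@Vg_act _ g) a v)) Y /\
    (forall (W : lmodType R[i]) (act : loop int g -> W -> W),
       leibniz_module act -> restricted act ->
       exists! YW : Vg g -> W -> int -> W,
         vertex_module_structure Y YW /\
         (forall (a : g) (w : W), YW (Vg_in a) w = current act a w)).
Proof.
have act_mod := Vg_act_module g; have act_res := @Vg_restricted _ g.
exists (Vg_Y (g := g)); split.
  split=> [|Y' [hY' Y'in]].
    (* For W = V_g, [Vg_YW] is [Vg_Y] by conversion, and an algebra structure is a module structure
       over itself. *)
    by split; [exact: Vg_YW_structure|exact: Vg_YW_in].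
  exact: (Vg_YW_unique _ _ Y'in hY' Y'in).
move=> W act am ar; exists (Vg_YW am ar); split=> [|YW' [hYW' YW'in]].
  by split; [exact: Vg_YW_structure|exact: Vg_YW_in].
by apply: Vg_YW_unique hYW' YW'in; exact: Vg_YW_in.
Qed.
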